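(* Let $V$ be a simple unitary strongly local vertex operator algebra and let $\mathcal{A}_V$ be the corresponding irreducible conformal net. Then, for any quasi-primary vector $a\in V$, we have $Y_I(a,f)=Y(a,f)$ for all $I\in\mathcal{I}$ and all $f\in C^\infty_c(I)$, i.e. the smeared vertex operators of $V$ coincide with the Fredenhagen–Jörß smeared vertex operators of $\mathcal{A}_V$. In particular, one can recover the VOA structure on $V=\mathcal{H}^{fin}$ from the conformal net $\mathcal{A}_V$ (i.e. the VOA structure on $V=\mathcal{H}^{fin}$ is determined by $\mathcal{A}_V$).
   Context: Unitary VOAs. Vertex algebras are over $\mathbb{C}$ and local (not super). A VOA $V$ has vacuum $\Omega$, vertex operators $Y(a,z)=\sum_n a_{(n)}z^{-n-1}$, conformal vector $\nu$ with $Y(\nu,z)=\sum_nL_nz^{-n-2}$ (Virasoro relations, $L_{-1}$ the infinitesimal translation operator), $V=\bigoplus_{n\in\mathbb{Z}}V_n$ with $V_n=\mathrm{Ker}(L_0-n1_V)$ finite-dimensional and zero for $n$ sufficiently small. For $a\in V_{d_a}$ put $a_n=a_{(n+d_a-1)}$, extended linearly to all $a\in V$. A homogeneous $a$ is quasi-primary if $L_1a=0$. $V$ is simple if it has no nontrivial ideals. A bilinear form is invariant if $(Y(a,z)b,c)=(b,Y(e^{zL_1}(-z^{-2})^{L_0}a,z^{-1})c)$. A scalar product (positive-definite, linear in the second variable) is normalized if $(\Omega|\Omega)=1$ and invariant if there is an antilinear vertex algebra automorphism $\theta$ of $V$ with $\theta\nu=\nu$ such that $(\theta\cdot|\cdot)$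 is an invariant bilinear form. A unitary VOA is a VOA with a normalized invariant scalar product. The net $\mathcal{A}_V$. Let $\mathcal{H}$ be the Hilbert space completion of $V$. $a\in V$ satisfies energy bounds if there are positive integers $s,k$ and $M>0$ with $\|a_nb\|\le M(|n|+1)^s\|(L_0+1_V)^kb\|$ for all $n\in\mathbb{Z}$, $b\in V$; $V$ is energy-bounded if every $a\in V$ does. Then for $f\in C^\infty(S^1)$ with Fourier coefficients $\hat f_n=\frac1{2\pi}\int_{-\pi}^{\pi}f(e^{i\vartheta})e^{-in\vartheta}d\vartheta$, the smeared vertex operator $Y(a,f)$ is the closure on $\mathcal{H}$ of $b\mapsto\sum_n\hat f_na_nb$, $b\in V$. Let $\mathcal{I}$ be the set of open, connected, non-empty, non-dense subsets of $S^1$, and $I'$ the interior of $S^1\setminus I$. For a family of closed densely defined operators, $W^*(\cdot)$ is the smallest von Neumann algebra to which all are affiliated. Put $\mathcal{A}_V(I)=W^*(\{Y(a,f):a\in V,\ f\in C^\infty(S^1),\ \mathrm{supp}f\subset I\})$. $V$ is strongly local if it is energy-bounded and $\mathcal{A}_V(I)\subset\mathcal{A}_V(I')'$ for all $I\in\mathcal{I}$. For simple strongly local $V$, $\mathcal{A}_V$ is an irreducible conformal net on $\mathcal{H}$ with vacuum $\Omega$ and representation of $\mathrm{Diff}^+(S^1)$ integrating the operators $L_n$. Fredenhagen–Jörß (FJ) smeared vertex operators. Let $\mathcal{A}$ be an irreducible Möbius covariant net on $\mathcal{H}$ with vacuum $\Omega$, $L_0$ the generator of rotations, $\mathcal{H}^{fin}=\bigoplus_{n\ge0}\mathrm{Ker}(L_0-n1_{\mathcal{H}})$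 (algebraic direct sum), and $L_{-1},L_0,L_1$ the operators on $\mathcal{H}^{fin}$ obtained by differentiating the representation of the Möbius group ($[L_1,L_{-1}]=2L_0$, $L_1\subset L_{-1}^*$). For a quasi-primary $a\in\mathcal{H}^{fin}$ ($L_0a=d_aa$, $L_1a=0$) and $f\in C^\infty(S^1)$ put $a(f)=\sum_{n\ge0}\hat f_{-n-d_a}\frac1{n!}L_{-1}^na\in\mathcal{H}$. For $I\in\mathcal{I}$ and $f\in C_c^\infty(I)$ (smooth on $S^1$ with support in $I$), the operator $A\Omega\mapsto Aa(f)$, $A\in\mathcal{A}(I)'$, is well defined, densely defined and closable; its closure is denoted $Y_I(a,f)$. *)

(* Defs.v *)
(* The real numbers are an arbitrary [R : realType], the complex numbers [R[i]]. *)
From HB Require Import structures.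
From mathcomp Require Import all_boot all_order all_algebra.
From mathcomp Require Import complex.
From mathcomp Require Import all_classical all_reals all_analysis.
Set Implicit Arguments.
Unset Strict Implicit.
Unset Printing Implicit Defensive.
Import Order.TTheory GRing.Theory Num.Theory.
Import numFieldNormedType.Exports.
Local Open Scope classical_set_scope.
Local Open Scope ring_scope.
Local Open Scope complex_scope.

Section Circle.
Variable R : realType.

Definition unit_circle : set R[i]^o := [set z | `|z| = 1].

(* [unit_circle] is used below as a type, carrying the induced topology. *)

Lemma expi_subproof (t : R) : unit_circle (cos t +i* sin t).
Proof. by rewrite /unit_circle /= normc_def /= cos2Dsin2 sqrtr1. Qed.

Definition expi (t : R) : unit_circle := SigSub (mem_set (expi_subproof t)).

Definition circle_val (z : unit_circle) : R[i] := set_val z.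

Definition smooth (g : R -> R) : Prop :=
  forall (n : nat) (x : R), derivable (derive1n n g) x 1.

Definition smooth_on_circle (f : unit_circle -> R[i]) : Prop :=
  smooth (fun t => complex.Re (f (expi t))) /\
  smooth (fun t => complex.Im (f (expi t))).

Definition circle_support (f : unit_circle -> R[i]) : set unit_circle :=
  closure [set z | f z != 0].

Definition test_function (I : set unit_circle) (f : unit_circle -> R[i]) :=
  smooth_on_circle f /\ circle_support f `<=` I.

Definition fourier (f : unit_circle -> R[i]) (n : int) : R[i] :=
  let g t := f (expi t) * circle_val (expi (- (n%:~R * t))) in
  ((2 * pi)^-1)%:C *
  ((\int[lebesgue_measure]_(t in `[- pi, pi]) complex.Re (g t)) +i*
   (\int[lebesgue_measure]_(t in `[- pi, pi]) complex.Im (g t))).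

Definition circle_interval (I : set unit_circle) : Prop :=
  [/\ open I, connected I, I !=set0 & ~ dense I].

Definition opposite (I : set unit_circle) : set unit_circle := (~` I)°.

Definition has_derivative (E : normedModType R[i]) (g : R -> E) (t : R) (y : E)
  : Prop :=
  (fun h : R => (h^-1)%:C *: (g (t + h) - g t)) @ 0^' --> y.

(* Flow of the vector field f(e^{it}) d/dt. *)
Definition is_flow (f : unit_circle -> R[i])
    (phi : R -> unit_circle -> unit_circle) : Prop :=
  (forall z, phi 0 z = z) /\
  forall t z, @has_derivative R[i]^o (fun s => circle_val (phi s z)) t
    ((0 +i* 1) * f (phi t z) * circle_val (phi t z)).

Definition one_field (z : unit_circle) : R[i] := 1.
Definition cos_field (z : unit_circle) : R[i] := (complex.Re (circle_val z))%:C.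
Definition sin_field (z : unit_circle) : R[i] := (complex.Im (circle_val z))%:C.

(* Orientation-preserving diffeomorphisms are described by their lifts. *)
Definition is_lift (phi : R -> R) (g : unit_circle -> unit_circle) : Prop :=
  [/\ smooth phi, forall t, 0 < derive1 phi t,
      forall t, phi (t + 2 * pi) = phi t + 2 * pi
    & forall t, g (expi t) = expi (phi t)].

Definition diffeo (g : unit_circle -> unit_circle) : Prop :=
  exists phi, is_lift phi g.

(* Sequential convergence in the (metrizable) smooth topology. *)
Definition diffeo_cvg (gs : nat -> unit_circle -> unit_circle)
    (g : unit_circle -> unit_circle) : Prop :=
  exists (phis : nat -> R -> R) (phi : R -> R),
    [/\ forall k, is_lift (phis k) (gs k), is_lift phi g
      & forall (n : nat) (e : R), 0 < e -> \forall k \near \oo,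
          forall t, - pi <= t <= pi ->
            `|derive1n n (phis k) t - derive1n n phi t| < e].

(* The action on the circle of the element of SU(1,1) with first row (a, b). *)
Definition mobius_map (a b : R[i]) (g : unit_circle -> unit_circle) : Prop :=
  `|a| ^+ 2 - `|b| ^+ 2 = 1 /\
  forall z, circle_val (g z) =
    (a * circle_val z + b) / (b^* * circle_val z + a^*).

Definition mobius (g : unit_circle -> unit_circle) : Prop :=
  exists a b, mobius_map a b g.

End Circle.

Section Hilbert.
Variable R : realType.

Definition scalar_product (V : lmodType R[i]) (form : V -> V -> R[i]) : Prop :=
  [/\ forall u (c : R[i]) v w, form u (c *: v + w) = c * form u v + form u w,
      forall u v, form v u = (form u v)^*
    & forall u, u != 0 -> 0 < form u u].

Variables (H : completeNormedModType R[i]) (ip : H -> H -> R[i]).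

Definition hilbert : Prop :=
  scalar_product ip /\ forall x, ip x x = `|x| ^+ 2.

Definition bounded_op : set (H -> H) := [set T | linear T /\ continuous T].

Definition adjoint_op (T S : H -> H) : Prop :=
  bounded_op S /\ forall x y, ip (S x) y = ip x (T y).

Definition unitary_op (T : H -> H) : Prop :=
  [/\ linear T, forall x y, ip (T x) (T y) = ip x y & range T = setT].

Definition commutant (X : set (H -> H)) : set (H -> H) :=
  [set T | bounded_op T /\ forall S, X S -> T \o S = S \o T].

Definition von_neumann (M : set (H -> H)) : Prop :=
  [/\ M `<=` bounded_op, forall T S, M T -> adjoint_op T S -> M S
    & commutant (commutant M) = M].

Definition vN_generated (X : set (H -> H)) : set (H -> H) :=
  [set T | forall M, von_neumann M -> X `<=` M -> M T].

(* An unbounded operator on H is represented by its graph, a subset of H * H;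
   the closure of an operator is the topological closure of its graph. *)

Definition affiliated (G : set (H * H)) (M : set (H -> H)) : Prop :=
  forall B, commutant M B -> forall x y, G (x, y) -> G (B x, B y).

Definition Wstar (F : set (set (H * H))) : set (H -> H) :=
  [set T | forall M, von_neumann M -> (forall G, F G -> affiliated G M) -> M T].

(* Self-adjoint generator A of [W t = exp (i t A)]. *)
Definition generator (W : R -> H -> H) : set (H * H) :=
  [set p | has_derivative (fun t => W t p.1) 0 ((0 +i* 1) *: p.2)].

Definition unitary_group (W : R -> H -> H) : Prop :=
  [/\ forall t, unitary_op (W t), forall x, W 0 x = x,
      forall s t x, W (s + t) x = W s (W t x)
    & forall x, continuous (fun t => W t x)].

Definition bilateral_sum (u : int -> H) (x : H) : Prop :=
  exists xp xn, [/\ series (fun k => u (Posz k)) @ \oo --> xp,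
    series (fun k => u (Negz k)) @ \oo --> xn & x = xp + xn].

End Hilbert.

Section Nets.
Variables (R : realType) (H : completeNormedModType R[i]) (ip : H -> H -> R[i]).
Local Notation S1 := (@unit_circle R).

(* [local_algebra] is only relevant on intervals and [mobius_rep] on Moebius
   transformations. *)
Record net := Net {
  local_algebra : set S1 -> set (H -> H);
  mobius_rep : (S1 -> S1) -> H -> H;
  net_vacuum : H }.

Variable N : net.

(* -i d/dt U(exp(t f d/dtheta)) at t = 0, with exp the flow. *)
Definition mobius_generator (f : S1 -> R[i]) : set (H * H) :=
  [set p | exists2 phi, is_flow f phi &
    generator (fun t => mobius_rep N (phi t)) p].

Definition net_L0 : set (H * H) := mobius_generator (@one_field R).

Definition Hfin : set H := [set v | exists (k : nat) (n : 'I_k -> nat)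
  (x : 'I_k -> H), (forall i, net_L0 (x i, (n i)%:R *: x i)) /\
                   v = \sum_(i < k) x i].

(* The field e^{i n t} d/dt corresponds to L_n: the fields cos and sin to
   (L_1 + L_{-1}) / 2 and (L_1 - L_{-1}) / (2 i). *)
Definition net_Lm1 : set (H * H) := [set p | Hfin p.1 /\
  exists u v, [/\ mobius_generator (@cos_field R) (p.1, u),
    mobius_generator (@sin_field R) (p.1, v) & p.2 = u - (0 +i* 1) *: v]].

Definition net_L1 : set (H * H) := [set p | Hfin p.1 /\
  exists u v, [/\ mobius_generator (@cos_field R) (p.1, u),
    mobius_generator (@sin_field R) (p.1, v) & p.2 = u + (0 +i* 1) *: v]].

Definition conjugate_alg (u : H -> H) (M : set (H -> H)) : set (H -> H) :=
  [set S : H -> H | exists2 T, M T & S \o u = u \o T].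

Definition all_local : set (H -> H) :=
  [set T | exists2 I, circle_interval I & local_algebra N I T].

Definition mobius_covariant_net : Prop :=
  (forall I, circle_interval I -> von_neumann ip (local_algebra N I)) /\
  (forall I J, circle_interval I -> circle_interval J -> I `<=` J ->
     local_algebra N I `<=` local_algebra N J) /\
  (forall I J, circle_interval I -> circle_interval J -> I `&` J = set0 ->
     local_algebra N I `<=` commutant (local_algebra N J)) /\
  (forall g, mobius g -> unitary_op ip (mobius_rep N g)) /\
  (forall g h, mobius g -> mobius h ->
     mobius_rep N (g \o h) = mobius_rep N g \o mobius_rep N h) /\
  (forall (a_ b_ : nat -> R[i]^o) (a b : R[i]^o) (gs : nat -> S1 -> S1) g x,
     (forall k, mobius_map (a_ k) (b_ k) (gs k)) -> mobius_map a b g ->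
     a_ @ \oo --> a -> b_ @ \oo --> b ->
     (fun k => mobius_rep N (gs k) x) @ \oo --> mobius_rep N g x) /\
  (forall g I, mobius g -> circle_interval I -> local_algebra N (g @` I) =
     conjugate_alg (mobius_rep N g) (local_algebra N I)) /\
  (forall x y, net_L0 (x, y) -> 0 <= ip x y) /\
  `|net_vacuum N| = 1 /\
  (forall g, mobius g -> mobius_rep N g (net_vacuum N) = net_vacuum N) /\
  closure [set T (net_vacuum N) | T in vN_generated ip all_local] = setT.

Definition irreducible_net : Prop := vN_generated ip all_local = @bounded_op R H.

(* U is a strongly continuous projective unitary representation of Diff^+(S^1),
   extending that of the Moebius group and making N a conformal net. *)
Definition diffeo_covariance (U : (S1 -> S1) -> H -> H) : Prop :=
  (forall g, diffeo g -> unitary_op ip (U g)) /\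
  (forall g h, diffeo g -> diffeo h -> exists2 c : R[i], `|c| = 1 &
     forall x, U (g \o h) x = c *: U g (U h x)) /\
  (forall gs g, diffeo_cvg gs g -> exists c : nat -> R[i],
     (forall k, `|c k| = 1) /\
     forall x, (fun k => c k *: U (gs k) x) @ \oo --> U g x) /\
  (forall g, mobius g -> U g = mobius_rep N g) /\
  (forall g I, diffeo g -> circle_interval I -> local_algebra N (g @` I) =
     conjugate_alg (U g) (local_algebra N I)) /\
  (forall g I T, diffeo g -> circle_interval I -> (forall z, opposite I z -> g z = z) ->
     local_algebra N (opposite I) T -> U g \o T = T \o U g).

Definition fj_vector (a : H) (f : S1 -> R[i]) : set H :=
  [set x | exists (d : nat) (w : nat -> H),
    [/\ net_L0 (a, d%:R *: a), net_L1 (a, 0), w 0%N = a,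
        forall n, net_Lm1 (w n, w n.+1)
      & series (fun n => (fourier f (- (n + d)%:Z) / (n`!)%:R) *: w n) @ \oo
          --> x]].

Definition fj_operator (I : set S1) (a : H) (f : S1 -> R[i]) : set (H * H) :=
  closure [set p | exists A x, [/\ commutant (local_algebra N I) A,
    fj_vector a f x & p = (A (net_vacuum N), A x)]].

End Nets.

Section VertexOperatorAlgebras.
Variables (R : realType) (V : lmodType R[i]).

(* [vop X a n b] is a_(n) b. *)
Record voa_data := VoaData {
  vop : V -> int -> V -> V;
  vacuum : V;
  conformal_vector : V }.

Variable X : voa_data.

Definition virL (n : int) : V -> V := vop X (conformal_vector X) (n + 1).

Definition weight_vector (d : int) (a : V) : Prop := virL 0 a = d%:~R *: a.

Definition quasi_primary (a : V) : Prop :=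
  exists2 d, weight_vector d a & virL 1 a = 0.

(* Vertex algebra with infinitesimal translation operator L_{-1}; locality is
   (z - w)^K [Y(a,z), Y(b,w)] = 0, read off coefficientwise. *)
Definition vertex_algebra : Prop :=
  (forall a n, linear (vop X a n)) /\
  (forall n b, linear (fun a => vop X a n b)) /\
  (forall a b, exists K : int, forall n, K <= n -> vop X a n b = 0) /\
  (forall n b, vop X (vacuum X) n b = if n == -1 then b else 0) /\
  (forall a, vop X a (-1) (vacuum X) = a) /\
  (forall a n, 0 <= n -> vop X a n (vacuum X) = 0) /\
  virL (-1) (vacuum X) = 0 /\
  (forall a n b, virL (-1) (vop X a n b) - vop X a n (virL (-1) b) =
     (- n)%:~R *: vop X a (n - 1) b) /\
  (forall a b, exists K : nat, forall (m n : int) (c : V),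
     \sum_(j < K.+1) ((-1) ^+ j * ('C(K, j))%:R : R[i]) *:
       (vop X a (m + (K - j)%N%:Z) (vop X b (n + j%:Z) c) -
        vop X b (n + j%:Z) (vop X a (m + (K - j)%N%:Z) c)) = 0).

Definition voa : Prop :=
  vertex_algebra /\
  (exists c : R[i], forall (m n : int) (b : V),
     virL m (virL n b) - virL n (virL m b) =
       (m - n)%:~R *: virL (m + n) b +
       (if m + n == 0 then (c / 12 * (m ^+ 3 - m)%:~R) *: b else 0)) /\
  (forall v, exists (s : seq int) (w : int -> V),
     (forall d, weight_vector d (w d)) /\ v = \sum_(d <- s) w d) /\
  (forall d, exists (k : nat) (e : 'I_k -> V), forall v, weight_vector d v ->
     exists c : 'I_k -> R[i], v = \sum_(i < k) c i *: e i) /\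
  (exists D : int, forall d v, d < D -> weight_vector d v -> v = 0).

(* a_n = a_(n + d - 1) for a of weight d, extended linearly in a. *)
Definition mode (a : V) (n : int) (b : V) : V :=
  xget 0 [set c | exists (s : seq int) (w : int -> V),
    [/\ uniq s, forall d, weight_vector d (w d), a = \sum_(d <- s) w d
      & c = \sum_(d <- s) vop X (w d) (n + d - 1) b]].

Definition ideal (J : set V) : Prop :=
  [/\ J 0, forall (c : R[i]) u v, J u -> J v -> J (c *: u + v),
      forall v, J v -> J (virL (-1) v)
    & forall a n v, J v -> J (vop X a n v)].

Definition simple_voa : Prop := forall J, ideal J -> J = [set 0] \/ J = setT.

(* (Y(a,z)b, c) = (b, Y(e^{z L_1} (-z^{-2})^{L_0} a, z^{-1}) c), coefficientwise
   for a of weight d; the sum over l is finite since L_1^K a = 0. *)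
Definition invariant_form (B : V -> V -> R[i]) : Prop :=
  forall (d : int) (K : nat) a, weight_vector d a -> iter K (virL 1) a = 0 ->
  forall (n : int) (b c : V),
    B (vop X a n b) c = (-1) ^ d * \sum_(l < K) (l`!)%:R^-1 *
      B b (vop X (iter l (virL 1) a) (2 * d - n - 2 - l%:Z) c).

Definition antilinear_automorphism (theta : V -> V) : Prop :=
  [/\ forall (c : R[i]) u v, theta (c *: u + v) = c^* *: theta u + theta v,
      bijective theta, theta (vacuum X) = vacuum X
    & forall a n b, theta (vop X a n b) = vop X (theta a) n (theta b)].

Definition unitary_voa (form : V -> V -> R[i]) : Prop :=
  [/\ voa, scalar_product form, form (vacuum X) (vacuum X) = 1
    & exists theta, [/\ antilinear_automorphism theta,
        theta (conformal_vector X) = conformal_vector X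
      & invariant_form (fun u v => form (theta u) v)]].

Definition energy_bounds (form : V -> V -> R[i]) (a : V) : Prop :=
  let nrm v := sqrtC (form v v) in
  exists (s k : nat) (M : R), [/\ (0 < s)%N, (0 < k)%N, 0 < M
    & forall (n : int) (b : V), nrm (mode a n b) <=
        M%:C * ((`|n|%N).+1%:R) ^+ s * nrm (iter k (fun v => virL 0 v + v) b)].

Definition energy_bounded (form : V -> V -> R[i]) : Prop :=
  forall a, energy_bounds form a.

Variables (H : completeNormedModType R[i]) (ip : H -> H -> R[i]) (iota : V -> H).
Local Notation S1 := (@unit_circle R).

Definition hilbert_completion (form : V -> V -> R[i]) : Prop :=
  [/\ hilbert ip, linear iota, forall u v, ip (iota u) (iota v) = form u v
    & dense (range iota)].

Definition smeared (a : V) (f : S1 -> R[i]) : set (H * H) :=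
  closure [set p | exists2 b, p.1 = iota b &
    bilateral_sum (fun n => fourier f n *: iota (mode a n b)) p.2].

Definition voa_algebra (I : set S1) : set (H -> H) :=
  Wstar ip [set G | exists a f, test_function I f /\ G = smeared a f].

Definition strongly_local (form : V -> V -> R[i]) : Prop :=
  energy_bounded form /\ forall I, circle_interval I ->
    voa_algebra I `<=` commutant (voa_algebra (opposite I)).

Definition simple_unitary_strongly_local (form : V -> V -> R[i]) : Prop :=
  [/\ unitary_voa form, simple_voa, hilbert_completion form
    & strongly_local form].

(* U integrates the operators L_n: for a real field f, U(exp(t f d/dtheta)) is
   exp(i t Y(nu, f)) up to a phase. *)
Definition integrates (U : (S1 -> S1) -> H -> H) : Prop :=
  forall f phi, smooth_on_circle f -> (forall z, f z \is Num.real) ->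
  is_flow f phi ->
  exists W, [/\ unitary_group ip W, generator W = smeared (conformal_vector X) f
    & forall t, exists2 c : R[i], `|c| = 1 & forall x, U (phi t) x = c *: W t x].

Definition net_of_voa (N : net H) : Prop :=
  [/\ mobius_covariant_net ip N, irreducible_net ip N,
      forall I, circle_interval I -> local_algebra N I = voa_algebra I,
      net_vacuum N = iota (vacuum X)
    & exists2 U, diffeo_covariance ip N U & integrates U].

End VertexOperatorAlgebras.

(* Main.v *)
(* The flows of the fields 1, cos, sin consist of Moebius transformations and
   Y(nu,f) kills Omega for these f, so the phases in exp(i t Y(nu,f)) are trivial
   and the Moebius generators of the net restrict to L_0, L_1, L_{-1} on V; hence
   V = H^fin, and the Fredenhagen-Joerss vector a(f) is Y(a,f) Omega.
   Y_I(a,f) is contained in Y(a,f), as the latter is affiliated with A(I).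
   Conversely let (xi, eta) be orthogonal to the graph of Y_I(a,f), and put
   ell(b) = <xi, b> + <eta, Y(a,f) b>. For b quasi-primary and g supported in I',
   Y(b,g) commutes with A(I), so (Y(b,g) Omega, Y(b,g) a(f)) is in that graph, and
   its second entry is Y(a,f) Y(b,g) Omega, because Y_I(a,f) is contained in
   Y(a,f). Thus sum_k ghat_{-k-d} ell(L_{-1}^k b / k!) = 0 for all such g; since g
   may be rotated a little, a power series vanishes on an arc, and all its
   coefficients are zero. The descendants of quasi-primary vectors span V, so
   ell = 0.
   For uniqueness, the same arc argument shows that the smeared operators of a
   quasi-primary a determine the modes of a. Locality and commutation with L_{-1}
   give the other modes. The two conformal vectors agree because their modes n = 0,
   1, 2 do and their difference is quasi-primary of weight 2. *)

(* The operator [Y(b,g)] is unbounded and only affiliated with the commutant of A(I), so it cannot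
   be inserted for A in the pairs (A Omega, A a(f)), and no polar decomposition is built. Instead
   the projection onto the closure of these pairs in [H * H] is split into four bounded entries;
   they lie in A(I) by the double commutant property, hence preserve the graph of [Y(b,g)] by strong
   locality. The operator theory thus reduces to projections, closed linear graphs, and
   single-valuedness of closures, which comes from densely defined adjoints. The test functions on
   I' are explicit: a flat bump in a rotated coordinate times a character. Rotating it multiplies
   the Fourier coefficients by phases, and the character selects the coefficient to be isolated.
   Convergence is always the balance of polynomial growth, from energy bounds, against rapid decay
   of Fourier coefficients. The generators of the net refer to any flow of a field, hence the
   explicit flows must also be shown to be unique. Reconstruction never compares representations of
   the diffeomorphism group; it uses the Moebius generators and the operators of one single
   interval. *)
Require Import Defs.
From HB Require Import structures.
From mathcomp Require Import all_boot all_order all_algebra.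
From mathcomp Require Import complex.
From mathcomp Require Import all_classical all_reals all_analysis.
From mathcomp Require Import ring lra zify.
Set Implicit Arguments.
Unset Strict Implicit.
Unset Printing Implicit Defensive.
Import Order.TTheory GRing.Theory Num.Theory.
Import numFieldNormedType.Exports.
Local Open Scope classical_set_scope.
Local Open Scope ring_scope.
Local Open Scope complex_scope.

(** * Norms and sesquilinear forms *)

Section RealNorm.
Variables (R : realType) (E : normedModType R[i]).
Implicit Types (x y : E) (u v : nat -> E) (c : R[i]).

(** The norm of a module over [R[i]] is itself an element of [R[i]]; its real part carries the same
    information and lives in an ordered field, where estimates can be closed by [lra]. *)
Definition rnorm x : R := complex.Re `|x|.

Lemma rnormE x : `|x| = (rnorm x)%:C.
Proof. by rewrite /rnorm RRe_real // normr_real. Qed.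

Lemma rnorm_ge0 x : 0 <= rnorm x.
Proof. by rewrite -ler0c -rnormE normr_ge0. Qed.

Lemma rnormD x y : rnorm (x + y) <= rnorm x + rnorm y.
Proof. by rewrite -lecR rmorphD /= -!rnormE ler_normD. Qed.

Lemma rnormN x : rnorm (- x) = rnorm x.
Proof. by rewrite /rnorm normrN. Qed.

Lemma rnormB x y : rnorm (x - y) = rnorm (y - x).
Proof. by rewrite -rnormN opprB. Qed.

Lemma rnorm0 : rnorm 0 = 0.
Proof. by rewrite /rnorm normr0. Qed.

Lemma rnorm_eq0 x : rnorm x = 0 -> x = 0.
Proof. by move=> h; apply/eqP; rewrite -normr_eq0 rnormE h. Qed.

Lemma rnormZ c x : rnorm (c *: x) = complex.Re `|c| * rnorm x.
Proof.
apply: (@complexI R); rewrite -rnormE normrZ rmorphM /= -rnormE; congr (_ * _).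
Qed.

Lemma rnormZr (r : R) x : 0 <= r -> rnorm (r%:C *: x) = r * rnorm x.
Proof. by move=> r0; rewrite rnormZ ger0_norm ?ler0c. Qed.

Lemma rnorm_triangle y x z : rnorm (x - z) <= rnorm (x - y) + rnorm (y - z).
Proof. by rewrite -{1}(subrK y x) -addrA rnormD. Qed.

Lemma rnorm_small_eq x y : (forall e : R, 0 < e -> rnorm (x - y) < e) -> x = y.
Proof.
move=> h; apply/eqP; rewrite -subr_eq0; apply/eqP/rnorm_eq0/eqP.
rewrite eq_le rnorm_ge0 andbT leNgt; apply/negP => p.
by have := h _ p; rewrite ltxx.
Qed.

Lemma rnorm_sum (I : Type) (s : seq I) (F : I -> E) :
  rnorm (\sum_(i <- s) F i) <= \sum_(i <- s) rnorm (F i).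
Proof.
elim: s => [|i s IH]; first by rewrite !big_nil rnorm0.
by rewrite !big_cons (le_trans (rnormD _ _)) // lerD2l.
Qed.

Lemma cvg_rnormP (T : Type) (F : set_system T) {FF : Filter F} (f : T -> E) x :
  f @ F --> x <-> forall e : R, 0 < e -> \forall t \near F, rnorm (f t - x) < e.
Proof.
split=> [/cvgrPdist_lt h e e0|h].
  have e0' : (0 : R[i]) < e%:C by rewrite ltcR.
  by move: (h _ e0'); apply: filterS => t; rewrite rnormE ltcR rnormB.
apply/cvgrPdist_lt => -[e e'] ; rewrite ltcE /= => /andP[/eqP -> e0].
by move: (h _ e0); apply: filterS => t; rewrite complexr0 rnormE ltcR rnormB.
Qed.

Lemma cvgn_rnormP u x : u @ \oo --> x <->
  forall e : R, 0 < e -> exists N, forall n, (N <= n)%N -> rnorm (u n - x) < e.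
Proof.
split=> [/cvg_rnormP h e /h [N _ hN]|h]; first by exists N => n /hN.
by apply/cvg_rnormP => e /h [N hN]; exists N.
Qed.

Lemma cvg_rnorm_uniq (T : Type) (F : set_system T) {FF : ProperFilter F}
    (f : T -> E) x y : f @ F --> x -> f @ F --> y -> x = y.
Proof. by apply: cvg_unique; exact: norm_hausdorff. Qed.

Lemma closure_rnormP (G : set E) x :
  closure G x <-> forall e : R, 0 < e -> exists2 y, G y & rnorm (y - x) < e.
Proof.
split=> [cG e e0|h].
  have e0' : (0 : R[i]) < e%:C by rewrite ltcR.
  have [y [Gy]] := cG _ (nbhsx_ballx x _ e0').
  by rewrite -ball_normE /= rnormE ltcR rnormB => yx; exists y.
move=> B /nbhs_ballP[[e e']] /=; rewrite ltcE /= => /andP[/eqP -> e0] eB.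
have [y Gy yx] := h _ e0; exists y; split => //; apply: eB.
by rewrite -ball_normE /= complexr0 rnormE ltcR rnormB.
Qed.

End RealNorm.

Lemma rnorm_le_norm (R : realType) (c : R[i]) : rnorm (c : R[i]^o) = complex.Re `|c|.
Proof. by []. Qed.

Section Complete.
Variables (R : realType) (E : completeNormedModType R[i]).
Implicit Types (u : nat -> E).

Lemma cauchy_rnorm_cvg u :
  (forall e : R, 0 < e -> exists N, forall n m, (N <= n)%N -> (N <= m)%N ->
     rnorm (u n - u m) < e) -> exists x : E, u @ \oo --> x.
Proof.
move=> h; suff : cvgn u by move=> c; exists (limn u).
apply/cauchy_cvgP; apply/cauchy_ballP => -[e e'].
rewrite ltcE /= => /andP[/eqP -> e0]; have [N hN] := h _ e0.
pose A := u @` [set n | (N <= n)%N].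
exists (A, A); first by split; exists N => // n /= Nn; exists n.
move=> [_ _] [/= [n /= Nn <-] [m /= Nm <-]]; rewrite -ball_normE /= complexr0 rnormE ltcR.
exact: hN.
Qed.

(** The Weierstrass test with a bound on the sum. The majorant has nonnegative terms, so bounded
    partial sums already make it converge, and its tails control those of the vector series. *)
Lemma series_rnorm_cvg u (b : nat -> R) (B : R) :
  (forall n, rnorm (u n) <= b n) -> (forall n, series b n <= B) ->
  exists2 x, series u @ \oo --> x & rnorm x <= B.
Proof.
move=> ub bB.
have b0 n : 0 <= b n by rewrite (le_trans (rnorm_ge0 (u n))).
have bnd : {homo series b : n m / (n <= m)%N >-> n <= m}.
  by apply/nondecreasing_seqP => n; rewrite seriesEnat /= big_nat_recr //= lerDl.
have cb : cvgn (series b).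
  apply: nondecreasing_is_cvgn => //; exists B => _ [n _ <-]; exact: bB.
have dist n m : (n <= m)%N -> rnorm (series u m - series u n) <= series b m - series b n.
  move=> nm; rewrite !sub_series_geq // (le_trans (rnorm_sum _ _)) //.
  by apply: ler_sum.
have [|x ux] := @cauchy_rnorm_cvg (series u).
  move=> e e0.
  have /cvgrPdist_lt/(_ (e / 2)) := cb.
  rewrite divr_gt0 // => /(_ isT) [N _ hN]; exists N => n m Nn Nm.
  wlog nm : n m Nn Nm / (m <= n)%N.
    move=> H; case/orP: (leq_total m n) => ?; first exact: H.
    by rewrite rnormB; exact: H.
  apply: (le_lt_trans (dist _ _ nm)).
  have /= := hN _ Nn; have /= := hN _ Nm; set l := lim _.
  have := ler_normB (l - series b m) (l - series b n).
  have := ler_norm (l - series b m - (l - series b n)).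
  rewrite (_ : l - series b m - (l - series b n) = series b n - series b m); last by ring.
  by move=> h1 h2 h3 h4; lra.
exists x => //; apply/ler_addgt0Pl => e e0.
have [N hN] := (cvgn_rnormP _ _).1 ux _ e0.
have h1 := hN _ (leqnn N).
have h2 : rnorm (series u N) <= B.
  apply: le_trans (bB N); rewrite !seriesEnat /=; apply: (le_trans (rnorm_sum _ _)).
  exact: ler_sum.
have := rnorm_triangle (series u N) x 0; rewrite !subr0 rnormB.
by move=> h3; lra.
Qed.

End Complete.

Lemma sqr_Re_norm (R : realType) (c : R[i]) : (complex.Re `|c| ^+ 2)%:C = c * (c^*)%C.
Proof. by rewrite -sqr_normc rmorphXn /=; congr (_ ^+ _); rewrite RRe_real ?normr_real. Qed.

Lemma Re_norm_ge0 (R : realType) (c : R[i]) : 0 <= complex.Re `|c|.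
Proof. exact: (@rnorm_ge0 R R[i]^o). Qed.

Lemma Re_normM (R : realType) (a b : R[i]) :
  complex.Re `|a * b| = complex.Re `|a| * complex.Re `|b|.
Proof. exact: (@rnormZ R R[i]^o a b). Qed.

Section Forms.
Variables (R : realType) (V : lmodType R[i]) (q : V -> V -> R[i]).
Hypothesis hq : scalar_product q.
Implicit Types (x y z : V) (c : R[i]).

Lemma spDr x y z : q x (y + z) = q x y + q x z.
Proof. by case: hq => l _ _; rewrite -(scale1r y) l mul1r scale1r. Qed.
Lemma sp0r x : q x 0 = 0.
Proof. by apply: (addIr (q x 0)); rewrite -spDr !add0r. Qed.
Lemma spZr c x y : q x (c *: y) = c * q x y.
Proof. by case: hq => l _ _; rewrite -[c *: y]addr0 l sp0r addr0. Qed.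
Lemma spNr x y : q x (- y) = - q x y.
Proof. by rewrite -scaleN1r spZr mulN1r. Qed.
Lemma spBr x y z : q x (y - z) = q x y - q x z.
Proof. by rewrite spDr spNr. Qed.
Lemma spC x y : q y x = (q x y)^*.
Proof. by case: hq => _ -> _. Qed.
Lemma spDl x y z : q (x + y) z = q x z + q y z.
Proof. by rewrite spC spDr rmorphD /= -!spC. Qed.
Lemma sp0l x : q 0 x = 0.
Proof. by rewrite spC sp0r rmorph0. Qed.
Lemma spZl c x y : q (c *: x) y = (c^*)%C * q x y.
Proof. by rewrite spC spZr rmorphM /= -spC. Qed.
Lemma spNl x y : q (- x) y = - q x y.
Proof. by rewrite spC spNr rmorphN /= -spC. Qed.
Lemma spBl x y z : q (x - y) z = q x z - q y z.
Proof. by rewrite spDl spNl. Qed.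
Lemma sp_ge0 x : 0 <= q x x.
Proof.
have [->|x0] := eqVneq x 0; first by rewrite sp0l.
by case: hq => _ _ /(_ _ x0) /ltW.
Qed.
Lemma sp_eq0 x : q x x = 0 -> x = 0.
Proof.
move=> h; apply/eqP/negPn/negP => x0.
by case: hq => _ _ /(_ _ x0); rewrite h ltxx.
Qed.
Lemma sp_sumr (I : Type) (s : seq I) (F : I -> V) x :
  q x (\sum_(i <- s) F i) = \sum_(i <- s) q x (F i).
Proof.
by elim: s => [|i s IH]; rewrite ?big_nil ?sp0r // !big_cons spDr IH.
Qed.

Definition sqform x : R := complex.Re (q x x).

Lemma sqformE x : q x x = (sqform x)%:C.
Proof. by rewrite /sqform RRe_real // ger0_real // sp_ge0. Qed.
Lemma sqform_ge0 x : 0 <= sqform x.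
Proof. by rewrite -ler0c -sqformE sp_ge0. Qed.
Lemma sqformZ c x : sqform (c *: x) = complex.Re `|c| ^+ 2 * sqform x.
Proof.
apply: (@complexI R); rewrite -sqformE spZl spZr mulrA [(c^*)%C * c]mulrC.
by rewrite sqformE rmorphM /= sqr_Re_norm.
Qed.
(** Here [c *: y] is the projection of [x] on the line of [y]; multiplying by [sqform y] clears the
    denominator in the theorem of Pythagoras. *)
Lemma sqform_residue x y c :
  y != 0 -> c = q y x / q y y ->
  sqform (x - c *: y) * sqform y = sqform x * sqform y - complex.Re `|q y x| ^+ 2.
Proof.
move=> y0 ->; have qy0 : q y y != 0 by apply: contra_neq y0; exact: sp_eq0.
apply: (@complexI R); rewrite rmorphB /= sqr_Re_norm !rmorphM /= -!sqformE //.
have -> : (q y x)^* = q x y by rewrite -spC.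
rewrite spBl !spBr !spZl !spZr rmorphM fmorphV /= -!spC.
by field.
Qed.

(** Obtained from the lower bound at the best multiple of [y]. For [d = 0] this is Cauchy-Schwarz;
    with [d] the squared distance to a subspace it says that an almost nearest point leaves an
    almost orthogonal remainder. *)
Lemma sqform_ineq x y (d : R) : (forall c, d <= sqform (x - c *: y)) ->
  complex.Re `|q y x| ^+ 2 <= (sqform x - d) * sqform y.
Proof.
move=> h; have [->|y0] := eqVneq y 0.
  by rewrite sp0l normr0 expr0n /sqform sp0l mulr0.
have := sqform_residue (x := x) y0 erefl.
set c := _ / _; move=> e.
have : d * sqform y <= sqform (x - c *: y) * sqform y.
  by rewrite ler_wpM2r ?sqform_ge0.
by rewrite e; lra.
Qed.

Lemma cauchy_schwarz x y : complex.Re `|q y x| ^+ 2 <= sqform x * sqform y.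
Proof.
have := @sqform_ineq x y 0; rewrite subr0; apply => c; exact: sqform_ge0.
Qed.

Lemma parallelogram x y :
  sqform (x + y) + sqform (x - y) = 2 * sqform x + 2 * sqform y.
Proof.
apply: (@complexI R); rewrite !rmorphD !rmorphM /= -!sqformE rmorph_nat.
by rewrite !(spDl, spDr, spNl, spNr) //; ring.
Qed.

End Forms.

Definition linear_set (K : numDomainType) (E : lmodType K) (G : set E) : Prop :=
  G 0 /\ forall (c : K) x y, G x -> G y -> G (c *: x + y).

Section LinearSetTheory.
Variables (K : numDomainType) (E : lmodType K) (G : set E).
Hypothesis hG : linear_set G.
Lemma linear_setD x y : G x -> G y -> G (x + y).
Proof. by move=> gx gy; rewrite -(scale1r x); apply: hG.2. Qed.
Lemma linear_setZ (c : K) x : G x -> G (c *: x).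
Proof. by move=> gx; rewrite -[_ *: _]addr0; apply: hG.2 => //; exact: hG.1. Qed.
Lemma linear_setN x : G x -> G (- x).
Proof. by move=> gx; rewrite -scaleN1r; exact: linear_setZ. Qed.
Lemma linear_setB x y : G x -> G y -> G (x - y).
Proof. by move=> gx gy; apply: linear_setD => //; exact: linear_setN. Qed.
End LinearSetTheory.

(** Completeness is a hypothesis of the projection theorem rather than part of the type, so that the
    theorem applies to [H * H], where graphs live. *)
Definition rcomplete (R : realType) (E : normedModType R[i]) : Prop :=
  forall u : nat -> E, (forall e : R, 0 < e -> exists N, forall n m,
    (N <= n)%N -> (N <= m)%N -> rnorm (u n - u m) < e) -> exists x : E, u @ \oo --> x.

(** * Orthogonal projection onto a closed subspace *)

Section Projection.
Variables (R : realType) (E : normedModType R[i]) (q : E -> E -> R[i]).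
Hypothesis hE : rcomplete E.
Hypothesis hq : scalar_product q.
Hypothesis q_lower : forall x, rnorm x ^+ 2 <= sqform q x.
Hypothesis q_upper : forall x, sqform q x <= 2 * rnorm x ^+ 2.
Variable G : set E.
Hypothesis Gsub : linear_set G.
Hypothesis Gcl : closed G.

Lemma invSn_small (e : R) : 0 < e -> exists N, forall n, (N <= n)%N -> n.+1%:R^-1 < e.
Proof.
move=> e0; have [N H] : exists N : nat, e^-1 < N%:R.
  exists (Num.trunc e^-1).+1; exact: truncnS_gt.
exists N => n Nn; rewrite invf_plt ?posrE // (lt_le_trans H) // ler_nat.
by rewrite (leq_trans Nn).
Qed.

(** A minimizing sequence for the distance is Cauchy by the parallelogram law. The norm of [E] need
    only be equivalent to that of [q]: on [H * H] it is the maximum of the two norms, whence the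
    factor 2 in [q_upper]. *)
Lemma orthogonal_projection p : exists2 g, G g & forall h, G h -> q h (p - g) = 0.
Proof.
pose S : set R := [set sqform q (p - g) | g in G].
have S0 : S !=set0 by exists (sqform q (p - 0)); exists 0 => //; exact: Gsub.1.
have Slb : has_lbound S by exists 0 => _ [g _ <-]; exact: sqform_ge0.
have hinf : has_inf S by [].
pose d := inf S.
have dle g : G g -> d <= sqform q (p - g).
  by move=> Gg; apply: ge_inf => //; exists g.
have ex n : exists g, G g /\ sqform q (p - g) < d + n.+1%:R^-1.
  have n0 : 0 < n.+1%:R^-1 :> R by rewrite invr_gt0.
  by have [_ [g Gg <-] h] := inf_adherent n0 hinf; exists g.
have [g hg] := choice ex.
have Gg n : G (g n) by case: (hg n).
have Qg n : sqform q (p - g n) < d + n.+1%:R^-1 by case: (hg n).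
have dist n m : sqform q (g n - g m) <= 2 * n.+1%:R^-1 + 2 * m.+1%:R^-1.
  have := parallelogram hq (p - g m) (p - g n).
  have -> : p - g m - (p - g n) = g n - g m by rewrite opprB addrC addrA subrK.
  have -> : p - g m + (p - g n) = (2 : R[i]) *: (p - (2 : R[i])^-1 *: (g m + g n)).
    rewrite scalerBr scalerA mulfV ?pnatr_eq0 // scale1r.
    by rewrite scalerDl scale1r opprD addrACA.
  rewrite sqformZ // (_ : complex.Re `|2| ^+ 2 = 4); last first.
    by rewrite ger0_norm ?ler0n // -[2%:R](rmorph_nat (real_complex R)) /= -natrX.
  have := dle ((2 : R[i])^-1 *: (g m + g n)).
  have Gh : G ((2 : R[i])^-1 *: (g m + g n)).
    by apply: (linear_setZ Gsub); apply: (linear_setD Gsub).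
  move/(_ Gh); have := Qg n; have := Qg m.
  by move: (n.+1%:R^-1) (m.+1%:R^-1) => rn rm; lra.
have [|g0 cg0] := hE (u := g).
  move=> e e0.
  have e1 : 0 < e ^+ 2 / 4 by rewrite divr_gt0 // exprn_gt0.
  have [N hN] := invSn_small e1; exists N => n m Nn Nm.
  rewrite -(ltr_pXn2r (n := 2)) ?nnegrE ?rnorm_ge0 ?ltW //.
  apply: (le_lt_trans (q_lower _)); apply: (le_lt_trans (dist _ _)).
  have := hN _ Nn; have := hN _ Nm.
  by move: (n.+1%:R^-1) (m.+1%:R^-1) => rn rm; lra.
exists g0.
  apply: Gcl; apply/closure_rnormP => e e0.
  have [N hN] := (cvgn_rnormP _ _).1 cg0 _ e0.
  by exists (g N) => //; apply: hN.
move=> h Gh.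
have Qh0 := sqform_ge0 hq h.
apply: (@rnorm_small_eq R R[i]^o) => e e0; rewrite subr0 rnorm_le_norm.
pose K := sqform q h + 1.
have K0 : 0 < K by rewrite /K; lra.
have e1 : 0 < (e / 2) ^+ 2 / (4 * K) by rewrite divr_gt0 // ?exprn_gt0 ?mulr_gt0 ?divr_gt0.
have e2 : 0 < e / 4 / K by rewrite !divr_gt0.
have [N hN] := invSn_small e1.
have e3 : 0 < Num.min (e / 4 / K) (e / 4).
  by rewrite lt_min e2 divr_gt0.
have [M hM] := (cvgn_rnormP _ _).1 cg0 _ e3.
pose n := maxn N M.
(* [d] also bounds the squared distances from [p] to [g n + c *: h], so [sqform_ineq] turns near
   minimality of [g n] into near orthogonality to [h]. *)
have b1 : complex.Re `|q h (p - g n)| < e / 2.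
  rewrite -(ltr_pXn2r (n := 2)) ?nnegrE ?Re_norm_ge0 ?divr_ge0 ?(ltW e0) //.
  apply: le_lt_trans (_ : (sqform q (p - g n) - d) * sqform q h < _).
    apply: sqform_ineq => // c.
    by rewrite -addrA -opprD [g n + _]addrC; apply/dle/Gsub.2.
  have h1 : sqform q (p - g n) - d <= (e / 2) ^+ 2 / (4 * K).
    have := Qg n; have := hN n (leq_maxl _ _); move: (n.+1%:R^-1) => rn; lra.
  have h2 : 0 <= sqform q (p - g n) - d by rewrite subr_ge0 dle.
  have h3 : (e / 2) ^+ 2 / (4 * K) * K = (e / 2) ^+ 2 / 4.
    by field; rewrite lt0r_neq0.
  have h4 : (sqform q (p - g n) - d) * sqform q h <= (e / 2) ^+ 2 / (4 * K) * K.
    by apply: ler_pM => //; rewrite /K; lra.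
  have : 0 < (e / 2) ^+ 2 by rewrite exprn_gt0 ?divr_gt0.
  by rewrite h3 in h4; lra.
have b2 : complex.Re `|q h (g n - g0)| <= e / 2.
  rewrite -(ler_pXn2r (n := 2)) ?nnegrE ?Re_norm_ge0 ?divr_ge0 ?(ltW e0) //.
  apply: (le_trans (cauchy_schwarz hq _ _)).
  have := hM n (leq_maxr _ _); rewrite lt_min => /andP[r1 r2].
  set r := rnorm (g n - g0) in r1 r2.
  have r0 : 0 <= r by exact: rnorm_ge0.
  have h1 : sqform q (g n - g0) * sqform q h <= (2 * r ^+ 2) * K.
    by apply: ler_pM; rewrite ?sqform_ge0 ?q_upper // /K; lra.
  have h2 : r * K <= e / 4 by rewrite -ler_pdivlMr // ltW.
  have h3 : r * (r * K) <= e / 4 * (e / 4) by apply: ler_pM => //; [rewrite mulr_ge0 // ltW | exact: ltW].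
  apply: (le_trans h1).
  have := exprn_gt0 2 e0; rewrite !expr2 => h4; nra.
have -> : p - g0 = (p - g n) + (g n - g0) by rewrite addrA subrK.
rewrite spDr //.
have := @rnormD R R[i]^o (q h (p - g n)) (q h (g n - g0)).
rewrite !rnorm_le_norm; lra.
Qed.

End Projection.

(** * Operators and von Neumann algebras *)

Lemma closure_linear_set (R : realType) (E : normedModType R[i]) (G : set E) :
  linear_set G -> linear_set (closure G).
Proof.
move=> hG; split; first exact/subset_closure/hG.1.
move=> c x y /closure_rnormP hx /closure_rnormP hy; apply/closure_rnormP => e e0.
pose K := complex.Re `|c| + 1.
have c0 := Re_norm_ge0 c.
have K0 : 0 < K by rewrite /K; lra.
have eK : 0 < e / 2 / K by rewrite !divr_gt0.
have e2 : 0 < e / 2 by rewrite divr_gt0.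
have [x' Gx' xx] := hx _ eK; have [y' Gy' yy] := hy _ e2.
exists (c *: x' + y'); first exact: hG.2.
have -> : c *: x' + y' - (c *: x + y) = c *: (x' - x) + (y' - y).
  by rewrite scalerBr opprD addrACA.
apply: le_lt_trans (rnormD _ _) _; rewrite rnormZ.
have : complex.Re `|c| * rnorm (x' - x) <= K * (e / 2 / K).
  by apply: ler_pM => //; rewrite ?rnorm_ge0 ?ltW // /K; lra.
by rewrite mulrCA divff ?mulr1 ?lt0r_neq0 // => ?; lra.
Qed.

Section Operators.
Variables (R : realType) (H : completeNormedModType R[i]) (ip : H -> H -> R[i]).
Hypothesis hH : hilbert ip.
Implicit Types (x y z : H) (T S B : H -> H).
Let sp : scalar_product ip := hH.1.

Lemma sqform_rnorm x : sqform ip x = rnorm x ^+ 2.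
Proof.
apply: (@complexI R); rewrite -sqformE // hH.2 rnormE.
by rewrite -rmorphXn.
Qed.

Lemma ip_bound x y : complex.Re `|ip x y| <= rnorm x * rnorm y.
Proof.
rewrite -(ler_pXn2r (n := 2)) ?nnegrE ?Re_norm_ge0 ?mulr_ge0 ?rnorm_ge0 //.
by rewrite exprMn -!sqform_rnorm mulrC cauchy_schwarz.
Qed.

Lemma ip_sep x y : (forall z, ip x z = ip y z) -> x = y.
Proof.
move=> h; apply/eqP; rewrite -subr_eq0; apply/eqP/(sp_eq0 sp).
by rewrite spBl // h subrr.
Qed.

Lemma ip_cvg (Y : Type) (F : set_system Y) {FF : Filter F} (u : Y -> H) z x :
  u @ F --> x -> (fun t => ip z (u t) : R[i]^o) @ F --> (ip z x : R[i]^o).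
Proof.
move=> /cvg_rnormP h; apply/cvg_rnormP => e e0.
pose K := rnorm z + 1; have z0 := rnorm_ge0 z.
have K0 : 0 < K by rewrite /K; lra.
have eK : 0 < e / K by rewrite divr_gt0.
move: (h _ eK); apply: filterS => t ht.
rewrite -[_ - _](spBr sp) rnorm_le_norm (le_lt_trans (ip_bound _ _)) //.
apply: le_lt_trans (_ : K * rnorm (u t - x) < _).
  by rewrite ler_wpM2r ?rnorm_ge0 // /K; lra.
by rewrite mulrC -ltr_pdivlMr.
Qed.

Lemma lin0 T : linear T -> T 0 = 0.
Proof. by move=> l; have := l 1 0 0; rewrite !scale1r addr0 -{1}[T 0]addr0 => /addrI <-. Qed.
Lemma linZ T c x : linear T -> T (c *: x) = c *: T x.
Proof. by move=> l; rewrite -[c *: x]addr0 l lin0 // addr0. Qed.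
Lemma linD T x y : linear T -> T (x + y) = T x + T y.
Proof. by move=> l; rewrite -{1}(scale1r x) l scale1r. Qed.
Lemma linB T x y : linear T -> T (x - y) = T x - T y.
Proof. by move=> l; rewrite linD // -scaleN1r linZ // scaleN1r. Qed.

Lemma bounded_continuous T (K : R) : linear T ->
  (forall x, rnorm (T x) <= K * rnorm x) -> continuous T.
Proof.
move=> lT bT x; apply/cvg_rnormP => e e0.
pose L := `|K| + 1.
have L0 : 0 < L by rewrite /L ltr_wpDl.
have eL : 0 < e / L by rewrite divr_gt0.
have : \forall y \near x, rnorm (y - x) < e / L by apply: ((cvg_rnormP (F := nbhs x) id x).1 cvg_id _ eL).
apply: filterS => y hy.
rewrite -linB //.
apply: le_lt_trans (bT _) _; apply: le_lt_trans (_ : L * rnorm (y - x) < _).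
  by rewrite ler_wpM2r ?rnorm_ge0 // /L; have := ler_norm K; lra.
by rewrite mulrC -ltr_pdivlMr.
Qed.

Lemma continuous_bounded T : linear T -> continuous T ->
  exists2 K : R, 0 < K & forall x, rnorm (T x) <= K * rnorm x.
Proof.
move=> lT cT.
have h1 : \forall x \near (0 : H), rnorm (T x - T 0) < 1.
  by apply: ((cvg_rnormP (F := nbhs 0) T (T 0)).1 (cT 0) _ ltr01).
have [[d d'] /=] := (nbhs_ballP _ _).1 h1; rewrite ltcE /= => /andP[/eqP -> d0] hd.
exists (2 / d); first by rewrite divr_gt0.
move=> x; have [->|x0] := eqVneq x 0.
  by rewrite lin0 // rnorm0 mulr0.
have nx : 0 < rnorm x.
  rewrite lt_neqAle rnorm_ge0 andbT eq_sym; apply: contra_neq x0; exact: rnorm_eq0.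
pose r := d / 2 / rnorm x.
have r0 : 0 < r by rewrite !divr_gt0.
have := hd (r%:C *: x); rewrite -ball_normE /= sub0r normrN complexr0 rnormE ltcR.
have -> : rnorm (r%:C *: x) = d / 2 by rewrite rnormZr ?ltW // /r divfK // lt0r_neq0.
rewrite ltr_pdivrMr // ltr_pMr // ltr1n => /(_ isT).
rewrite lin0 // subr0 linZ // rnormZr ?(ltW r0) // => h.
have -> : 2 / d * rnorm x = r^-1.
  by rewrite /r !invf_div mulrA mulrAC; field; rewrite !lt0r_neq0.
by rewrite -[r^-1]mulr1 ler_pdivlMl // ltW.
Qed.

Lemma linear_bounded_op T (K : R) : linear T ->
  (forall x, rnorm (T x) <= K * rnorm x) -> bounded_op T.
Proof. by move=> lT bT; split => //; exact: bounded_continuous bT. Qed.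

(** Unless [phi] is zero, its kernel is a closed hyperplane and every vector is a multiple of the
    normal [w] modulo the kernel; the scalar in the witness makes both sides agree on [w]. *)
Lemma riesz (phi : H -> R[i]) (K : R) :
  (forall c x y, phi (c *: x + y) = c * phi x + phi y) ->
  (forall x, complex.Re `|phi x| <= K * rnorm x) ->
  exists z, forall x, phi x = ip z x.
Proof.
move=> lphi bphi.
have phi0 : phi 0 = 0.
  by have := lphi 1 0 0; rewrite scaler0 addr0 mul1r -{1}[phi 0]addr0 => /addrI <-.
have phiB x y : phi (x - y) = phi x - phi y.
  by rewrite addrC -scaleN1r lphi mulN1r addrC.
have [all0|/existsNP [x0 /eqP px0]] := pselect (forall x, phi x = 0).
  by exists 0 => x; rewrite all0 sp0l.
pose G := [set x | phi x = 0].
have sG : linear_set G.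
  by split=> // c x y /= px py; rewrite /G /= lphi px py mulr0 addr0.
have cG : closed G.
  move=> x /closure_rnormP h; apply: (@rnorm_small_eq R R[i]^o) => e e0.
  have K0 : 0 < `|K| + 1 by rewrite ltr_wpDl.
  have eK : 0 < e / (`|K| + 1) by rewrite divr_gt0.
  have [y py yx] := h _ eK.
  rewrite -[0 : R[i]^o]py -rnormB -phiB rnorm_le_norm.
  apply: le_lt_trans (bphi _) _; apply: le_lt_trans (_ : (`|K| + 1) * rnorm (y - x) < _).
    by rewrite ler_wpM2r ?rnorm_ge0 //; have := ler_norm K; lra.
  by rewrite mulrC -ltr_pdivlMr.
have [||g Gg og] := orthogonal_projection (@cauchy_rnorm_cvg R H) sp _ _ sG cG x0.
- by move=> x; rewrite sqform_rnorm.
- by move=> x; rewrite sqform_rnorm; have := exprn_ge0 2 (rnorm_ge0 x); lra.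
set w := x0 - g in og.
have pw : phi w != 0 by rewrite /w phiB Gg subr0.
have w0 : w != 0 by apply: contra_neq pw => ->.
have ww : ip w w != 0 by apply: contra_neq w0; exact: sp_eq0.
exists (((phi w / ip w w)^*)%C *: w) => x; rewrite spZl // conjcK.
have : G (x - (phi x / phi w) *: w).
  by rewrite /G /= addrC -scaleNr lphi mulNr divfK // addNr.
move=> /og; rewrite spBl // spZl // => /eqP; rewrite subr_eq0 => /eqP e.
by rewrite (spC sp x w) e rmorphM /= conjcK -spC //; field; rewrite pw ww.
Qed.

Lemma adjoint_exists T : bounded_op T -> exists S, adjoint_op ip T S.
Proof.
move=> [lT cT]; have [K K0 bT] := continuous_bounded lT cT.
have ex y : exists z, forall x, ip y (T x) = ip z x.
  apply: (@riesz _ (rnorm y * K)) => [c u v|x]; first by rewrite lT spDr // spZr.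
  by apply: (le_trans (ip_bound _ _)); rewrite -mulrA ler_wpM2l ?rnorm_ge0.
have [S hS] := choice ex.
exists S; split; last by move=> x y; rewrite hS.
apply: (@linear_bounded_op _ K).
  by move=> c x y; apply: ip_sep => z; rewrite spDl // spZl // -!hS spDl // spZl.
move=> y; have [z|nz] := eqVneq (rnorm (S y)) 0.
  by rewrite z mulr_ge0 ?rnorm_ge0 // ltW.
have p : 0 < rnorm (S y) by rewrite lt_neqAle eq_sym nz rnorm_ge0.
rewrite -(ler_pM2r p) -expr2 -sqform_rnorm.
have -> : sqform ip (S y) = complex.Re `|ip y (T (S y))|.
  by rewrite hS /sqform ger0_norm // sp_ge0.
apply: (le_trans (ip_bound _ _)); rewrite mulrAC mulrC ler_wpM2r ?rnorm_ge0 //.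
Qed.

Lemma adjoint_sym T S : bounded_op T -> adjoint_op ip T S -> adjoint_op ip S T.
Proof.
move=> bT [bS h]; split=> // x y.
by rewrite (spC sp (S y)) // h -spC.
Qed.

Lemma commutant_adjoint (M : set (H -> H)) B B' :
  M `<=` @bounded_op R H -> (forall T S, M T -> adjoint_op ip T S -> M S) ->
  commutant M B -> adjoint_op ip B B' -> commutant M B'.
Proof.
move=> Mb Ma [bB cB] aB; split; first by case: aB.
move=> S MS; have [S' aS] := adjoint_exists (Mb _ MS).
have MS' := Ma _ _ MS aS; have := cB _ MS'.
move=> /(congr1 (fun f : H -> H => f _)) e.
apply/funext => x /=; apply: ip_sep => z.
have [_ hB] := aB; have [_ hS] := aS.
have [_ hS'] := adjoint_sym (Mb _ MS) aS.
rewrite hB hS' hS' hB; congr (ip x _); exact: esym (e z).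
Qed.

Definition ip2 (p p' : H * H) : R[i] := ip p.1 p'.1 + ip p.2 p'.2.

Lemma scalar_product_ip2 : scalar_product ip2.
Proof.
split=> [u c v w|u v|u u0]; rewrite /ip2.
- have -> : (c *: v + w).1 = c *: v.1 + w.1 by [].
  have -> : (c *: v + w).2 = c *: v.2 + w.2 by [].
  by rewrite (spDr sp) (spZr sp) (spDr sp) (spZr sp) mulrDr addrACA.
- by rewrite (spC sp u.1) (spC sp u.2) rmorphD.
- have h1 := sp_ge0 sp u.1; have h2 := sp_ge0 sp u.2.
  rewrite lt_neqAle addr_ge0 // andbT eq_sym; apply: contra_neq u0 => /eqP.
  rewrite paddr_eq0 // => /andP[/eqP/(sp_eq0 sp) e1 /eqP/(sp_eq0 sp) e2].
  by case: u e1 e2 {h1 h2} => ? ? /= -> ->.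
Qed.

Lemma rnorm_pair (p : H * H) : rnorm p = Num.max (rnorm p.1) (rnorm p.2).
Proof.
have -> : rnorm p = complex.Re (Num.max `|p.1| `|p.2|) by [].
rewrite !rnormE; case: (leP (rnorm p.1) (rnorm p.2)) => h.
  by rewrite max_r ?lecR.
by rewrite max_l // lecR ltW.
Qed.

Lemma rnorm_pair_lt (p : H * H) (e : R) :
  (rnorm p < e) = (rnorm p.1 < e) && (rnorm p.2 < e).
Proof. by rewrite rnorm_pair gt_max. Qed.

Lemma rcomplete_pair : rcomplete (H * H)%type.
Proof.
move=> u cu.
have [|x ux] := @cauchy_rnorm_cvg _ _ (fun n => (u n).1).
  move=> e /cu [N hN]; exists N => n m Nn Nm.
  by have := hN _ _ Nn Nm; rewrite rnorm_pair_lt => /andP[].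
have [|y uy] := @cauchy_rnorm_cvg _ _ (fun n => (u n).2).
  move=> e /cu [N hN]; exists N => n m Nn Nm.
  by have := hN _ _ Nn Nm; rewrite rnorm_pair_lt => /andP[].
exists (x, y); apply/cvgn_rnormP => e e0.
have [N hN] := (cvgn_rnormP _ _).1 ux _ e0.
have [M hM] := (cvgn_rnormP _ _).1 uy _ e0.
exists (maxn N M) => n; rewrite geq_max => /andP[Nn Mn].
by rewrite rnorm_pair_lt hN // hM.
Qed.

Lemma pair_bounds (p : H * H) :
  rnorm p ^+ 2 <= sqform ip2 p /\ sqform ip2 p <= 2 * rnorm p ^+ 2.
Proof.
have -> : sqform ip2 p = rnorm p.1 ^+ 2 + rnorm p.2 ^+ 2.
  by rewrite -!sqform_rnorm /sqform raddfD.
have h1 := exprn_ge0 2 (rnorm_ge0 p.1); have h2 := exprn_ge0 2 (rnorm_ge0 p.2).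
have [k1 k2] := (rnorm_ge0 p.1, rnorm_ge0 p.2).
rewrite rnorm_pair; case: (leP (rnorm p.1) (rnorm p.2)) => h.
  have : rnorm p.1 ^+ 2 <= rnorm p.2 ^+ 2 by rewrite ler_pXn2r.
  by split; lra.
have : rnorm p.2 ^+ 2 <= rnorm p.1 ^+ 2 by rewrite ler_pXn2r // ltW.
by split; lra.
Qed.

Lemma projection2 (G : set (H * H)) : linear_set G -> closed G ->
  forall p, exists2 g, G g & forall h, G h -> ip2 h (p - g) = 0.
Proof.
move=> lG cG; apply: orthogonal_projection => //.
- exact: rcomplete_pair.
- exact: scalar_product_ip2.
- by move=> x; case: (pair_bounds x).
- by move=> x; case: (pair_bounds x).
Qed.

Lemma orthogonal_mem (G : set (H * H)) (p : H * H) : linear_set G -> closed G ->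
  (forall z : H * H, (forall g, G g -> ip2 z g = 0) -> ip2 z p = 0) -> G p.
Proof.
move=> lG cG h; have [g Gg og] := projection2 lG cG p.
have sp2 := scalar_product_ip2.
have hz : ip2 (p - g) p = 0.
  by apply: h => k Gk; rewrite (spC sp2) og // rmorph0.
have : ip2 (p - g) (p - g) = 0.
  by rewrite spBr // hz (spC sp2 g) og // rmorph0 subrr.
by move/(sp_eq0 sp2)/eqP; rewrite subr_eq0 => /eqP ->.
Qed.

(** When [G] is the graph of an operator [T], this is the inclusion of [B T] in [T B], which
    [affiliated] demands of every [B] in the commutant. *)
Definition diag_invariant (G : set (H * H)) B : Prop :=
  forall x y, G (x, y) -> G (B x, B y).

(** The block matrix of a projection of [H * H] onto [G]. The first index is the output component,
    the second the input component, and [false] stands for the first coordinate. *)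
Definition entries_in (P : bool -> bool -> H -> H) (G : set (H * H)) : Prop :=
  (forall x y, G (P false false x + P false true y, P true false x + P true true y)) /\
  (forall x y, G (x, y) -> P false false x + P false true y = x /\
     P true false x + P true true y = y).

(** If [B] and its adjoint both preserve [G], then the diagonal action of [B] preserves [G] and its
    orthogonal complement. It therefore commutes with the orthogonal projection, which means that
    [B] commutes with the four entries. *)
Lemma projection_entries (G : set (H * H)) : linear_set G -> closed G ->
  exists P : bool -> bool -> H -> H,
  [/\ entries_in P G, forall i j, bounded_op (P i j)
    & forall B B', bounded_op B -> adjoint_op ip B B' -> diag_invariant G B ->
        diag_invariant G B' -> forall i j, B \o P i j = P i j \o B].
Proof.
move=> lG cG; have sp2 := scalar_product_ip2.
have ex (p : H * H) : exists g, G g /\ forall h, G h -> ip2 h (p - g) = 0.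
  by have [g Gg og] := projection2 lG cG p; exists g.
have [P hP] := choice ex.
have GP (p : H * H) : G (P p) by case: (hP p).
have oP (p : H * H) h : G h -> ip2 h (p - P p) = 0 by case: (hP p) => _; apply.
have uniqP (p : H * H) g : G g -> (forall h, G h -> ip2 h (p - g) = 0) -> P p = g.
  move=> Gg og; pose d := P p - g; have Gd : G d by exact: linear_setB.
  have e : d = (p - g) - (p - P p) by rewrite [RHS]addrC opprB addrA subrK.
  have : ip2 d d = 0 by rewrite {2}e spBr // og // oP // subrr.
  by move/(sp_eq0 sp2)/eqP; rewrite subr_eq0 => /eqP.
have lP : forall c (p p' : H * H), P (c *: p + p') = c *: P p + P p'.
  move=> c p p'; apply: uniqP; first by apply: lG.2.
  move=> h Gh; have -> : c *: p + p' - (c *: P p + P p') = c *: (p - P p) + (p' - P p').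
    by rewrite opprD addrACA scalerBr.
  by rewrite (spDr sp2) (spZr sp2) !oP // mulr0 addr0.
have idP (p : H * H) : G p -> P p = p.
  by move=> Gp; apply: uniqP => // h _; rewrite subrr (sp0r sp2).
have bP (p : H * H) : rnorm (P p) <= 2 * rnorm p.
  pose d := p - P p.
  have e : sqform ip2 p = sqform ip2 (P p) + sqform ip2 d.
    have {1}-> : p = d + P p by rewrite subrK.
    have o1 : ip2 (P p) d = 0 by exact: oP.
    have o2 : ip2 d (P p) = 0 by rewrite (spC sp2 (P p)) o1 rmorph0.
    rewrite /sqform (spDl sp2) (spDr sp2) (spDr sp2 (P p)) o1 o2.
    by rewrite addr0 add0r raddfD addrC.
  have h0 := sqform_ge0 sp2 d.
  have [h1 _] := pair_bounds (P p); have [_ h2] := pair_bounds p.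
  have k1 := rnorm_ge0 p; have k2 := rnorm_ge0 (P p).
  move: h0 h1 h2 k1 k2 e; move: (rnorm p) (rnorm (P p)) => r s.
  move: (sqform _ _) (sqform _ _) (sqform _ _) => a b c h0 h1 h2 k1 k2 e.
  by rewrite -(ler_pXn2r (n := 2)) ?nnegrE ?mulr_ge0 // exprMn; nra.
have PD (p p' : H * H) : P (p + p') = P p + P p' by rewrite -{1}(scale1r p) lP scale1r.
have inv B B' : bounded_op B -> adjoint_op ip B B' -> diag_invariant G B ->
    diag_invariant G B' ->
    forall p : H * H, P (B p.1, B p.2) = (B (P p).1, B (P p).2).
  move=> bB aB iB iB' p; apply: uniqP; first by apply: iB; rewrite -surjective_pairing.
  move=> [h1 h2] Gh; have [_ hB] := aB; have [lB _] := bB.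
  have := oP p _ (iB' _ _ Gh); rewrite /ip2 /= !hB => <-.
  by rewrite -!linB.
pose inj (j : bool) (x : H) : H * H := if j then (0, x) else (x, 0).
pose pr (i : bool) (p : H * H) : H := if i then p.2 else p.1.
have linj j c x y : inj j (c *: x + y) = c *: inj j x + inj j y.
  by case: j; apply: injective_projections; rewrite /inj /= ?scaler0 ?addr0.
have ninj j x : rnorm (inj j x) = rnorm x.
  rewrite rnorm_pair; case: j => /=; rewrite rnorm0.
    by apply/max_idPr; exact: rnorm_ge0.
  by apply/max_idPl; exact: rnorm_ge0.
have npr i p : rnorm (pr i p) <= rnorm p.
  by rewrite rnorm_pair le_max; case: i; rewrite /= lexx ?orbT.
have lpr i c p p' : pr i (c *: p + p') = c *: pr i p + pr i p' by case: i.
have sumP x y : P (x, y) = P (inj false x) + P (inj true y).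
  rewrite -PD; congr P; apply/eqP.
  by rewrite /inj -pair_eqE /= /pair_eq /= addr0 add0r !eqxx.
exists (fun i j x => pr i (P (inj j x))); split.
- split=> [x y|x y /idP]; first have := GP (x, y); rewrite sumP /pr;
  by case: (P (inj false x)) => ? ?; case: (P (inj true y)) => ? ? // [].
- move=> i j; apply: (@linear_bounded_op _ 2) => [c x y|x].
    by rewrite linj lP lpr.
  by apply: le_trans (npr _ _) _; rewrite (le_trans (bP _)) // ninj.
- move=> B B' bB aB iB iB' i j; have [lB _] := bB.
  apply/funext => x /=; have := inv _ _ bB aB iB iB' (inj j x).
  have -> : (B (inj j x).1, B (inj j x).2) = inj j (B x).
    by rewrite /inj; case: j => /=; rewrite lin0.
  by move=> ->; case: i.
Qed.

Lemma commutant_bounded (M : set (H -> H)) B : commutant M B -> bounded_op B.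
Proof. by case. Qed.

Lemma von_neumann_commutant_adjoint M B : von_neumann ip M -> commutant M B ->
  exists2 B', commutant M B' & adjoint_op ip B B'.
Proof.
move=> [Mb Ma _] cB; have [B' aB] := adjoint_exists (commutant_bounded cB).
by exists B' => //; exact: commutant_adjoint aB.
Qed.

(** [Wstar] is an intersection, so its commutant may exceed that of each algebra [M] to which [G] is
    affiliated, and affiliation does not pass to it formally. The entries of the projection onto [G]
    commute with the commutant of every such [M], hence lie in every [M], which is its own
    bicommutant; and an operator commuting with the entries preserves [G]. *)
Lemma affiliated_Wstar (F : set (set (H * H))) (G : set (H * H)) :
  F G -> linear_set G -> closed G -> affiliated G (Wstar ip F).
Proof.
move=> FG lG cG B [bB cB] x y Gxy.
have [P [[e1 e2] e3 e4]] := projection_entries lG cG.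
have comm i j : P i j \o B = B \o P i j.
  apply/esym/cB => M vM aM.
  have [Mb Ma MM] := vM.
  rewrite -MM; split; first exact: e3.
  move=> C cC; have [C' cC' aC] := von_neumann_commutant_adjoint vM cC.
  apply/esym/(e4 _ _ (commutant_bounded cC) aC); exact: aM.
have commE i j z : P i j (B z) = B (P i j z).
  by have := congr1 (fun f : H -> H => f z) (comm i j).
have [h1 h2] := e2 _ _ Gxy; have [lB _] := bB.
by have := e1 (B x) (B y); rewrite !commE -!linD // h1 h2.
Qed.

Lemma commutant_linear_set M (x y : H) :
  M `<=` @bounded_op R H ->
  linear_set [set p | exists2 A, commutant M A & p = (A x, A y)].
Proof.
move=> Mb; split.
  exists (fun=> 0) => //; split.
    by apply: (@linear_bounded_op _ 0) => [c u v|u]; rewrite ?rnorm0 ?mul0r ?scaler0 ?addr0.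
  move=> S /Mb [lS _]; apply/funext => u /=; by rewrite lin0.
move=> c _ _ [A [[lA cA] hA] ->] [B [[lB cB] hB] ->].
exists (fun z => c *: A z + B z) => //; split.
  have [K K0 bK] := continuous_bounded lA cA.
  have [L L0 bL] := continuous_bounded lB cB.
  apply: (@linear_bounded_op _ (complex.Re `|c| * K + L)) => [d u v|u].
    rewrite lA lB !scalerDr !scalerA [c * d]mulrC addrACA.
    by congr (_ + _).
  rewrite mulrDl (le_trans (rnormD _ _)) // lerD // rnormZ -mulrA.
  by rewrite ler_wpM2l ?Re_norm_ge0.
move=> S MS; apply/funext => u /=; have [lS _] := Mb _ MS.
have := congr1 (fun f : H -> H => f u) (hA _ MS).
have := congr1 (fun f : H -> H => f u) (hB _ MS).
by rewrite /= lS => -> ->.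
Qed.

(** With [x] the vacuum and [y] the vector a(f) this is the Fredenhagen-Joerss graph, see
    [fj_commutant_graph]. *)
Definition commutant_graph (M : set (H -> H)) (x y : H) : set (H * H) :=
  closure [set p | exists2 A, commutant M A & p = (A x, A y)].

Lemma commutant_id (M : set (H -> H)) : commutant M id.
Proof. by split=> //; split => // x. Qed.

Lemma commutant_comp (M : set (H -> H)) A B : commutant M A -> commutant M B -> commutant M (A \o B).
Proof.
move=> [[lA cA] hA] [[lB cB] hB]; split.
  split; first by move=> c x y /=; rewrite lB lA.
  by move=> x; apply: continuous_comp; [exact: cB | exact: cA].
by move=> S MS; rewrite -compA hB // compA hA.
Qed.

Lemma diag_invariant_closure (G : set (H * H)) B : bounded_op B ->
  diag_invariant G B -> diag_invariant (closure G) B.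
Proof.
move=> [lB cB] iB x y /closure_rnormP h; apply/closure_rnormP => e e0.
have [K K0 bK] := continuous_bounded lB cB.
have eK : 0 < e / K by rewrite divr_gt0.
have [[x' y'] Gxy] := h _ eK; rewrite rnorm_pair_lt /= => /andP[h1 h2].
exists (B x', B y'); first exact: iB.
rewrite rnorm_pair_lt /= -!linB //; apply/andP; split.
  by apply: le_lt_trans (bK _) _; rewrite mulrC -ltr_pdivlMr.
by apply: le_lt_trans (bK _) _; rewrite mulrC -ltr_pdivlMr.
Qed.

(* The projection onto the closure of [M'(w, x)] has entries in [M'' = M], which
   preserve the graph of [T]; comparing the values of [T] at [w] and [x] shows
   that the projection fixes [(Tw, Tx)]. *)
Lemma commutant_graph_invariant (M : set (H -> H)) (T : set (H * H)) w x u v :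
  von_neumann ip M -> linear_set T ->
  (forall B, M B -> diag_invariant T B) ->
  (forall z y y', T (z, y) -> T (z, y') -> y = y') ->
  T (w, u) -> T (x, v) -> commutant_graph M w x (u, v).
Proof.
move=> vM lT iT sT Twu Txv; have [Mb Ma MM] := vM.
have lG : linear_set (commutant_graph M w x).
  exact/closure_linear_set/commutant_linear_set.
have cG : closed (commutant_graph M w x) by exact: closed_closure.
have iG B : commutant M B -> diag_invariant (commutant_graph M w x) B.
  move=> cB; apply: diag_invariant_closure; first exact: commutant_bounded cB.
  by move=> _ _ [A cA [-> ->]]; exists (B \o A) => //; exact: commutant_comp.
have [P [[e1 e2] e3 e4]] := projection_entries lG cG.
have MP i j : M (P i j).
  rewrite -MM; split; first exact: e3.
  move=> C cC; have [C' cC' aC] := von_neumann_commutant_adjoint vM cC.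
  by apply/esym/(e4 _ _ (commutant_bounded cC) aC); exact: iG.
have Gwx : commutant_graph M w x (w, x).
  by apply: subset_closure; exists id => //; exact: commutant_id.
have [h1 h2] := e2 _ _ Gwx.
have TP i j : T (P i j w + P i (~~ j) x, P i j u + P i (~~ j) v).
  by apply: (linear_setD lT (x := (_, _)) (y := (_, _))); apply: iT.
have eu : P false false u + P false true v = u.
  by apply: sT Twu; have := TP false false; rewrite h1.
have ev : P true false u + P true true v = v.
  by apply: sT Txv; have := TP true false; rewrite h2.
by have := e1 u v; rewrite eu ev.
Qed.

End Operators.

(** * Power series vanishing on an arc *)

Section Cis.
Variable R : realType.
Implicit Types (s t : R).

Definition cis t : R[i] := cos t +i* sin t.

Lemma cis0 : cis 0 = 1. Proof. by rewrite /cis cos0 sin0. Qed.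

Lemma cisD s t : cis (s + t) = cis s * cis t.
Proof. by rewrite /cis cosD sinD; simpc; congr (_ +i* _); rewrite addrC. Qed.

Lemma norm_cis t : `|cis t| = 1.
Proof. by rewrite normc_def /= cos2Dsin2 sqrtr1. Qed.

Lemma cis_neq0 t : cis t != 0.
Proof. by rewrite -normr_eq0 norm_cis oner_neq0. Qed.

Lemma cisN t : cis (- t) = (cis t)^-1.
Proof.
apply: (mulfI (cis_neq0 t)); rewrite -cisD addrN cis0 divff //; exact: cis_neq0.
Qed.

Lemma cisN_conj t : cis (- t) = ((cis t)^*)%C.
Proof. by rewrite /cis cosN sinN. Qed.

Lemma cisMn t n : cis (n%:R * t) = cis t ^+ n.
Proof.
elim: n => [|n IH]; first by rewrite mul0r cis0.
by rewrite -natr1 mulrDl mul1r cisD IH exprSr.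
Qed.

Lemma cis2pi : cis (2 * pi) = 1.
Proof.
have -> : 2 * pi = pi + pi :> R by rewrite mulr_natl mulr2n.
have cispi : cis pi = -1.
  by apply/eqP; rewrite eq_complex /= cospi sinpi oppr0 !eqxx.
by rewrite cisD cispi mulrNN mulr1.
Qed.

Lemma cis_neq1 t : 0 < t -> t < 2 * pi -> cis t != 1.
Proof.
move=> t0 t2; apply/negP => /eqP [c1 _].
have h : 0 < sin (t / 2) by apply: sin_gt0_pi; rewrite divr_gt0 //= ltr_pdivrMr // mulrC.
have := cosD (t / 2) (t / 2); rewrite -splitr c1.
have := cos2Dsin2 (t / 2); have := mulr_gt0 h h; rewrite !expr2.
by move=> h1 h2 h3; lra.
Qed.

Lemma sum_roots_of_unity (L k : nat) : (0 < k)%N -> (k < L)%N ->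
  \sum_(l < L) cis (2 * pi / L%:R) ^+ (l * k) = 0.
Proof.
move=> k0 kL; have L0 : (0 < L)%N by exact: leq_trans kL.
have L0' : (0 : R) < L%:R by rewrite ltr0n.
set z := cis _.
have zk1 : z ^+ k != 1.
  rewrite /z -cisMn; apply: cis_neq1.
    by rewrite !mulr_gt0 ?ltr0n ?pi_gt0 ?invr_gt0 ?ltr0n.
  rewrite mulrA ltr_pdivrMr // mulrC ltr_pM2l ?mulr_gt0 ?pi_gt0 //.
  by rewrite ltr_nat.
have zL : z ^+ L = 1.
  by rewrite /z -cisMn mulrC divfK ?cis2pi // lt0r_neq0.
have := subrX1 (z ^+ k) L.
rewrite -exprM mulnC exprM zL expr1n subrr => /esym/eqP.
rewrite mulf_eq0 subr_eq0 (negPf zk1) /= => /eqP e; rewrite -[RHS]e.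
by apply: eq_bigr => l _; rewrite -exprM mulnC.
Qed.

(** The powers of a primitive root of unity of order [L] sum to zero for each exponent strictly
    between 0 and [L], so the mean over the roots keeps only the constant term. *)
Lemma average_horner (p : {poly R[i]}) (L : nat) : (size p <= L)%N -> (0 < L)%N ->
  \sum_(l < L) p.[cis (2 * pi / L%:R) ^+ l] = L%:R * p`_0.
Proof.
move=> sp; case: L sp => // L sp _.
under eq_bigr => l _ do rewrite (horner_coef_wide _ sp).
rewrite exchange_big big_ord_recl /= [X in _ + X]big1 ?addr0.
  by rewrite (eq_bigr (fun=> p`_0)) => [|i _]; rewrite ?expr0 ?mulr1 // sumr_const card_ord mulr_natl.
move=> i _; rewrite -mulr_sumr.
rewrite (eq_bigr (fun j : 'I_L.+1 => cis (2 * pi / L.+1%:R) ^+ (j * (lift ord0 i)))).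
  by rewrite sum_roots_of_unity ?mulr0.
by move=> j _; rewrite exprM.
Qed.

Lemma Re_normX (z : R[i]) n : complex.Re `|z ^+ n| = complex.Re `|z| ^+ n.
Proof.
elim: n => [|n IH]; first by rewrite !expr0 normr1.
by rewrite !exprS -IH; exact: (@rnormZ R R[i]^o).
Qed.

(* A power series with summable coefficients vanishing on an arc of the unit
   circle: the product of sufficiently many rotates of a partial sum is a
   polynomial which is uniformly small on the circle, and its mean value is a
   power of the constant term. *)
Lemma arc_const (c : nat -> R[i]) (b : nat -> R) (B d : R) :
  (forall n, complex.Re `|c n| <= b n) -> (forall n, series b n <= B) -> 0 < d ->
  (forall s, `|s| < d ->
     series (fun k => c k * cis (k%:R * s) : R[i]^o) @ \oo --> (0 : R[i]^o)) ->
  c 0%N = 0.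
Proof.
move=> cb bB d0 hz.
have b0 n : 0 <= b n by rewrite (le_trans (Re_norm_ge0 (c n))).
have pi0 : 0 < pi :> R by exact: pi_gt0.
(* [m.+1] arcs of length [2 * pi / m.+1], each shorter than [d], cover the circle. *)
have [m md] : exists m : nat, 2 * pi / m.+1%:R < d.
  exists (Num.trunc (2 * pi / d)); rewrite ltr_pdivrMr ?ltr0n // [d * _]mulrC -ltr_pdivrMr //.
  exact: truncnS_gt.
have B0 : 0 <= B by have := bB 0%N; rewrite /series /= big_geq.
have bnd : {homo series b : n m / (n <= m)%N >-> n <= m}.
  by apply/nondecreasing_seqP => n; rewrite seriesEnat /= big_nat_recr //= lerDl.
have cb' : cvgn (series b).
  by apply: nondecreasing_is_cvgn => //; exists B => _ [n _ <-]; exact: bB.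
suff key e : 0 < e -> complex.Re `|c 0%N| ^+ m.+1 <= e * (B + 1) ^+ m.
  have : complex.Re `|c 0%N| ^+ m.+1 <= 0.
    apply/ler_addgt0Pl => e e0; rewrite addr0.
    have K0 : 0 < (B + 1) ^+ m by rewrite exprn_gt0 // ltr_wpDl.
    by rewrite (le_trans (key _ (divr_gt0 e0 K0))) // divfK // lt0r_neq0.
  move=> h; apply: (@rnorm_eq0 R R[i]^o); rewrite rnorm_le_norm.
  have r0 := Re_norm_ge0 (c 0%N).
  have : complex.Re `|c 0%N| ^+ m.+1 == 0 by rewrite eq_le h exprn_ge0.
  by rewrite expf_eq0 => /andP[_ /eqP].
move=> e0.
pose e1 := Num.min e 1 / 2.
have e10 : 0 < e1 by rewrite divr_gt0 // lt_min e0 ltr01.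
have [M hM] : exists M, forall N, (M <= N)%N -> series b N - series b M <= e / 2.
  have /cvgrPdist_lt/(_ (e / 4)) := cb'; rewrite divr_gt0 // => /(_ isT)[M _ hM].
  exists M => N MN; have := hM _ MN; have := hM _ (leqnn M); rewrite /=.
  set l := lim _; have := ler_norm (- (l - series b N)); have := ler_norm (l - series b M).
  by rewrite normrN => ????; lra.
pose p := \poly_(k < M.+1) c k.
have pE z : p.[z] = \sum_(k < M.+1) c k * z ^+ k by rewrite horner_poly.
have hM1 N : (M.+1 <= N)%N -> series b N - series b M.+1 <= e / 2.
  move=> MN; have := hM _ (ltnW MN); have := bnd _ _ (leqnSn M); lra.
have pB t : complex.Re `|p.[cis t]| <= B.
  rewrite pE; have := @rnorm_sum R R[i]^o _ (index_enum _) (fun k : 'I_M.+1 => c k * cis t ^+ k).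
  rewrite !rnorm_le_norm => /le_trans; apply; apply: le_trans (bB M.+1).
  rewrite seriesEnat /= big_mkord; apply: ler_sum => k _.
  by rewrite rnorm_le_norm normrM normrX norm_cis expr1n mulr1.
have small s : `|s| < d -> complex.Re `|p.[cis s]| <= e.
  move=> sd; have e2 : 0 < e / 2 by rewrite divr_gt0.
  have [N hN] := (cvgn_rnormP _ _).1 (hz _ sd) _ e2.
  pose n := maxn N M.+1; have := hN n (leq_maxl _ _); rewrite subr0 => h1.
  have h2 := hM1 n (leq_maxr _ _).
  have pser : p.[cis s] = series (fun k => c k * cis (k%:R * s) : R[i]^o) M.+1.
    by rewrite pE seriesEnat /= big_mkord; apply: eq_bigr => k _; rewrite cisMn.
  have h3 : rnorm (series (fun k => c k * cis (k%:R * s) : R[i]^o) n -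
      series (fun k => c k * cis (k%:R * s) : R[i]^o) M.+1) <= e / 2.
    rewrite sub_series_geq ?leq_maxr // (le_trans (rnorm_sum _ _)) //.
    apply: le_trans h2; rewrite sub_series_geq ?leq_maxr //; apply: ler_sum => k _.
    by rewrite rnorm_le_norm normrM norm_cis mulr1.
  rewrite pser -rnorm_le_norm; set x := series _ M.+1 in h3 *; set y := series _ n in h1 h3.
  have := rnorm_triangle y x 0.
  by rewrite !subr0 rnormB => h4; lra.
(* [P] below has degree at most [m.+1 * M], which is less than [L], so averaging over the roots of
   unity of order [L] isolates its constant term; [zt ^+ Q] is the rotation by [2 * pi / m.+1]. *)
pose Q := M.+2; pose L := (m.+1 * Q)%N.
have L0 : (0 < L)%N by [].
have L0' : (0 : R) < L%:R by rewrite ltr0n.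
pose zt := cis (2 * pi / L%:R).
pose P := \prod_(j < m.+1) (p \Po ((zt ^+ (j * Q)) *: 'X)).
have PE z : P.[z] = \prod_(j < m.+1) p.[zt ^+ (j * Q) * z].
  rewrite horner_prod; apply: eq_bigr => j _.
  by rewrite horner_comp hornerZ hornerX.
have sP : (size P <= L)%N.
  have sz (j : 'I_m.+1) : (size (p \Po ((zt ^+ (j * Q)) *: 'X)) <= M.+1)%N.
    apply: (leq_trans (size_comp_poly_leq _ _)).
    rewrite size_scale ?expf_neq0 ?cis_neq0 // size_polyX /= muln1 ltnS.
    by rewrite -subn1 leq_subLR (leq_trans (size_poly _ _)).
  apply: (leq_trans (size_prod_leq _ _)); rewrite card_ord leq_subLR.
  apply: (@leq_trans (\sum_(i < m.+1) M.+1).+1).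
    by rewrite ltnS; apply: leq_sum => i _; exact: sz.
  by rewrite sum_nat_const card_ord /L /Q; nia.
have P0 : P`_0 = c 0%N ^+ m.+1.
  rewrite -horner_coef0 PE (eq_bigr (fun=> c 0%N)) ?prodr_const ?card_ord // => j _.
  by rewrite mulr0 horner_coef0 coef_poly.
have Pz l : (l < L)%N -> complex.Re `|P.[zt ^+ l]| <= e * (B + 1) ^+ m.
  move=> lL.
  pose a := (l %/ Q)%N; pose r := (l %% Q)%N.
  have aQ : (a < m.+1)%N by rewrite ltn_divLR.
  have rQ : (r < Q)%N by rewrite ltn_mod.
  (* Cut the roots into [m.+1] blocks of [Q]. The factor with [j] congruent to [- a] modulo [m.+1]
     rotates block [a] onto block 0, whose angles are below [2 * pi / m.+1 < d]; [small] applies to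
     this factor, and [pB] bounds the others. *)
  have [j hj] : exists j : 'I_m.+1, zt ^+ (j * Q) * zt ^+ l = cis (r%:R * (2 * pi / L%:R)).
    have ztL : zt ^+ L = 1 by rewrite /zt -cisMn mulrC divfK ?cis2pi // lt0r_neq0.
    have lE : l = (a * Q + r)%N by exact: divn_eq.
    have [a0|a0] := posnP a.
      by exists ord0; rewrite mul0n expr0 mul1r cisMn lE a0.
    have mj : (m.+1 - a < m.+1)%N by rewrite ltn_subrL a0.
    exists (Ordinal mj); rewrite -exprD cisMn lE /= mulnBl addnA subnK.
      by rewrite exprD -/L ztL mul1r.
    by rewrite leq_mul2r (ltnW aQ) orbT.
  have hs : complex.Re `|p.[zt ^+ (j * Q) * zt ^+ l]| <= e.
    rewrite hj; apply: small; rewrite ger0_norm; last first.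
      by rewrite mulr_ge0 // divr_ge0 // mulr_ge0 // ltW.
    apply: le_lt_trans md; rewrite mulrCA ler_pM2l ?mulr_gt0 //.
    rewrite ler_pdivrMr // mulrC ler_pdivlMr ?ltr0n // -natrM ler_nat /L mulnC leq_mul2l /=.
    exact: ltnW.
  have hz' i : zt ^+ (i * Q) * zt ^+ l = cis ((i * Q + l)%:R * (2 * pi / L%:R)).
    by rewrite cisMn exprD.
  rewrite -lecR RRe_real ?normr_real // PE normr_prod (bigD1 j) //= rmorphM /=.
  apply: ler_pM; rewrite ?normr_ge0 ?prodr_ge0 //.
    by move: hs; rewrite -lecR RRe_real ?normr_real.
  rewrite rmorphXn /=.
  have -> : (B + 1)%:C ^+ m = \prod_(i < m.+1 | i != j) (B + 1)%:C.
    by rewrite prodr_const; congr (_ ^+ _); rewrite cardC1 card_ord.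
  apply: ler_prod => i _; rewrite normr_ge0 /= hz'.
  have := pB ((i * Q + l)%:R * (2 * pi / L%:R)); rewrite -lecR RRe_real ?normr_real //.
  by move=> /le_trans; apply; rewrite lecR lerDl.
have := average_horner sP L0; rewrite -/zt P0 => av.
have : complex.Re `|L%:R * c 0%N ^+ m.+1| <= L%:R * (e * (B + 1) ^+ m).
  rewrite -av; have := @rnorm_sum R R[i]^o _ (index_enum _) (fun l : 'I_L => P.[zt ^+ l]).
  rewrite !rnorm_le_norm => /le_trans; apply.
  apply: (@le_trans _ _ (\sum_(l < L) (e * (B + 1) ^+ m))).
    by apply: ler_sum => l _; rewrite rnorm_le_norm; exact: Pz.
  by rewrite sumr_const card_ord mulr_natl.
have -> : L%:R * c 0%N ^+ m.+1 = (L%:R : R)%:C *: (c 0%N ^+ m.+1 : R[i]^o).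
  by rewrite rmorph_nat.
have -> : complex.Re `|(L%:R : R)%:C *: (c 0%N ^+ m.+1 : R[i]^o)| = L%:R * complex.Re `|c 0%N ^+ m.+1|.
  by apply: (@rnormZr R R[i]^o); rewrite ler0n.
rewrite Re_normX.
by rewrite ler_pM2l.
Qed.

(** Once the first [n] coefficients are known to vanish, the series is [cis (n%:R * s)] times the
    series of the shifted coefficients, and [arc_const] gives the next one. *)
Lemma arc_zero (c : nat -> R[i]) (b : nat -> R) (B d : R) :
  (forall n, complex.Re `|c n| <= b n) -> (forall n, series b n <= B) -> 0 < d ->
  (forall s, `|s| < d ->
     series (fun k => c k * cis (k%:R * s) : R[i]^o) @ \oo --> (0 : R[i]^o)) ->
  forall n, c n = 0.
Proof.
move=> cb bB d0 hz; elim/ltn_ind => n IH.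
have b0 k : 0 <= b k by rewrite (le_trans (Re_norm_ge0 (c k))).
have split_series (u : nat -> R[i]^o) N :
    series u (N + n)%N = series u n + series (fun k => u (k + n)%N) N.
  rewrite !seriesEnat /= (big_cat_nat (n := n)) ?leq_addl //=; congr (_ + _).
  by rewrite -{1}[n]add0n big_addn addnK.
have split_seriesR (u : nat -> R) N :
    series u (N + n)%N = series u n + series (fun k => u (k + n)%N) N.
  rewrite !seriesEnat /= (big_cat_nat (n := n)) ?leq_addl //=; congr (_ + _).
  by rewrite -{1}[n]add0n big_addn addnK.
rewrite -[n]add0n.
apply: (@arc_const (fun k => c (k + n)%N) (fun k => b (k + n)%N) B d) => // [N|s sd].
  have := bB (N + n)%N; rewrite split_seriesR; apply: le_trans.
  by rewrite lerDr seriesEnat /=; apply: sumr_ge0.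
apply/cvgn_rnormP => e e0; have [N hN] := (cvgn_rnormP _ _).1 (hz _ sd) _ e0.
exists N => k Nk; have := hN (k + n)%N (leq_trans Nk (leq_addr _ _)).
rewrite !subr0 split_series [X in X + _](_ : _ = 0) ?add0r; last first.
  by rewrite seriesEnat /= big_nat big1 // => i /andP[_ /IH ->]; rewrite mul0r.
have -> : series (fun i => c (i + n)%N * cis ((i + n)%N%:R * s) : R[i]^o) k =
    cis (n%:R * s) *: series (fun i => c (i + n)%N * cis (i%:R * s) : R[i]^o) k.
  rewrite !seriesEnat /= scaler_sumr; apply: eq_bigr => i _.
  by rewrite natrD mulrDl cisD -[RHS]/(_ * _); ring.
by rewrite rnormZ norm_cis mul1r.
Qed.

End Cis.

(** * Smooth functions *)

Section RealDerivatives.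
Variable R : realType.
Implicit Types (f g F : R -> R) (x a b c : R).

Lemma der_val f x a b : is_derive x 1 f a -> a = b -> is_derive x 1 f b.
Proof. by move=> h <-. Qed.

Lemma der_ext f g x a : is_derive x 1 f a -> f =1 g -> is_derive x 1 g a.
Proof. by move=> h /funext <-. Qed.

Lemma derD f g x a b : is_derive x 1 f a -> is_derive x 1 g b ->
  is_derive x 1 (fun y => f y + g y) (a + b).
Proof. exact: is_deriveD. Qed.

Lemma derM f g x a b : is_derive x 1 f a -> is_derive x 1 g b ->
  is_derive x 1 (fun y => f y * g y) (f x * b + g x * a).
Proof. exact: is_deriveM. Qed.

Lemma der_cst c x : is_derive x 1 (fun _ : R => c) 0.
Proof. exact: is_derive_cst. Qed.

Lemma derZ f x a c : is_derive x 1 f a -> is_derive x 1 (fun y => c * f y) (c * a).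
Proof. by move=> h; apply: der_val (derM (der_cst c x) h) _; rewrite mulr0 addr0. Qed.

Lemma derN f x a : is_derive x 1 f a -> is_derive x 1 (fun y => - f y) (- a).
Proof.
move=> h; apply: der_val (der_ext (derZ (-1) h) _) _; rewrite ?mulN1r //.
by move=> y; rewrite mulN1r.
Qed.

Lemma derB f g x a b : is_derive x 1 f a -> is_derive x 1 g b ->
  is_derive x 1 (fun y => f y - g y) (a - b).
Proof. by move=> h k; exact: derD h (derN k). Qed.

Lemma der_id x : is_derive x 1 (fun y : R => y) 1.
Proof. exact: is_derive_id. Qed.

Lemma der_comp f g x a b : is_derive (g x) 1 f a -> is_derive x 1 g b ->
  is_derive x 1 (fun y => f (g y)) (a * b).
Proof. exact: is_derive1_comp. Qed.

Lemma der_affine f a c b x : is_derive (c * x + b) 1 f a ->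
  is_derive x 1 (fun y => f (c * y + b)) (c * a).
Proof.
move=> h; rewrite mulrC; apply: (der_comp (g := fun y => c * y + b) h).
apply: der_val (derD (derZ c (der_id x)) (der_cst b x)) _.
by rewrite mulr1 addr0.
Qed.

Lemma der_cos x : is_derive x 1 (@cos R) (- sin x).
Proof. exact: is_derive_cos. Qed.

Lemma der_sin x : is_derive x 1 (@sin R) (cos x).
Proof. exact: is_derive_sin. Qed.

Lemma der_derive1 f x a : is_derive x 1 f a -> (derive1 f) x = a.
Proof. by move=> h; rewrite derive1E derive_val. Qed.

Lemma derivable_der f x : derivable f x 1 -> is_derive x 1 f ((derive1 f) x).
Proof. by move=> h; apply: DeriveDef => //; rewrite derive1E. Qed.

Lemma der_limP f x a :
  is_derive x 1 f a <-> h^-1 * (f (x + h) - f x) @[h --> 0^'] --> a.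
Proof.
have E : (fun h => h^-1 *: ((f \o shift x) (h *: (1 : R)) - f x)) =
         (fun h => h^-1 * (f (x + h) - f x)).
  by apply/funext => h /=; rewrite [h%:A]mulr1 [h + x]addrC.
split=> [[d e]|h].
  by rewrite -E -e; exact: d.
apply: DeriveDef; first by rewrite /derivable E; apply/cvg_ex; exists a.
by rewrite /derive E; apply/cvg_lim => //; exact: Rhausdorff.
Qed.

Lemma der_continuous f x a : is_derive x 1 f a -> {for x, continuous f}.
Proof. by move=> [d _]; apply: differentiable_continuous; exact/derivable1_diffP. Qed.

Lemma der0_const f : (forall x, is_derive x 1 f 0) -> forall x y, f x = f y.
Proof. by move=> h x y; exact: is_derive_0_is_cst. Qed.

Lemma der_nonincreasing f (df : R -> R) a b : a <= b ->
  (forall x, a <= x <= b -> is_derive x 1 f (df x)) ->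
  (forall x, a <= x <= b -> df x <= 0) -> f b <= f a.
Proof.
move=> ab hd hle.
have hin (x : R) : x \in `]a, b[ -> a <= x <= b.
  by rewrite in_itv /= => /andP[/ltW -> /ltW ->].
apply: (@ler0_derive1_le_cc R f a b) => //.
- by move=> x /hin /hd [].
- by move=> x /hin hx; rewrite (der_derive1 (hd _ hx)) hle.
- apply: derivable_within_continuous => x; rewrite in_itv /= => hx.
  by case: (hd x hx).
- by rewrite in_itv /= lexx ab.
- by rewrite in_itv /= ab lexx.
Qed.

Lemma der0_const_on f a b : a <= b ->
  (forall x, a <= x <= b -> is_derive x 1 f 0) -> f a = f b.
Proof.
move=> ab h; apply/eqP; rewrite eq_le; apply/andP; split; last first.
  exact: (@der_nonincreasing f (fun=> 0)).
rewrite -lerN2.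
apply: (@der_nonincreasing (fun x => - f x) (fun=> 0)) => // x hx.
by apply: der_val (derN (h x hx)) _; rewrite oppr0.
Qed.

Lemma smooth_derivable f x : smooth f -> derivable f x 1.
Proof. by move=> h; exact: (h 0%N). Qed.

Lemma smooth_der f x : smooth f -> is_derive x 1 f ((derive1 f) x).
Proof. by move=> h; apply/derivable_der/smooth_derivable. Qed.

Lemma smooth_derive1 f : smooth f -> smooth (derive1 f).
Proof. by move=> h n x; rewrite -derive1Sn; exact: h. Qed.

Lemma smooth_continuous f : smooth f -> continuous f.
Proof. by move=> h x; exact: der_continuous (smooth_der x h). Qed.

(** Proves smoothness without computing iterated derivatives: it suffices to place [f] in a class
    that contains a derivative of each of its members. *)
Lemma smooth_class (C : (R -> R) -> Prop) :
  (forall f, C f -> exists2 g, C g & forall x, is_derive x 1 f (g x)) ->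
  forall f, C f -> smooth f.
Proof.
move=> hC f Cf n.
have hCd g : C g -> C (derive1 g) /\ forall x, derivable g x 1.
  move=> /hC [k Ck hk]; split; last by move=> x; case: (hk x).
  by have -> : (derive1 g) = k by apply/funext => x; rewrite (der_derive1 (hk x)).
have : C (derive1n n f).
  by elim: n => // n IH; rewrite derive1nS; case: (hCd _ IH).
by move=> /hCd [].
Qed.

(** The derivative of a product is a sum of products, and that of a composite is a product with a
    composite, so these forms are not separately closed under differentiation; the class generated
    by all of them is. *)
Inductive smooth_expr : (R -> R) -> Prop :=
| SmoothBase f : smooth f -> smooth_expr f
| SmoothAdd f g : smooth_expr f -> smooth_expr g -> smooth_expr (fun x => f x + g x)
| SmoothMul f g : smooth_expr f -> smooth_expr g -> smooth_expr (fun x => f x * g x)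
| SmoothComp f g : smooth f -> smooth g -> smooth_expr (fun x => f (g x)).

Lemma smooth_exprP f : smooth_expr f -> smooth f.
Proof.
apply: smooth_class => {}f; elim=> {f}.
- by move=> f sf; exists (derive1 f); [exact/SmoothBase/smooth_derive1 | move=> x; exact: smooth_der].
- move=> f g _ [df sdf hf] _ [dg sdg hg]; exists (fun x => df x + dg x).
    exact: SmoothAdd.
  by move=> x; exact: derD.
- move=> f g sf [df sdf hf] sg [dg sdg hg]; exists (fun x => f x * dg x + g x * df x).
    by apply: SmoothAdd; exact: SmoothMul.
  by move=> x; exact: derM.
- move=> f g sf sg; exists (fun x => (derive1 f) (g x) * (derive1 g) x).
    apply: SmoothMul; last exact/SmoothBase/smooth_derive1.
    exact: SmoothComp (smooth_derive1 sf) sg.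
  by move=> x; apply: der_comp; exact: smooth_der.
Qed.

Lemma smoothD f g : smooth f -> smooth g -> smooth (fun x => f x + g x).
Proof. by move=> sf sg; apply/smooth_exprP/SmoothAdd; exact: SmoothBase. Qed.

Lemma smoothM f g : smooth f -> smooth g -> smooth (fun x => f x * g x).
Proof. by move=> sf sg; apply/smooth_exprP/SmoothMul; exact: SmoothBase. Qed.

Lemma smooth_comp f g : smooth f -> smooth g -> smooth (fun x => f (g x)).
Proof. by move=> sf sg; exact/smooth_exprP/SmoothComp. Qed.

Lemma smooth_cst c : smooth (fun _ : R => c).
Proof.
apply: (@smooth_class (fun f => exists c, f = fun=> c)); last by exists c.
by move=> _ [d ->]; exists (fun=> 0); [exists 0 | move=> x; exact: der_cst].
Qed.

Lemma smooth_id : smooth (fun x : R => x).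
Proof.
apply: (@smooth_class (fun f => f = (fun x => x) \/ exists c, f = fun=> c)); last by left.
move=> _ [->|[c ->]].
  by exists (fun=> 1); [right; exists 1 | move=> x; exact: der_id].
by exists (fun=> 0); [right; exists 0 | move=> x; exact: der_cst].
Qed.

Lemma smooth_affine f c b : smooth f -> smooth (fun x => f (c * x + b)).
Proof.
move=> sf; have sg := smoothD (smoothM (@smooth_cst c) smooth_id) (@smooth_cst b).
exact: (smooth_comp sf sg).
Qed.

Lemma smooth_cos : smooth (@cos R).
Proof.
apply: (@smooth_class (fun f => exists a b, f = fun x => a * cos x + b * sin x)).
  move=> _ [a [b ->]]; exists (fun x => b * cos x + - a * sin x); first by exists b, (- a).
  move=> x; apply: der_val (derD (derZ a (der_cos x)) (derZ b (der_sin x))) _.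
  by rewrite mulrN mulNr addrC.
by exists 1, 0; apply/funext => x; rewrite mul1r mul0r addr0.
Qed.

Lemma smooth_sin : smooth (@sin R).
Proof.
have := @smooth_affine cos (-1) (pi / 2) smooth_cos.
by congr smooth; apply/funext => x; rewrite mulN1r -cosN opprD opprK cosBpihalf.
Qed.

(* The derivative of [p(1/x) exp(-1/x)] is [q(1/x) exp(-1/x)] with
   [q = X^2 (p - p')]. *)
Definition flat (p : {poly R}) x : R :=
  if 0 < x then p.[x^-1] * expR (- x^-1) else 0.

Lemma expR_lower (n : nat) (y : R) : 0 <= y -> y ^+ n <= n`!%:R * expR y.
Proof.
move=> y0; case: n => [|n].
  by rewrite expr0 fact0 mul1r -expR0 ler_expR.
have f0 : (0 : R) < (n.+1)`!%:R by rewrite ltr0n fact_gt0.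
have := expR_ge1Dxn n y0; rewrite -ler_pdivrMl // mulrC => h.
by apply: le_trans h; rewrite lerDr.
Qed.

(** The power 2 forces the difference quotient of [flat p] at 0 to tend to 0. The factorial of
    [i.+2] comes from comparing [x^-1 ^+ i.+2] with one term of the exponential series at [x^-1]. *)
Lemma flat_decay (p : {poly R}) : exists2 C : R, 0 <= C &
  forall x, 0 < x -> x < 1 -> `|flat p x| <= C * x ^+ 2.
Proof.
exists (\sum_(i < size p) `|p`_i| * (i.+2)`!%:R).
  by apply: sumr_ge0 => i _; rewrite mulr_ge0.
move=> x x0 x1; rewrite /flat x0 horner_coef mulr_suml mulr_suml.
apply: (le_trans (ler_norm_sum _ _ _)); apply: ler_sum => i _.
rewrite !normrM -!mulrA ler_wpM2l //.
have xi : 0 < x^-1 by rewrite invr_gt0.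
rewrite (ger0_norm (exprn_ge0 _ (ltW xi))) (ger0_norm (expR_ge0 _)) expRN.
rewrite ler_pdivrMr ?expR_gt0 // mulrAC.
have := expR_lower i.+2 (ltW xi).
have -> : x^-1 ^+ i.+2 = x^-1 ^+ i / x ^+ 2 by rewrite -addn2 exprD [x^-1 ^+ 2]exprVn.
by rewrite ler_pdivrMr ?exprn_gt0.
Qed.

Lemma der_flat (p : {poly R}) x : is_derive x 1 (flat p) (flat ('X^2 * (p - p^`())) x).
Proof.
have [x0|x0|->] := ltgtP x 0.
- have e : \near x, (fun=> 0) x = flat p x.
    have : \forall y \near x, y < 0 by exact: lt_nbhsl.
    by apply: filterS => y y0; rewrite /flat ltNge (ltW y0).
  apply: near_eq_is_derive e _; rewrite /flat ltNge (ltW x0); exact: der_cst.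
- have e : \near x, (fun y => p.[y^-1] * expR (- y^-1)) x = flat p x.
    have : \forall y \near x, 0 < y by exact: lt_nbhsr.
    by apply: filterS => y y0; rewrite /flat y0.
  apply: near_eq_is_derive e _; rewrite /flat x0.
  have xn : x != 0 by rewrite gt_eqF.
  have dV : is_derive x 1 (fun y : R => y^-1) (- x ^- 2).
    by apply: der_val (is_deriveV (f := fun y => y) xn (der_id x)) _; rewrite [_ *: _]mulr1.
  have dp : is_derive x 1 (fun y => p.[y^-1]) ((p^`()).[x^-1] * - x ^- 2).
    apply: (der_comp (f := fun z => p.[z]) _ dV).
    exact: is_derive_poly.
  have de : is_derive x 1 (fun y => expR (- y^-1)) (expR (- x^-1) * - - x ^- 2).
    exact: (der_comp (f := expR) (is_derive_expR _) (derN dV)).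
  apply: der_val (derM dp de) _.
  by rewrite hornerM hornerXn hornerD hornerN exprVn; ring.
- apply/der_limP; rewrite /flat ltxx.
  have [C C0 hC] := flat_decay p.
  apply/cvgrPdist_lt => e e0.
  have d0 : 0 < Num.min 1 (e / (C + 1)).
    by rewrite lt_min ltr01 divr_gt0 // ltr_wpDl.
  apply/nbhs_ballP; exists (Num.min 1 (e / (C + 1))) => //= h.
  rewrite /ball /= sub0r normrN lt_min => /andP[h1 h2] hn.
  rewrite sub0r normrN add0r subr0.
  have [hp|hp] := ltP 0 h; last by rewrite mulr0 normr0.
  have := hC h hp; rewrite ltr_normlW // => /(_ isT); rewrite /flat hp => h3.
  rewrite normrM normfV (gtr0_norm hp) ltr_pdivrMl //.
  apply: le_lt_trans h3 _; rewrite expr2 mulrCA ltr_pM2l //.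
  rewrite (gtr0_norm hp) in h2.
  have K0 : 0 < C + 1 by rewrite ltr_wpDl.
  apply: le_lt_trans (_ : (C + 1) * h < _); first by rewrite ler_wpM2r ?ltW // ltrDl.
  by rewrite mulrC -ltr_pdivlMr.
Qed.

Lemma smooth_flat (p : {poly R}) : smooth (flat p).
Proof.
apply: (@smooth_class (fun f => exists p, f = flat p)); last by exists p.
move=> _ [r ->]; exists (flat ('X^2 * (r - r^`()))); first by exists ('X^2 * (r - r^`())).
by move=> x; exact: der_flat.
Qed.

End RealDerivatives.

(** * Fourier coefficients *)

Section PeriodIntegral.
Variable R : realType.
Implicit Types (F G f g : R -> R) (t s x C c : R) (n : int).

Definition pint F : R := \int[lebesgue_measure]_(t in `[- pi, pi]) F t.

Lemma pi_ltNpi : - pi < pi :> R.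
Proof. by have := pi_gt0 R; lra. Qed.

Lemma pint_integrable F : continuous F ->
  lebesgue_measure.-integrable `[(- pi : R), pi] (EFin \o F).
Proof.
move=> cF; apply: continuous_compact_integrable; first exact: segment_compact.
exact: continuous_subspaceT.
Qed.

Lemma eq_pint F G : F =1 G -> pint F = pint G.
Proof. by move=> h; apply: eq_Rintegral => t _. Qed.

Lemma pintD F G : continuous F -> continuous G ->
  pint (fun t => F t + G t) = pint F + pint G.
Proof. by move=> cF cG; apply: RintegralD => //; exact: pint_integrable. Qed.

Lemma pintZ c F : continuous F -> pint (fun t => c * F t) = c * pint F.
Proof. by move=> cF; apply: RintegralZl => //; exact: pint_integrable. Qed.

Lemma pint_cst c : pint (fun=> c) = c * (2 * pi).
Proof.
rewrite /pint Rintegral_cst //= lebesgue_measure_itv /= lte_fin pi_ltNpi.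
by rewrite -EFinD /= opprK -mulr2n mulr_natl.
Qed.

Lemma pint_bound F C : continuous F -> (forall t, `|F t| <= C) ->
  `|pint F| <= C * (2 * pi).
Proof.
move=> cF hF; have cn : continuous (fun t => `|F t|).
  by move=> t; apply: (continuous_comp (cF t)); exact: norm_continuous.
apply: (le_trans (le_normr_Rintegral _ (pint_integrable cF))) => //.
rewrite -pint_cst; apply: le_Rintegral => //.
- exact: (pint_integrable cn).
- by apply: pint_integrable => t; exact: cst_continuous.
Qed.

Lemma pint_der F G a : pi < a -> (forall x, - a < x < a -> is_derive x 1 G (F x)) ->
  continuous F -> pint F = G pi - G (- pi).
Proof.
move=> pa dG cF; have p0 := pi_gt0 R.
have cG x : - a < x < a -> {for x, continuous G}.
  by move=> /dG h; exact: der_continuous h.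
rewrite /pint /Rintegral (@continuous_FTC2 _ _ G) ?pi_ltNpi //.
- exact: continuous_subspaceT.
- split.
  + by move=> x; rewrite in_itv /= => /andP[h1 h2]; case: (dG x) => //; lra.
  + by apply: cvg_at_right_filter; apply: cG; lra.
  + by apply: cvg_at_left_filter; apply: cG; lra.
- move=> x; rewrite in_itv /= => /andP[h1 h2].
  by rewrite (der_derive1 (dG x _)) //; lra.
Qed.

Lemma primitive F a : 0 < a -> continuous F ->
  exists G, forall x, - a < x < a -> is_derive x 1 G (F x).
Proof.
move=> a0 cF.
exists (fun x => \int[lebesgue_measure]_(t in `[- a, x]) F t) => x /andP[h1 h2].
have [|d e] := @continuous_FTC1_closed _ F (- a) x a h2 _ h1 (cF x).
  apply: continuous_compact_integrable; first exact: segment_compact.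
  exact: continuous_subspaceT.
by apply: der_val (derivable_der d) e.
Qed.

(** A primitive of [F] is nondecreasing; a zero integral would make it constant, and its derivative
    at [t0] would vanish. *)
Lemma pint_gt0 F t0 : continuous F -> (forall t, 0 <= F t) ->
  - pi < t0 < pi -> 0 < F t0 -> 0 < pint F.
Proof.
move=> cF F0 ht Ft; have p0 := pi_gt0 R.
have a0 : 0 < pi + 1 :> R by lra.
have [G dG] := primitive a0 cF.
rewrite (@pint_der F G (pi + 1)) //; last by lra.
have mono a b : - pi <= a -> a <= b -> b <= pi -> G a <= G b.
  move=> ha ab hb; rewrite -lerN2.
  apply: (@der_nonincreasing R (fun x => - G x) (fun x => - F x)) => // x hx.
    by apply: derN; apply: dG; lra.
  by rewrite oppr_le0.
rewrite subr_gt0 lt_neqAle mono ?lexx ?(ltW pi_ltNpi) // andbT.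
apply/negP => /eqP e.
have Gc x : - pi <= x <= pi -> G x = G pi.
  move=> hx; apply/eqP; rewrite eq_le mono /=; try lra.
  by rewrite -e mono //; lra.
have d1 : is_derive t0 1 G (F t0) by apply: dG; lra.
have d2 : is_derive t0 1 G 0.
  apply: near_eq_is_derive (der_cst (G pi) t0).
  have : \forall y \near t0, - pi < y < pi.
    have i1 : \forall y \near t0, - pi < y by apply: lt_nbhsr; lra.
    have i2 : \forall y \near t0, y < pi by apply: lt_nbhsl; lra.
    by near=> y; apply/andP; split; near: y.
  by apply: filterS => y hy; rewrite Gc //; lra.
by move: Ft; rewrite -(der_derive1 d1) (der_derive1 d2) ltxx.
Unshelve. all: by end_near. Qed.

Definition periodic2pi F := forall t, F (t + 2 * pi) = F t.

(** With [G] a primitive, both integrals are values of [G (x + 2 * pi) - G x], a function of [x]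
    whose derivative is 0 by periodicity. *)
Lemma pint_shift F s : continuous F -> periodic2pi F ->
  pint (fun t => F (t - s)) = pint F.
Proof.
move=> cF pF; have p0 := pi_gt0 R.
have s0 : 0 <= `|s| by exact: normr_ge0.
(* A half-width covering all the points where [G] is differentiated below, shifts by [s] and by
   [2 * pi] included. *)
pose a := 3 * pi + `|s| + 1.
have a0 : 0 < a by rewrite /a; lra.
have [G dG] := primitive a0 cF.
have hs1 := ler_norm s; have hs2 := ler_norm (- s); rewrite normrN in hs2.
have cFs : continuous (fun t => F (t - s)).
  move=> t; apply: (continuous_comp (f := fun y => y - s)); last exact: cF.
  by apply: cvgB; [exact: cvg_id | exact: cvg_cst].
have -> : pint (fun t => F (t - s)) = G (pi - s) - G (- pi - s).
  apply: (@pint_der _ (fun t => G (t - s)) (pi + 1)) => //; first by lra.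
  move=> x hx; have := @der_affine R G (F (x - s)) 1 (- s) x.
  rewrite !mul1r => h; apply: der_ext (h _) _; first by apply: dG; rewrite /a; lra.
  by move=> y; rewrite mul1r.
have -> : pint F = G pi - G (- pi).
  apply: (@pint_der _ _ (pi + 1)) => //; first by lra.
  by move=> x hx; apply: dG; rewrite /a; lra.
pose K x := G (x + 2 * pi) - G x.
have -> : G (pi - s) - G (- pi - s) = K (- pi - s).
  by rewrite /K; congr (G _ - _); ring.
have -> : G pi - G (- pi) = K (- pi) by rewrite /K; congr (G _ - _); ring.
have dK x : - pi - `|s| <= x <= - pi + `|s| -> is_derive x 1 K 0.
  move=> hx; apply: der_val (derB _ _) (subrr (F x)).
    have := @der_affine R G (F (x + 2 * pi)) 1 (2 * pi) x.
    rewrite !mul1r => h; rewrite -pF; apply: der_ext (h _) _; last by move=> y; rewrite mul1r.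
    by apply: dG; rewrite /a; lra.
  by apply: dG; rewrite /a; lra.
case: (leP 0 s) => ss.
  by apply: der0_const_on => [|x hx]; [lra | apply: dK; lra].
by apply/esym/der0_const_on => [|x hx]; [lra | apply: dK; lra].
Qed.

Lemma periodic_derive1 F : smooth F -> periodic2pi F -> periodic2pi (derive1 F).
Proof.
move=> sF pF t.
have h : is_derive t 1 F (derive1 F (t + 2 * pi)).
  have := @der_affine R F (derive1 F (t + 2 * pi)) 1 (2 * pi) t.
  rewrite !mul1r => h; apply: der_ext (h (smooth_der _ sF)) _.
  by move=> y; rewrite mul1r pF.
by rewrite (der_derive1 h).
Qed.

Lemma periodic_int F n : periodic2pi F -> forall t, F (t + n%:~R * (2 * pi)) = F t.
Proof.
move=> pF.
have hn (m : nat) t : F (t + m%:R * (2 * pi)) = F t.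
  elim: m t => [|m IH] t; first by rewrite mul0r addr0.
  by rewrite -natr1 mulrDl mul1r addrA pF IH.
case: n => m t; first exact: hn.
rewrite NegzE mulrNz mulNr; have := hn m.+1 (t - m.+1%:R * (2 * pi)).
by rewrite subrK => <-.
Qed.

Lemma periodic_bounded F : continuous F -> periodic2pi F ->
  exists2 C, 0 <= C & forall t, `|F t| <= C.
Proof.
move=> cF pF; have p0 := pi_gt0 R.
have cn : continuous (fun t => `|F t|).
  by move=> t; apply: (continuous_comp (cF t)); exact: norm_continuous.
have [c _ hc] := EVT_max (ltW pi_ltNpi) (continuous_subspaceT (A := `[- pi, pi]) cn).
exists `|F c| => // t.
pose m := Num.floor ((t + pi) / (2 * pi)).
have h1 : m%:~R * (2 * pi) <= t + pi by rewrite -ler_pdivlMr ?mulr_gt0 // floor_le_tmp.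
have h2 : t + pi < (m + 1)%:~R * (2 * pi).
  by rewrite -ltr_pdivrMr ?mulr_gt0 // floorD1_gt.
have := hc (t + (- m)%:~R * (2 * pi)); rewrite periodic_int //; apply.
move: h2; rewrite intrD mulrDl mul1r => h2.
by rewrite in_itv /= mulrNz mulNr; apply/andP; split; lra.
Qed.

Lemma cis_int t n : cis (n%:~R * t) = cis t ^ n.
Proof.
case: n => m; first by rewrite -pmulrn cisMn.
by rewrite NegzE mulrNz mulNr cisN cisMn.
Qed.

Lemma cis_periodic n t : cis (n%:~R * (t + 2 * pi)) = cis (n%:~R * t).
Proof. by rewrite mulrDr cisD [cis (_ * (2 * pi))]cis_int cis2pi exp1rz mulr1. Qed.

Lemma cos_int_periodic n : periodic2pi (fun t => cos (n%:~R * t)).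
Proof. by move=> t; have := cis_periodic n t => -[]. Qed.

Lemma sin_int_periodic n : periodic2pi (fun t => sin (n%:~R * t)).
Proof. by move=> t; have := cis_periodic n t => -[]. Qed.

Lemma smooth_cos_int n : smooth (fun t : R => cos (n%:~R * t)).
Proof.
have := @smooth_affine R cos n%:~R 0 (@smooth_cos R).
by congr smooth; apply/funext => t; rewrite addr0.
Qed.

Lemma smooth_sin_int n : smooth (fun t : R => sin (n%:~R * t)).
Proof.
have := @smooth_affine R sin n%:~R 0 (@smooth_sin R).
by congr smooth; apply/funext => t; rewrite addr0.
Qed.

Lemma der_cos_int n t :
  is_derive t 1 (fun t : R => cos (n%:~R * t)) (- (n%:~R * sin (n%:~R * t))).
Proof.
have := @der_affine R cos (- sin (n%:~R * t + 0)) n%:~R 0 t (der_cos _).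
rewrite addr0 mulrN => h; apply: der_ext h _ => y; by rewrite addr0.
Qed.

Lemma der_sin_int n t :
  is_derive t 1 (fun t : R => sin (n%:~R * t)) (n%:~R * cos (n%:~R * t)).
Proof.
have := @der_affine R sin (cos (n%:~R * t + 0)) n%:~R 0 t (der_sin _).
rewrite addr0 => h; apply: der_ext h _ => y; by rewrite addr0.
Qed.

(** Unnormalized real coefficients: [fourier] is assembled from those of the real and imaginary
    parts, so that real calculus suffices. *)
Definition cos_coef F n := pint (fun t => F t * cos (n%:~R * t)).
Definition sin_coef F n := pint (fun t => F t * sin (n%:~R * t)).

Lemma continuous_mul_smooth F G : smooth F -> smooth G ->
  continuous (fun t => F t * G t).
Proof. by move=> sF sG; apply: smooth_continuous; exact: smoothM. Qed.

Lemma pint_der_periodic F G : (forall x, is_derive x 1 G (F x)) -> continuous F ->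
  periodic2pi G -> pint F = 0.
Proof.
move=> dG cF pG; rewrite (@pint_der F G (pi + 1)) //; last by lra.
by rewrite -[G (- pi)]pG (_ : - pi + 2 * pi = pi) ?subrr //; ring.
Qed.

(** Integration by parts: the combined integrand of the two sides is the derivative of the periodic
    function [F t * sin (n%:~R * t)]. *)
Lemma cos_coef_derive F n : smooth F -> periodic2pi F ->
  n%:~R * cos_coef F n = - sin_coef (derive1 F) n.
Proof.
move=> sF pF; have sd := smooth_derive1 sF.
have cs := @smooth_cos_int n; have sn := @smooth_sin_int n.
apply/eqP; rewrite -addr_eq0 /cos_coef -pintZ; last exact: continuous_mul_smooth.
rewrite -pintD; last 2 first.
- by apply: smooth_continuous; apply: smoothM; [exact: smooth_cst | exact: smoothM].
- exact: continuous_mul_smooth.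
apply/eqP; apply: (@pint_der_periodic _ (fun t => F t * sin (n%:~R * t))).
- move=> x; apply: der_val (derM (smooth_der x sF) (der_sin_int n x)) _.
  by ring.
- apply: smooth_continuous; apply: smoothD; last exact: smoothM.
  by apply: smoothM; [exact: smooth_cst | exact: smoothM].
- by move=> t; rewrite pF sin_int_periodic.
Qed.

Lemma sin_coef_derive F n : smooth F -> periodic2pi F ->
  n%:~R * sin_coef F n = cos_coef (derive1 F) n.
Proof.
move=> sF pF; have sd := smooth_derive1 sF.
have cs := @smooth_cos_int n; have sn := @smooth_sin_int n.
apply/eqP; rewrite eq_sym -subr_eq0 -mulNr /sin_coef -pintZ; last exact: continuous_mul_smooth.
rewrite -pintD; last 2 first.
- exact: continuous_mul_smooth.
- by apply: smooth_continuous; apply: smoothM; [exact: smooth_cst | exact: smoothM].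
apply/eqP; apply: (@pint_der_periodic _ (fun t => F t * cos (n%:~R * t))).
- move=> x; apply: der_val (derM (smooth_der x sF) (der_cos_int n x)) _.
  by ring.
- apply: smooth_continuous; apply: smoothD; first exact: smoothM.
  by apply: smoothM; [exact: smooth_cst | exact: smoothM].
- by move=> t; rewrite pF cos_int_periodic.
Qed.

Lemma trig_coef_decay (q : nat) F : smooth F -> periodic2pi F ->
  exists C, forall n, `|n%:~R| ^+ q * `|cos_coef F n| <= C /\
                      `|n%:~R| ^+ q * `|sin_coef F n| <= C.
Proof.
elim: q F => [|q IH] F sF pF.
  have [C C0 hC] := periodic_bounded (smooth_continuous sF) pF.
  exists (C * (2 * pi)) => n; rewrite !expr0 !mul1r.
  split; apply: pint_bound.
  - exact: (continuous_mul_smooth sF (@smooth_cos_int n)).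
  - move=> t; rewrite normrM -[C]mulr1 ler_pM // ler_norml.
    by rewrite cos_geN1 cos_le1.
  - exact: (continuous_mul_smooth sF (@smooth_sin_int n)).
  - move=> t; rewrite normrM -[C]mulr1 ler_pM // ler_norml.
    by rewrite sin_geN1 sin_le1.
have [C hC] := IH _ (smooth_derive1 sF) (periodic_derive1 sF pF).
exists C => n; have [h1 h2] := hC n; rewrite !exprSr -!mulrA -!normrM.
by rewrite cos_coef_derive // sin_coef_derive // normrN.
Qed.

End PeriodIntegral.

Section CircleFourier.
Variable R : realType.
Local Notation S1 := (@unit_circle R).
Implicit Types (f g : S1 -> R[i]) (n : int) (t s : R).

Lemma circle_valE t : circle_val (expi t) = cis t. Proof. by []. Qed.

Lemma circle_val_inj : injective (@circle_val R).
Proof. exact: val_inj. Qed.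

Lemma circle_norm (z : S1) : `|circle_val z| = 1.
Proof. by case: z => z zP; exact: (set_mem zP). Qed.

Lemma expi_periodic t : expi (t + 2 * pi) = expi t :> S1.
Proof. by apply: circle_val_inj; rewrite !circle_valE cisD cis2pi mulr1. Qed.

Lemma smooth_circle_re f : smooth_on_circle f -> smooth (fun t => complex.Re (f (expi t))).
Proof. by case. Qed.

Lemma smooth_circle_im f : smooth_on_circle f -> smooth (fun t => complex.Im (f (expi t))).
Proof. by case. Qed.

Lemma periodic_re f : periodic2pi (fun t => complex.Re (f (expi t))).
Proof. by move=> t; rewrite expi_periodic. Qed.

Lemma periodic_im f : periodic2pi (fun t => complex.Im (f (expi t))).
Proof. by move=> t; rewrite expi_periodic. Qed.

Lemma fourierE f n : smooth_on_circle f ->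
  let u t := complex.Re (f (expi t)) in let v t := complex.Im (f (expi t)) in
  fourier f n = ((2 * pi)^-1)%:C *
    ((cos_coef u n + sin_coef v n) +i* (cos_coef v n - sin_coef u n)).
Proof.
move=> [sf1 sf2] u v; have [c s] := (@smooth_cos_int R n, @smooth_sin_int R n).
have uc := continuous_mul_smooth sf1 c; have vs := continuous_mul_smooth sf2 s.
have vc := continuous_mul_smooth sf2 c; have us := continuous_mul_smooth sf1 s.
have E t : f (expi t) * circle_val (expi (- (n%:~R * t))) =
   (u t * cos (n%:~R * t) + v t * sin (n%:~R * t)) +i*
   (v t * cos (n%:~R * t) + -1 * (u t * sin (n%:~R * t))).
  rewrite circle_valE /cis cosN sinN /u /v; case: (f _) => a b.
  by simpc => /=; congr (_ +i* _); ring.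
rewrite /fourier; congr (_ * (_ +i* _)).
  rewrite -(pintD uc vs).
  by apply: eq_pint => t; rewrite E.
have -> : - sin_coef u n = pint (fun t => -1 * (u t * sin (n%:~R * t))).
  by rewrite (pintZ _ us) mulN1r.
have us' := continuous_mul_smooth (@smooth_cst R (-1)) (smoothM sf1 s).
by rewrite -(pintD vc us'); apply: eq_pint => t; rewrite E.
Qed.

Lemma fourier_decay (q : nat) f : smooth_on_circle f -> exists2 C : R, 0 <= C &
  forall n, complex.Re `|fourier f n| * ((absz n).+1%:R) ^+ q <= C.
Proof.
move=> sf; have p0 := pi_gt0 R.
have trig (F : R -> R) : smooth F -> periodic2pi F -> exists C, forall n,
    (`|n%:~R| ^+ q + 1) * `|cos_coef F n| <= C /\
    (`|n%:~R| ^+ q + 1) * `|sin_coef F n| <= C.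
  move=> sF pF; have [C hC] := trig_coef_decay q sF pF.
  have [D hD] := trig_coef_decay 0 sF pF.
  exists (C + D) => n; have [h1 h2] := hC n; have [h3 h4] := hD n.
  rewrite !mulrDl !mul1r; rewrite !expr0 !mul1r in h3 h4.
  by split; lra.
have [C1 h1] := trig _ (smooth_circle_re sf) (periodic_re f).
have [C2 h2] := trig _ (smooth_circle_im sf) (periodic_im f).
have pi2 : 0 < (2 * pi : R)^-1 by rewrite invr_gt0 mulr_gt0.
pose C := (2 * pi)^-1 * (2 * C1 + 2 * C2) * 2 ^+ q.
exists `|C| => // n.
have [a1 b1] := h1 n; have [a2 b2] := h2 n.
rewrite fourierE //.
set u := fun t => complex.Re _ in a1 b1 *; set v := fun t => complex.Im _ in a2 b2 *.
apply: le_trans (ler_norm C).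
pose w : R := `|n%:~R| ^+ q + 1.
have w0 : 0 <= w by rewrite addr_ge0 // exprn_ge0.
(* The weight [absz n + 1] is at most twice [absz n] unless [n] is 0, a case covered by the summand
   1 in [w]; this is the origin of [2 ^+ q]. *)
have nw : ((absz n).+1%:R) ^+ q <= 2 ^+ q * w.
  have e : `|n%:~R| = (absz n)%:R :> R by rewrite natr_absz intr_norm.
  rewrite /w e; case: (absz n) => [|m].
    rewrite expr1n mulrDr mulr1 [_ ^+ q * _ ^+ q]mulrC -[X in X <= _]add0r lerD //.
    by rewrite exprn_ege1 // ler1n.
  apply: le_trans (_ : 2 ^+ q * m.+1%:R ^+ q <= _).
    rewrite -exprMn; apply: lerXn2r; rewrite ?nnegrE ?mulr_ge0 //.
    by rewrite -natrM ler_nat; lia.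
  by rewrite ler_wpM2l ?exprn_ge0 // lerDl.
set z := _ +i* _.
have hz : complex.Re `|((2 * pi)^-1)%:C * z| = (2 * pi)^-1 * complex.Re `|z|.
  exact: (@rnormZr R R[i]^o (2 * pi)^-1 z (ltW pi2)).
have nz : complex.Re `|z| <= `|complex.Re z| + `|complex.Im z|.
  rewrite normc_def /=; set a := _ + _; set b := _ - _.
  rewrite -[X in _ <= X]ger0_norm ?addr_ge0 // -sqrtr_sqr ler_wsqrtr //.
  rewrite sqrrD !real_normK ?num_real // -addrA [_ *+ 2 + _]addrC addrA lerDl.
  by rewrite mulrn_wge0 // mulr_ge0.
have wz : w * complex.Re `|z| <= 2 * C1 + 2 * C2.
  apply: le_trans (_ : w * (`|complex.Re z| + `|complex.Im z|) <= _).
    by rewrite ler_wpM2l.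
  rewrite mulrDr /=.
  have k1 : w * `|cos_coef u n + sin_coef v n| <= C1 + C2.
    apply: le_trans (_ : w * (`|cos_coef u n| + `|sin_coef v n|) <= _).
      by rewrite ler_wpM2l // ler_normD.
    by rewrite mulrDr lerD.
  have k2 : w * `|cos_coef v n - sin_coef u n| <= C1 + C2.
    apply: le_trans (_ : w * (`|cos_coef v n| + `|sin_coef u n|) <= _).
      by rewrite ler_wpM2l // ler_normB.
    by rewrite mulrDr [C1 + _]addrC lerD.
  lra.
rewrite hz /C -!mulrA ler_wpM2l ?(ltW pi2) //.
apply: le_trans (_ : complex.Re `|z| * (2 ^+ q * w) <= _).
  by rewrite ler_wpM2l ?Re_norm_ge0.
rewrite mulrCA mulrC ler_wpM2r ?exprn_ge0 //.
by rewrite mulrC.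
Qed.

Lemma smooth_one : smooth_on_circle (@one_field R).
Proof. by split => /=; exact: smooth_cst. Qed.

Lemma smooth_cos_field : smooth_on_circle (@cos_field R).
Proof. by split => /=; [exact: smooth_cos | exact: smooth_cst]. Qed.

Lemma smooth_sin_field : smooth_on_circle (@sin_field R).
Proof. by split => /=; [exact: smooth_sin | exact: smooth_cst]. Qed.

Lemma pint0 : pint (fun=> 0 : R) = 0.
Proof. by rewrite pint_cst mul0r. Qed.

Lemma cos_coef0 n : cos_coef (fun=> 0 : R) n = 0.
Proof. by rewrite /cos_coef -[RHS]pint0; apply: eq_pint => t; rewrite mul0r. Qed.

Lemma sin_coef0 n : sin_coef (fun=> 0 : R) n = 0.
Proof. by rewrite /sin_coef -[RHS]pint0; apply: eq_pint => t; rewrite mul0r. Qed.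

Lemma intr_neq0 n : n != 0 -> n%:~R != 0 :> R.
Proof. by rewrite intr_eq0. Qed.

Lemma derive1_cst (c : R) : derive1 (fun=> c) = (fun=> 0) :> (R -> R).
Proof. by apply/funext => t; rewrite (der_derive1 (der_cst c t)). Qed.

Lemma derive1_cosE : derive1 (@cos R) = (fun t => - sin t).
Proof. by apply/funext => t; rewrite (der_derive1 (der_cos t)). Qed.

Lemma derive1_sinE : derive1 (@sin R) = @cos R.
Proof. by apply/funext => t; rewrite (der_derive1 (der_sin t)). Qed.

Lemma cos_coef1 n : cos_coef (fun=> 1 : R) n = if n == 0 then 2 * pi else 0.
Proof.
have [->|n0] := eqVneq n 0.
  rewrite /cos_coef -[RHS]mul1r -pint_cst; apply: eq_pint => t.
  by rewrite mul0r cos0 mulr1.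
apply: (mulfI (intr_neq0 n0)); rewrite cos_coef_derive ?mulr0 //.
  by rewrite derive1_cst sin_coef0 oppr0.
exact: smooth_cst.
Qed.

Lemma sin_coef1 n : sin_coef (fun=> 1 : R) n = 0.
Proof.
have [->|n0] := eqVneq n 0.
  rewrite /sin_coef -[RHS]pint0; apply: eq_pint => t.
  by rewrite mul0r sin0 mulr0.
apply: (mulfI (intr_neq0 n0)); rewrite sin_coef_derive ?mulr0 //.
  by rewrite derive1_cst cos_coef0.
exact: smooth_cst.
Qed.

Lemma fourier_one n : fourier (@one_field R) n = (n == 0)%:R.
Proof.
have p0 := pi_gt0 R.
rewrite fourierE /=; last exact: smooth_one.
rewrite cos_coef1 sin_coef1 cos_coef0 sin_coef0 addr0 subr0 complexr0.
case: eqP => _; last by rewrite mulr0.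
by rewrite -rmorphM mulVf //= lt0r_neq0 // mulr_gt0.
Qed.

Lemma cos_periodic : periodic2pi (@cos R).
Proof. by move=> t; have := cos_int_periodic 1 t; rewrite !mul1r. Qed.

Lemma sin_periodic : periodic2pi (@sin R).
Proof. by move=> t; have := sin_int_periodic 1 t; rewrite !mul1r. Qed.

Lemma coefN F n : continuous (fun t : R => F t * cos (n%:~R * t)) ->
  cos_coef (fun t => - F t) n = - cos_coef F n.
Proof.
move=> c; rewrite -mulN1r /cos_coef -pintZ //; apply: eq_pint => t.
by rewrite mulNr mulN1r.
Qed.

Lemma scoefN F n : continuous (fun t : R => F t * sin (n%:~R * t)) ->
  sin_coef (fun t => - F t) n = - sin_coef F n.
Proof.
move=> c; rewrite -mulN1r /sin_coef -pintZ //; apply: eq_pint => t.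
by rewrite mulNr mulN1r.
Qed.

(** Integration by parts, cos and sin being each other's derivatives up to sign. Applied twice it
    multiplies a coefficient by the square of [n], so the coefficients vanish unless that square is
    1. *)
Lemma trig_relations n :
  [/\ n%:~R * cos_coef (@cos R) n = sin_coef (@sin R) n,
      n%:~R * sin_coef (@cos R) n = - cos_coef (@sin R) n,
      n%:~R * cos_coef (@sin R) n = - sin_coef (@cos R) n
    & n%:~R * sin_coef (@sin R) n = cos_coef (@cos R) n].
Proof.
have cs := @smooth_cos_int R n; have sn := @smooth_sin_int R n.
have c := @smooth_cos R; have s := @smooth_sin R.
have pc := cos_periodic; have ps := sin_periodic.
split.
- rewrite cos_coef_derive // derive1_cosE scoefN ?opprK //; exact: continuous_mul_smooth.
- rewrite sin_coef_derive // derive1_cosE coefN //; exact: continuous_mul_smooth.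
- by rewrite cos_coef_derive // derive1_sinE.
- by rewrite sin_coef_derive // derive1_sinE.
Qed.

Lemma cos_coef_cos1 : cos_coef (@cos R) 1 = pi.
Proof.
have [h _ _ _] := trig_relations 1; rewrite mul1r in h.
have : cos_coef (@cos R) 1 + sin_coef (@sin R) 1 = 2 * pi.
  rewrite -[RHS]mul1r -pint_cst -pintD; last 2 first.
  - by apply: continuous_mul_smooth; [exact: smooth_cos | exact: smooth_cos_int].
  - by apply: continuous_mul_smooth; [exact: smooth_sin | exact: smooth_sin_int].
  by apply: eq_pint => t; rewrite mul1r -!expr2 cos2Dsin2.
by rewrite -h; lra.
Qed.

Lemma sin_coef_cos1 : sin_coef (@cos R) 1 = 0.
Proof.
have [_ h _ _] := trig_relations 1; rewrite mul1r in h.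
have : cos_coef (@sin R) 1 = sin_coef (@cos R) 1.
  by apply: eq_pint => t; rewrite mul1r mulrC.
by move=> e; rewrite e in h; lra.
Qed.

Lemma coef_opp F n : cos_coef F (- n) = cos_coef F n /\ sin_coef F (- n) = sin_coef (fun t : R => - F t) n.
Proof.
by split; apply: eq_pint => t; rewrite rmorphN mulNr ?cosN // sinN mulrN mulNr.
Qed.

Lemma trig_coefs n :
  [/\ cos_coef (@cos R) n = if (n == 1) || (n == -1) then pi else 0,
      sin_coef (@cos R) n = 0, cos_coef (@sin R) n = 0
    & sin_coef (@sin R) n = if n == 1 then pi else if n == -1 then - pi else 0].
Proof.
have [h1 h2 h3 h4] := trig_relations n.
have [->|n1] := eqVneq n 1.
  have [k1 k2 k3 k4] := trig_relations 1; rewrite mul1r in k1 k2.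
  rewrite cos_coef_cos1 in k1; rewrite sin_coef_cos1 in k2.
  rewrite cos_coef_cos1 sin_coef_cos1 -k1; split=> //.
  by move/eqP: k2; rewrite mulr0 eq_sym oppr_eq0 => /eqP.
have [n2|n2] := eqVneq n (-1).
  have [k1 k2] := coef_opp (@cos R) 1; have [k3 k4] := coef_opp (@sin R) 1.
  rewrite n2 k1 cos_coef_cos1 k2 scoefN; last first.
    by apply: continuous_mul_smooth; [exact: smooth_cos | exact: smooth_sin_int].
  rewrite sin_coef_cos1 oppr0 k3 k4 scoefN; last first.
    by apply: continuous_mul_smooth; [exact: smooth_sin | exact: smooth_sin_int].
  have [l1 l2 l3 l4] := trig_relations 1; rewrite mul1r in l1 l2.
  rewrite -l1 cos_coef_cos1; split=> //.
  by move/eqP: l2; rewrite sin_coef_cos1 ?mulr0 eq_sym oppr_eq0 => /eqP.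
have nn : n%:~R * n%:~R - 1 != 0 :> R.
  have -> : n%:~R * n%:~R - 1 = (n * n - 1)%:~R :> R by rewrite intrB intrM.
  rewrite intr_eq0 subr_eq0 -expr2 sqrf_eq1.
  by rewrite negb_or n1.
have z (x y : R) : n%:~R * x = y -> n%:~R * y = x -> x = 0.
  move=> a b; apply/eqP; have := congr1 (fun y => n%:~R * y) a; rewrite /= b mulrA => e.
  have : (n%:~R * n%:~R - 1) * x = 0 by rewrite mulrBl mul1r e subrr.
  by move/eqP; rewrite mulf_eq0 (negPf nn).
split=> /=.
- exact: z h1 h4.
- by apply: (z _ _ h2); rewrite mulrN h3 opprK.
- by apply: (z _ _ h3); rewrite mulrN h2 opprK.
- exact: z h4 h1.
Qed.

Lemma fourier_cos n :
  fourier (@cos_field R) n = if (n == 1) || (n == -1) then 2^-1 else 0.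
Proof.
have p0 := pi_gt0 R; have [h1 h2 h3 h4] := trig_coefs n.
rewrite fourierE /=; last exact: smooth_cos_field.
rewrite h1 h2 cos_coef0 sin_coef0 addr0 subr0 complexr0.
case: ifP => _; last by rewrite mulr0.
rewrite -rmorphM invfM -mulrA mulVf ?mulr1 ?lt0r_neq0 //=.
by rewrite fmorphV rmorph_nat.
Qed.

Lemma fourier_sin n :
  fourier (@sin_field R) n =
    if n == 1 then - ((0 +i* 1) / 2) else if n == -1 then (0 +i* 1) / 2 else 0.
Proof.
have p0 := pi_gt0 R; have [h1 h2 h3 h4] := trig_coefs n.
rewrite fourierE /=; last exact: smooth_sin_field.
rewrite h3 h4 cos_coef0 sin_coef0 addr0 sub0r.
have e (r : R) : ((2 * pi)^-1)%:C * (0 +i* (r * pi)) = r%:C * ((0 +i* 1) / 2) :> R[i].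
  have -> : 0 +i* (r * pi) = (r * pi)%:C * (0 +i* 1) :> R[i] by simpc.
  rewrite mulrA -rmorphM /= mulrCA invfM -mulrA mulVf ?mulr1 ?lt0r_neq0 //.
  by rewrite rmorphM fmorphV rmorph_nat /=; ring.
have [_|_] := eqVneq n 1.
  by have := e (-1); rewrite mulN1r => ->; rewrite rmorphN1 mulN1r.
have [_|_] := eqVneq n (-1).
  by have := e 1; rewrite mul1r opprK => ->; rewrite mul1r.
by rewrite oppr0 complexr0 mulr0.
Qed.

End CircleFourier.

(** * Test functions supported in an arc *)

Section Bump.
Variable R : realType.
Local Notation S1 := (@unit_circle R).
Implicit Types (c s t : R) (N n : int) (z : S1).

Definition rotated s z : R[i] := circle_val z * cis (- s).

(** Supported on the arc around [expi s] where the real part of the rotated coordinate is at least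
    [c]. The character of degree [N] shifts the Fourier coefficients, so that any prescribed one can
    be made nonzero. *)
Definition arc_bump c N s z : R[i] :=
  (flat 1 (complex.Re (rotated s z) - c))%:C * rotated s z ^ N.

Definition bump_profile c t : R := flat 1 (cos t - c).

(** The value of [fourier (arc_bump c N 0) n], written with the real coefficients of the profile. *)
Definition bump_coef c N n : R[i] := ((2 * pi)^-1)%:C *
  (cos_coef (bump_profile c) (N - n) +i* sin_coef (bump_profile c) (N - n)).

Lemma bump_expi c N s t :
  arc_bump c N s (expi t) = (bump_profile c (t - s))%:C * cis (N%:~R * (t - s)).
Proof. by rewrite /arc_bump /rotated circle_valE -cisD cis_int. Qed.

Lemma smooth_profile c : smooth (bump_profile c).
Proof.
apply: (@smooth_comp R (flat 1) (fun t => cos t - c)); first exact: smooth_flat.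
by apply: smoothD; [exact: smooth_cos | exact: smooth_cst].
Qed.

Lemma smooth_bump c N s : smooth_on_circle (arc_bump c N s).
Proof.
have sp := @smooth_profile c.
have shift f : smooth f -> smooth (fun t => f (t - s)).
  move=> sf; have := @smooth_affine R f 1 (- s) sf.
  by congr smooth; apply/funext => t; rewrite mul1r.
split.
  have := shift _ (smoothM sp (@smooth_cos_int R N)).
  congr smooth; apply/funext => t; rewrite bump_expi /=; ring.
have := shift _ (smoothM sp (@smooth_sin_int R N)).
congr smooth; apply/funext => t; rewrite bump_expi /=; ring.
Qed.

Lemma periodic_profile c : periodic2pi (bump_profile c).
Proof. by move=> t; rewrite /bump_profile cos_periodic. Qed.

(** Rotation acts on the coefficients by phases only; varying [s] therefore turns a pairing with
    test functions into the values of a trigonometric series on an arc. *)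
Lemma fourier_bump c N s n :
  fourier (arc_bump c N s) n = cis (- (n%:~R * s)) * bump_coef c N n.
Proof.
have sp := @smooth_profile c; have pp := @periodic_profile c.
pose C t := bump_profile c t * cos ((N - n)%:~R * t).
pose S t := bump_profile c t * sin ((N - n)%:~R * t).
have sC : smooth C := smoothM sp (@smooth_cos_int R (N - n)).
have sS : smooth S := smoothM sp (@smooth_sin_int R (N - n)).
have pC : periodic2pi C by move=> t; rewrite /C pp cos_int_periodic.
have pS : periodic2pi S by move=> t; rewrite /S pp sin_int_periodic.
have shift f : smooth f -> smooth (fun t => f (t - s)).
  move=> sf; have := @smooth_affine R f 1 (- s) sf.
  by congr smooth; apply/funext => t; rewrite mul1r.
have cC := shift _ sC; have cS := shift _ sS.
pose a := cos (n%:~R * s); pose b := - sin (n%:~R * s).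
have E t : arc_bump c N s (expi t) * circle_val (expi (- (n%:~R * t))) =
    (a * C (t - s) + (- b) * S (t - s)) +i* (b * C (t - s) + a * S (t - s)).
  rewrite bump_expi circle_valE -mulrA -cisD.
  have -> : N%:~R * (t - s) + - (n%:~R * t) = (N - n)%:~R * (t - s) + - (n%:~R * s) :> R.
    by rewrite intrB; ring.
  rewrite cisD [cis (- _)]/cis cosN sinN -/a -/b /cis /C /S.
  by simpc => /=; congr (_ +i* _); ring.
have cZ (k : R) f : smooth f -> continuous (fun t => k * f t).
  by move=> sf; exact: (continuous_mul_smooth (@smooth_cst R k) sf).
have lin (k l : R) : pint (fun t => k * C (t - s) + l * S (t - s)) = k * pint C + l * pint S.
  rewrite pintD; [| exact: (cZ k (fun t => C (t - s))) | exact: (cZ l (fun t => S (t - s)))].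
  rewrite (pintZ k (smooth_continuous cC)) (pintZ l (smooth_continuous cS)).
  by rewrite (pint_shift _ (smooth_continuous sC)) // (pint_shift _ (smooth_continuous sS)).
have -> : fourier (arc_bump c N s) n = ((2 * pi)^-1)%:C *
    ((a * pint C + (- b) * pint S) +i* (b * pint C + a * pint S)).
  rewrite -!lin /fourier; congr (_ * (_ +i* _)); apply: eq_pint => t; by rewrite E.
rewrite /bump_coef mulrCA; congr (_ * _).
rewrite /cis cosN sinN -/a -/b /cos_coef /sin_coef -/(pint C) -/(pint S).
by simpc => /=; congr (_ +i* _); ring.
Qed.

(** At [n = N] the character is cancelled, and the real part is a positive multiple of the integral
    of a nonnegative profile that is positive at angle 0. *)
Lemma bump_coef_neq0 c N : c < 1 -> bump_coef c N N != 0.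
Proof.
move=> c1; have p0 := pi_gt0 R.
have pos : 0 < cos_coef (bump_profile c) (N - N).
  rewrite subrr; apply: (@pint_gt0 _ _ 0).
  - by apply: continuous_mul_smooth; [exact: smooth_profile | exact: smooth_cos_int].
  - move=> t; rewrite mul0r cos0 mulr1 /bump_profile /flat; case: ifP => // _.
    by rewrite hornerC mul1r expR_ge0.
  - by rewrite oppr_lt0 p0.
  - by rewrite !mul0r cos0 mulr1 /bump_profile /flat cos0 subr_gt0 c1 hornerC mul1r expR_gt0.
rewrite /bump_coef mulf_neq0 //.
  by rewrite fmorph_eq0 invr_eq0 lt0r_neq0 // mulr_gt0.
by apply: contraTneq pos => -[-> _]; rewrite ltxx.
Qed.

Lemma circle_val_continuous : continuous (@circle_val R : S1 -> R[i]^o).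
Proof. exact: initial_continuous. Qed.

Lemma rotated_dist s z :
  `|circle_val z - cis s| ^+ 2 = (2 - 2 * complex.Re (rotated s z))%:C.
Proof.
have -> : circle_val z - cis s = (rotated s z - 1) * cis s.
  by rewrite mulrBl mul1r /rotated -mulrA -cisD addNr cis0 mulr1.
rewrite normrM norm_cis mulr1.
have nw : `|rotated s z| = 1 by rewrite /rotated normrM norm_cis circle_norm mulr1.
have n2 : `|rotated s z| ^+ 2 = 1 by rewrite nw expr1n.
rewrite -add_Re2_Im2 in n2; rewrite -add_Re2_Im2.
have [e] : (complex.Re (rotated s z) ^+ 2 + complex.Im (rotated s z) ^+ 2)%:C = (1 : R)%:C by [].
congr (_ %:C); move: e; case: (rotated s z) => a b /=.
by rewrite subr0 !expr2 => e; lra.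
Qed.

Lemma sqr_lt (a b : R) : 0 <= b -> a ^+ 2 < b ^+ 2 -> a < b.
Proof. by rewrite !expr2 => b0 h; nra. Qed.

Lemma Re_norm_sqr (w : R[i]) : complex.Re `|w| ^+ 2 = complex.Re (`|w| ^+ 2).
Proof. by rewrite -Re_normX normrX. Qed.

Lemma Re_norm_cis t : complex.Re `|cis t| = 1.
Proof. by rewrite norm_cis. Qed.

Lemma test_bump (J : set S1) : open J -> J !=set0 ->
  exists t0 d c, [/\ 0 < d, c < 1
    & forall N s, `|s| < d -> test_function J (arc_bump c N (t0 + s))].
Proof.
move=> oJ [z0 Jz0].
have [t0 zt0] : exists t0, circle_val z0 = cis t0.
  have := circle_norm z0; case: (circle_val z0) => a b; rewrite normc_def /= => -[e].
  have ab : a ^+ 2 + b ^+ 2 = 1.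
    by rewrite -[LHS]sqr_sqrtr ?addr_ge0 ?sqr_ge0 // e expr1n.
  have a1 : -1 <= a <= 1.
    by rewrite -ler_norml -(ler_pXn2r (n := 2)) ?nnegrE // real_normK ?num_real // expr1n -ab lerDl sqr_ge0.
  have sa : sin (acos a) ^+ 2 = b ^+ 2.
    have := cos2Dsin2 (acos a); rewrite acosK ?in_itv //= -ab => h.
    by move/addrI: h.
  have [h|h] : sin (acos a) = b \/ sin (acos a) = - b.
    by move/eqP: sa; rewrite eqf_sqr => /orP[] /eqP; [left | right].
  - by exists (acos a); rewrite /cis acosK ?in_itv // h.
  - by exists (- acos a); rewrite /cis cosN sinN acosK ?in_itv // h opprK.
have [e e0 he] : exists2 e : R, 0 < e & forall z, complex.Re `|circle_val z - cis t0| < e -> J z.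
  case: oJ => O oO JO; have Oz : O (circle_val z0) by move: Jz0; rewrite -JO.
  have [[e e'] /= ] := (nbhs_ballP _ _).1 (oO _ Oz).
  rewrite ltcE /= => /andP[/eqP -> e0] eO; exists e => // z hz.
  rewrite -JO; apply: eO; rewrite -ball_normE /= complexr0.
  by rewrite -[`|_|]RRe_real ?normr_real // ltcR distrC zt0.
have [d d0 hd] : exists2 d : R, 0 < d & forall s, `|s| < d -> complex.Re `|cis s - 1| < e / 2.
  have c0 : {for 0, continuous (@cos R)} by exact: continuous_cos.
  have e2 : 0 < 1 - e ^+ 2 / 16 \/ 1 - e ^+ 2 / 16 <= 0 by case: ltP => ?; [left|right].
  have e16 : 0 < e ^+ 2 / 16 by rewrite divr_gt0 // exprn_gt0.
  have /cvgrPdist_lt/(_ _ e16) := c0; rewrite cos0 => /nbhs_ballP[d d0 hd].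
  exists d => // s sd.
  have h : `|1 - cos s| < e ^+ 2 / 16.
    by apply: hd; rewrite /ball /= sub0r normrN.
  have := rotated_dist 0 (expi s); rewrite /rotated circle_valE oppr0 cis0 mulr1 => r.
  apply: sqr_lt; first by rewrite divr_ge0 // ltW.
  rewrite Re_norm_sqr r /=.
  have := ler_norm (1 - cos s); have := exprn_gt0 2 e0.
  by rewrite expr_div_n; lra.
(* The squared distance to the centre is [2 - 2 * complex.Re (rotated s z)], at most [e ^+ 2 / 8] on
   the support, so the bump stays within [e / 2] of its centre; the centre itself moves by less than
   [e / 2]. *)
exists t0, d, (1 - e ^+ 2 / 16); split=> //.
  by rewrite ltrBlDr ltrDl divr_gt0 // exprn_gt0.
move=> N s sd; split; first exact: smooth_bump.
set c := 1 - _; set s' := t0 + s.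
have cl : closed [set z : S1 | c <= complex.Re (rotated s' z)].
  have -> : [set z : S1 | c <= complex.Re (rotated s' z)] =
      (@circle_val R : S1 -> R[i]^o) @^-1` [set w : R[i]^o | c <= complex.Re (w * cis (- s'))] by [].
  apply: (closed_comp (f := (@circle_val R : S1 -> R[i]^o))).
    by move=> z _; exact: circle_val_continuous.
  move=> w /closure_rnormP h; rewrite /= leNgt; apply/negP => lt.
  have k0 : 0 < c - complex.Re (w * cis (- s')) by rewrite subr_gt0.
  have [v /= hv vw] := h _ k0.
  have : complex.Re ((v - w) * cis (- s')) <= complex.Re `|v - w|.
    apply: le_trans (_ : complex.Re `|(v - w) * cis (- s')| <= _).
      rewrite -lecR [X in _ <= X]RRe_real ?normr_real //.
      apply: le_trans (normc_ge_Re _); rewrite lecR; exact: ler_norm.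
    by rewrite normrM norm_cis mulr1.
  move=> /le_lt_trans/(_ vw); rewrite mulrBl raddfB ltrD2r => h3.
  by move: hv; rewrite leNgt h3.
move=> z hz; have {hz} : c <= complex.Re (rotated s' z).
  apply: (cl z); move: hz; apply: closure_subset => y /=.
  apply: contra_neqP => /negP; rewrite -ltNge => lt.
  by rewrite /arc_bump /flat subr_gt0 ltNge (ltW lt) mul0r.
move=> hz; apply: he.
have b1 : complex.Re `|circle_val z - cis s'| < e / 2.
  apply: sqr_lt; first by rewrite divr_ge0 // ltW.
  rewrite Re_norm_sqr rotated_dist /=.
  by move: hz; rewrite /c expr_div_n; have := exprn_gt0 2 e0; lra.
have b2 : complex.Re `|cis s' - cis t0| < e / 2.
  rewrite /s' cisD -[X in _ - X]mulr1 -mulrBr normrM norm_cis mul1r; exact: hd.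
have := @rnorm_triangle R R[i]^o (cis s') (circle_val z) (cis t0).
by rewrite !rnorm_le_norm; lra.
Qed.

(** Induction on the sharper bound [2 - N.+1%:R^-1] for [N.+1] terms, which telescopes. *)
Lemma series_inv_sq (N : nat) : series (fun n : nat => n.+1%:R ^- 2 : R) N <= 2.
Proof.
case: N => [|N]; first by rewrite seriesEnat /= big_geq.
apply: (@le_trans _ _ (2 - N.+1%:R^-1)); last by rewrite gerBl invr_ge0.
elim: N => [|N IH]; first by rewrite seriesEnat /= big_nat1 expr1n invr1; lra.
rewrite seriesEnat /= big_nat_recr //=; rewrite seriesEnat /= in IH.
apply: le_trans (lerD IH (lexx _)) _.
rewrite -addrA lerD2l lerNr opprD opprK.
have a0 : (0 : R) < N.+1%:R by rewrite ltr0n.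
have b0 : (0 : R) < N.+2%:R by rewrite ltr0n.
have e : N.+2%:R = N.+1%:R + 1 :> R by rewrite natr1.
have -> : N.+1%:R^-1 - N.+2%:R ^- 2 =
  N.+2%:R^-1 + N.+1%:R^-1 * N.+2%:R^-1 * N.+2%:R^-1 :> R.
  by rewrite e in b0 *; field; rewrite !lt0r_neq0.
by rewrite lerDl !mulr_ge0 // invr_ge0 ltW.
Qed.

(* If the one-sided family [u] pairs to zero with the Fourier coefficients of
   every test function on [J], then testing against rotates of a single bump
   gives a power series vanishing on an arc. *)
Lemma test_extract (J : set S1) (u : nat -> R[i]) (K : R) (p : nat) (e : int) :
  open J -> J !=set0 -> (forall k, complex.Re `|u k| <= K * k.+1%:R ^+ p) ->
  (forall g, test_function J g ->
     series (fun k => fourier g (e - k%:Z) * u k : R[i]^o) @ \oo --> (0 : R[i]^o)) ->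
  forall k, u k = 0.
Proof.
move=> oJ J0 ub hg k0; have [t0 [d [c [d0 c1 hb]]]] := test_bump oJ J0.
(* With this frequency the factor of [u k0] is, up to a phase, [bump_coef c N N], which is
   nonzero. *)
pose N := e - k0%:Z.
pose a k := bump_coef c N (e - k%:Z) * u k * cis (k%:R * t0).
(* Two orders beyond the growth of [u] leave the majorant [k.+1%:R ^- 2]; the constant [L] below
   accounts for the shift of the index by [e]. *)
have [D D0 hD] := fourier_decay (p + 2) (@smooth_bump c N 0).
have coefD n : complex.Re `|bump_coef c N n| * (absz n).+1%:R ^+ (p + 2) <= D.
  by have := hD n; rewrite fourier_bump mulr0 oppr0 cis0 mul1r.
pose L : R := (absz e).+1%:R ^+ (p + 2).
have L0 : 0 <= L by rewrite exprn_ge0.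
have K0 : 0 <= K by have := ub 0%N; rewrite expr1n mulr1; apply: le_trans; exact: Re_norm_ge0.
have az : forall k, a k = 0.
  apply: (@arc_zero R a (fun k => (D * L * K) * k.+1%:R ^- 2) ((D * L * K) * 2) d) => //.
  - move=> k; rewrite /a Re_normM Re_norm_cis mulr1 Re_normM.
    set x := complex.Re _; have x0 : 0 <= x by exact: Re_norm_ge0.
    have k1 : (0 : R) < k.+1%:R ^+ 2 by rewrite exprn_gt0 // ltr0n.
    rewrite ler_pdivlMr //.
    apply: le_trans (_ : x * (K * k.+1%:R ^+ p) * k.+1%:R ^+ 2 <= _).
      by rewrite ler_wpM2r ?(ltW k1) // ler_wpM2l.
    rewrite -!mulrA -exprD mulrCA [X in _ <= X](_ : _ = K * (D * L)); last by ring.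
    rewrite ler_wpM2l //.
    apply: le_trans (_ : x * (L * (absz (e - k%:Z)).+1%:R ^+ (p + 2)) <= _).
      rewrite ler_wpM2l // /L -exprMn lerXn2r ?nnegrE ?mulr_ge0 //.
      by rewrite -natrM ler_nat; lia.
    by rewrite mulrCA mulrC; apply: ler_wpM2r => //; exact: coefD.
  - move=> n; rewrite seriesEnat /= -mulr_sumr ler_wpM2l ?mulr_ge0 //.
    by have := series_inv_sq n; rewrite seriesEnat.
  - move=> s sd; have hs := hg _ (hb N s sd).
    have E k : fourier (arc_bump c N (t0 + s)) (e - k%:Z) * u k =
        cis (- (e%:~R * (t0 + s))) * (a k * cis (k%:R * s)).
      rewrite fourier_bump /a intrB.
      have -> : - ((e%:~R - k%:Z%:~R) * (t0 + s)) =
          - (e%:~R * (t0 + s)) + (k%:R * t0 + k%:R * s) :> R.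
        by rewrite -pmulrn; ring.
      by rewrite !cisD; ring.
    apply/cvgn_rnormP => r r0; have [M hM] := (cvgn_rnormP _ _).1 hs _ r0.
    exists M => n Mn; have := hM _ Mn; rewrite !subr0.
    have -> : series (fun k => fourier (arc_bump c N (t0 + s)) (e - k%:Z) * u k : R[i]^o) n =
        cis (- (e%:~R * (t0 + s))) *: series (fun k => a k * cis (k%:R * s) : R[i]^o) n.
      rewrite !seriesEnat /= scaler_sumr; apply: eq_bigr => k _; exact: E.
    by rewrite rnormZ norm_cis mul1r.
have := az k0; rewrite /a => /eqP.
rewrite mulf_eq0 (negPf (cis_neq0 _)) orbF mulf_eq0 -/N.
by rewrite (negPf (bump_coef_neq0 N c1)) /= => /eqP.
Qed.

End Bump.

(** * Vertex operator algebras *)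

Section LinearMaps.
Variables (K : pzRingType) (U W : lmodType K) (f : U -> W).
Hypothesis lf : linear f.

Lemma linear_D x y : f (x + y) = f x + f y.
Proof. by rewrite -{1}(scale1r x) lf scale1r. Qed.
Lemma linear_0 : f 0 = 0.
Proof. by apply: (addrI (f 0)); rewrite -linear_D !addr0. Qed.
Lemma linear_Z c x : f (c *: x) = c *: f x.
Proof. by rewrite -[c *: x]addr0 lf linear_0 addr0. Qed.
Lemma linear_N x : f (- x) = - f x.
Proof. by rewrite -scaleN1r linear_Z scaleN1r. Qed.
Lemma linear_B x y : f (x - y) = f x - f y.
Proof. by rewrite linear_D linear_N. Qed.
Lemma linear_S (I : Type) (s : seq I) (P : pred I) (F : I -> U) :
  f (\sum_(i <- s | P i) F i) = \sum_(i <- s | P i) f (F i).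
Proof. exact: (big_morph f linear_D linear_0). Qed.
End LinearMaps.

Section FiniteProjection.
Variables (R : realType) (V : lmodType R[i]) (q : V -> V -> R[i]).
Hypothesis hq : scalar_product q.

(** [V] is not assumed complete, so the projection is built by induction on the number of spanning
    vectors, which need not lie in [W]. Either all of [W] is in the span of the first [k], or [W] is
    that part plus the line of [w0] minus its projection. *)
Lemma finite_projection (e : nat -> V) (k : nat) (W : set V) :
  linear_set W ->
  (forall w, W w -> exists c : nat -> R[i], w = \sum_(i < k) c i *: e i) ->
  forall v, exists2 w, W w & forall u, W u -> q u (v - w) = 0.
Proof.
elim: k W => [|k IH] W lW hW v.
  exists 0; first exact: lW.1.
  by move=> u /hW [c ->]; rewrite big_ord0 sp0l.
pose W' := [set w | W w /\ exists c : nat -> R[i], w = \sum_(i < k) c i *: e i].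
have lW' : linear_set W'.
  split; first by split; [exact: lW.1 | exists (fun=> 0); rewrite big1 // => i _; rewrite scale0r].
  move=> c x y [Wx [a ea]] [Wy [b eb]]; split; first by apply: lW.2.
  exists (fun i => c * a i + b i); rewrite ea eb scaler_sumr -big_split /=.
  by apply: eq_bigr => i _; rewrite scalerA scalerDl.
have P' u : exists2 w, W' w & forall z, W' z -> q z (u - w) = 0.
  by apply: IH => // w [].
have [sub|/existsNP [w0 /not_implyP [Ww0 nW0]]] := pselect (forall w, W w -> W' w).
  by have [w W'w ow] := P' v; exists w; [case: W'w | move=> u /sub; exact: ow].
have [c0 e0] := hW _ Ww0.
have c0k : c0 k != 0.
  apply: contra_notN nW0 => /eqP z; split=> //; exists c0.
  by rewrite e0 big_ord_recr /= z scale0r addr0.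
have [p0 W'p0 op0] := P' w0; pose w1 := w0 - p0.
have Ww1 : W w1 by apply: linear_setB => //; case: W'p0.
have dec u : W u -> exists c, W' (u - c *: w1).
  move=> Wu; have [d ed] := hW _ Wu; exists (d k / c0 k).
  have -> : u - (d k / c0 k) *: w1 = (u - (d k / c0 k) *: w0) + (d k / c0 k) *: p0.
    by rewrite /w1 scalerBr opprB addrA addrAC.
  apply: linear_setD => //; last exact: linear_setZ.
  split; first by apply: linear_setB => //; exact: linear_setZ.
  exists (fun i => d i - d k / c0 k * c0 i).
  rewrite ed e0 !big_ord_recr /= scalerDr opprD addrACA scalerA divfK // subrr addr0.
  rewrite scaler_sumr -sumrB; apply: eq_bigr => i _.
  by rewrite scalerBl scalerA.
have [w W'w ow] := P' v.
have w1n : w1 != 0.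
  by apply: contra_notN nW0 => /eqP/subr0_eq ->.
have w11 : q w1 w1 != 0 by apply: contra_neq w1n; exact: sp_eq0.
pose r := q w1 (v - w) / q w1 w1.
exists (w + r *: w1).
  by rewrite addrC; apply: lW.2 => //; case: W'w.
move=> u /dec [c W'z]; set z := u - _ in W'z.
have -> : u = c *: w1 + z by rewrite addrC subrK.
have o1 : q z w1 = 0 by exact: op0.
have -> : v - (w + r *: w1) = (v - w) - r *: w1 by rewrite opprD addrA.
rewrite (spDl hq) !(spBr hq _ (v - w)) !(spZr hq) !(spZl hq) o1 (ow _ W'z).
by rewrite /r mulrCA divfK // mulr0 !subrr addr0.
Qed.

End FiniteProjection.

(** * Consequences of locality and translation covariance *)

Section VertexAlgebra.
Variables (R : realType) (V : lmodType R[i]) (X : voa_data V).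
Local Notation om := (vacuum X).
Local Notation nu := (conformal_vector X).
Local Notation L := (virL X).
Implicit Types (a b c v : V) (m n d : int).

Hypothesis hva : vertex_algebra X.

Lemma vop_lin a n : linear (vop X a n).
Proof. by case: hva. Qed.
Lemma vop_linl n b : linear (fun a => vop X a n b).
Proof. by case: hva => _ []. Qed.
Lemma vop_vanish a b : exists K : int, forall n, K <= n -> vop X a n b = 0.
Proof. by case: hva => _ [_ []]. Qed.
Lemma vop_creation a : vop X a (-1) om = a.
Proof. by case: hva => _ [_ [_ [_ []]]]. Qed.
Lemma vop_annihilation a n : 0 <= n -> vop X a n om = 0.
Proof. by case: hva => _ [_ [_ [_ [_ [h _]]]]]; exact: h. Qed.
Lemma virL_lin n : linear (L n).
Proof. exact: vop_lin. Qed.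
Lemma translation_vacuum : L (-1) om = 0.
Proof. by case: hva => _ [_ [_ [_ [_ [_ []]]]]]. Qed.
Lemma translation_vop a n b :
  L (-1) (vop X a n b) = vop X a n (L (-1) b) + (- n)%:~R *: vop X a (n - 1) b.
Proof.
case: hva => _ [_ [_ [_ [_ [_ [_ [h _]]]]]]].
by rewrite -h addrC subrK.
Qed.

(** The coefficients of [(z - w)^K] times the formal series with coefficients [F]. *)
Definition local_sum (F : int -> int -> V) (K : nat) m n : V :=
  \sum_(j < K.+1) ((-1) ^+ j * ('C(K, j))%:R : R[i]) *: F (m + (K - j)%N%:Z) (n + j%:Z).

(** Pascal's rule, that is, one more factor [z - w]. It lets the order of locality be raised, so
    that two algebras can later share one [K]. *)
Lemma local_sumS F K m n :
  local_sum F K.+1 m n = local_sum F K (m + 1) n - local_sum F K m (n + 1).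
Proof.
rewrite /local_sum big_ord_recl /= bin0 expr0 mul1r scale1r subn0 addr0.
have E (i : 'I_K.+1) : ((-1) ^+ lift ord0 i * ('C(K.+1, lift ord0 i))%:R : R[i]) *:
     F (m + (K.+1 - lift ord0 i)%N%:Z) (n + (lift ord0 i)%:Z) =
   ((-1) ^+ i.+1 * ('C(K, i.+1))%:R : R[i]) *: F (m + (K - i)%N%:Z) (n + (i.+1)%:Z)
   - ((-1) ^+ i * ('C(K, i))%:R : R[i]) *: F (m + (K - i)%N%:Z) (n + 1 + i%:Z).
  have e : n + 1 + i%:Z = n + (i.+1)%:Z by rewrite -addrA -intS.
  rewrite !lift0 subSS binS natrD mulrDr scalerDl e.
  by rewrite -scaleNr !exprS !mulN1r !mulNr.
rewrite (eq_bigr _ (fun i _ => E i)) sumrB addrA; congr (_ - _).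
rewrite [in RHS]big_ord_recl /= bin0 expr0 mul1r scale1r subn0 addr0.
congr (_ + _); first by congr F; rewrite -addn1 PoszD; ring.
rewrite big_ord_recr /= bin_small // mulr0 scale0r addr0.
apply: eq_bigr => i _; rewrite /bump /= ?add1n; congr (_ *: F _ _).
by have := ltn_ord i; lia.
Qed.

Lemma local_sum_mono F K0 K : (K0 <= K)%N -> (forall m n, local_sum F K0 m n = 0) ->
  forall m n, local_sum F K m n = 0.
Proof.
move=> KK h; elim: K KK => [|K IH]; first by rewrite leqn0 => /eqP <-.
rewrite leq_eqVlt => /orP[/eqP <- //|KK] m n.
by rewrite local_sumS !IH ?subrr.
Qed.

Lemma locality a b : exists K0 : nat, forall K, (K0 <= K)%N -> forall c m n,
  local_sum (fun m n => vop X a m (vop X b n c) - vop X b n (vop X a m c)) K m n = 0.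
Proof.
case: hva => _ [_ [_ [_ [_ [_ [_ [_ h]]]]]]]; have [K0 hK] := h a b.
by exists K0 => K KK c; apply: (local_sum_mono KK) => m n; exact: hK.
Qed.

(* Locality applied to the vacuum expresses the modes of [a] on [b] through the
   modes of [b] on descendants of [a]. *)
Lemma vop_swap a b : exists K0 : nat, forall K, (K0 <= K)%N -> forall m,
  vop X a (m + K%:Z) b = \sum_(j < K.+1) ((-1) ^+ j * ('C(K, j))%:R : R[i]) *:
    vop X b (j%:Z - 1) (vop X a (m + (K - j)%N%:Z) om).
Proof.
have [K0 h] := locality a b; exists K0 => K KK m.
(* On the vacuum with [n = -1], the modes of [b] of index [-1 + j] vanish for [j > 0] and give [b]
   for [j = 0], so one of the two sums has a single term. *)
have := h K KK om m (-1); rewrite /local_sum.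
rewrite (eq_bigr (fun j : 'I_K.+1 =>
  ((-1) ^+ j * ('C(K, j))%:R : R[i]) *:
     vop X a (m + (K - j)%N%:Z) (vop X b (-1 + j%:Z) om) -
  ((-1) ^+ j * ('C(K, j))%:R : R[i]) *:
     vop X b (j%:Z - 1) (vop X a (m + (K - j)%N%:Z) om))); last first.
  by move=> j _; rewrite scalerBr [-1 + _]addrC.
rewrite sumrB => /eqP; rewrite subr_eq0 => /eqP <-.
rewrite big_ord_recl /= expr0 bin0 mul1r scale1r subn0 addr0 vop_creation.
rewrite big1 ?addr0 // => i _.
rewrite vop_annihilation; last by rewrite /bump /=; lia.
by rewrite (linear_0 (vop_lin _ _)) scaler0.
Qed.

(** The coefficient form of [Y(a,z) Omega = e^(z L_(-1)) a]. *)
Lemma vop_translation_vacuum a (k : nat) :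
  vop X a (- k%:Z - 1) om = (k`!)%:R^-1 *: iter k (L (-1)) a.
Proof.
elim: k => [|k IH]; first by rewrite fact0 invr1 scale1r oppr0 add0r vop_creation.
have := translation_vop a (- k%:Z - 1) om.
rewrite translation_vacuum (linear_0 (vop_lin _ _)) add0r IH.
rewrite (linear_Z (virL_lin _)).
have -> : - (- k%:Z - 1) = (k.+1)%:Z by rewrite intS; ring.
have -> : - k%:Z - 1 - 1 = - (k.+1)%:Z - 1 by rewrite intS; ring.
rewrite -pmulrn => e.
have kn : (k.+1%:R : R[i]) != 0 by rewrite pnatr_eq0.
have /(congr1 (fun z => k.+1%:R^-1 *: z)) := e; rewrite !scalerA mulVf // scale1r => <-.
by rewrite iterS factS natrM invfM.
Qed.

End VertexAlgebra.

(** * Weights, adjoints and quasi-primary vectors in a unitary VOA *)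

Section UnitaryVOA.
Variables (R : realType) (V : lmodType R[i]) (X : voa_data V) (form : V -> V -> R[i]).
Local Notation om := (vacuum X).
Local Notation nu := (conformal_vector X).
Local Notation L := (virL X).
Local Notation T := (virL X (-1)).
Implicit Types (a b c v u : V) (m n d : int).

Hypothesis hV : unitary_voa X form.

Let hq : scalar_product form. Proof. by case: hV. Qed.
Let hvoa : voa X. Proof. by case: hV. Qed.
Let hva : vertex_algebra X. Proof. by case: hvoa. Qed.

Lemma form_vacuum : form om om = 1. Proof. by case: hV. Qed.

Lemma virasoro : exists c : R[i], forall m n b,
  L m (L n b) = L n (L m b) + ((m - n)%:~R *: L (m + n) b +
     (if m + n == 0 then (c / 12 * (m ^+ 3 - m)%:~R) *: b else 0)).
Proof.
case: hvoa => _ [[c h] _]; exists c => m n b; by rewrite -h addrC subrK.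
Qed.

Lemma virasoro0 n b : L 0 (L n b) = L n (L 0 b) - n%:~R *: L n b.
Proof.
have [c h] := virasoro; rewrite h sub0r add0r expr0n subrr /= mulr0 scale0r.
by rewrite if_same addr0 rmorphN scaleNr.
Qed.

Lemma virasoro1 b : L 1 (L (-1) b) = L (-1) (L 1 b) + 2 *: L 0 b.
Proof.
have [c h] := virasoro; rewrite h (_ : 1 + -1 == 0 :> int) //.
rewrite (_ : 1 ^+ 3 - 1 = 0 :> int) // mulr0 scale0r addr0.
by rewrite (_ : 1 - -1 = 2 :> int).
Qed.

Lemma weight_virL d n v : weight_vector X d v -> weight_vector X (d - n) (L n v).
Proof.
rewrite /weight_vector => h; rewrite virasoro0 h (linear_Z (virL_lin hva _)).
by rewrite intrB scalerBl.
Qed.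

Lemma weight_lin d (k : R[i]) u v : weight_vector X d u -> weight_vector X d v ->
  weight_vector X d (k *: u + v).
Proof.
rewrite /weight_vector => hu hv; rewrite (virL_lin hva) hu hv scalerDr !scalerA.
by rewrite mulrC.
Qed.

Lemma weight0 d : weight_vector X d 0.
Proof. by rewrite /weight_vector (linear_0 (virL_lin hva _)) scaler0. Qed.

Lemma weight_B d u v : weight_vector X d u -> weight_vector X d v ->
  weight_vector X d (u - v).
Proof. by move=> hu hv; rewrite addrC -scaleN1r; exact: weight_lin. Qed.

Lemma weight_iterT d k v : weight_vector X d v ->
  weight_vector X (d + k%:Z) (iter k T v).
Proof.
move=> h; elim: k => [|k IH]; first by rewrite addr0.
have -> : d + (k.+1)%:Z = d + k%:Z - (-1) by rewrite intS; ring.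
exact: weight_virL.
Qed.

Lemma virL_vacuum n : -1 <= n -> L n om = 0.
Proof. by move=> h; rewrite /virL vop_annihilation //; lia. Qed.

Lemma weight_vacuum : weight_vector X 0 om.
Proof. by rewrite /weight_vector virL_vacuum // scale0r. Qed.

Lemma conformal_vectorE : nu = L (-2) om.
Proof. by rewrite /virL (vop_creation hva). Qed.

Lemma weight_conformal : weight_vector X 2 nu.
Proof.
rewrite conformal_vectorE; have := weight_virL (-2) weight_vacuum.
by rewrite sub0r opprK.
Qed.

Lemma virL1_conformal : L 1 nu = 0.
Proof.
rewrite conformal_vectorE; have [c h] := virasoro; rewrite h /=.
rewrite (virL_vacuum (n := 1)) // (linear_0 (virL_lin hva _)).
by rewrite [1 + -2](_ : _ = -1) // virL_vacuum // scaler0 !addr0.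
Qed.

Lemma quasi_primary_conformal : quasi_primary X nu.
Proof. by exists 2; [exact: weight_conformal | exact: virL1_conformal]. Qed.

(** The vector is [theta a]: the antilinear automorphism converts the invariant bilinear form into
    the scalar product. As [L 1 a = 0], the invariance formula applies with [K = 1] and has a single
    term. *)
Lemma adjoint_vector d a : weight_vector X d a -> L 1 a = 0 ->
  exists a', [/\ weight_vector X d a', L 1 a' = 0
    & forall n b c, form (vop X a' n b) c =
        (-1) ^ d * form b (vop X a (2 * d - n - 2) c)].
Proof.
move=> wa qa; case: hV => _ _ _ [theta [[th1 [tinv ti1 ti2] th3 th4] thn inv]].
have thD u v : theta (u + v) = theta u + theta v.
  by rewrite -{1}(scale1r u) th1 conjC1 scale1r.
have th0 : theta 0 = 0 by apply: (addrI (theta 0)); rewrite -thD !addr0.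
have thZ (k : R[i]) u : theta (k *: u) = k^* *: theta u.
  by rewrite -[k *: u]addr0 th1 th0 addr0.
have thL n u : theta (L n u) = L n (theta u) by rewrite /virL th4 thn.
exists (theta a); split.
- rewrite /weight_vector -thL wa thZ; congr (_ *: _).
  by rewrite rmorph_int.
- by rewrite -thL qa th0.
- move=> n b c; have := inv d 1%N a wa qa n (tinv b) c.
  rewrite th4 ti2 => ->; congr (_ * _).
  by rewrite big_ord1 /= fact0 invr1 mul1r subr0.
Qed.

(** Invariance for the conformal vector: its weight 2 makes the sign disappear, and [theta] fixes
    it. *)
Lemma virL_adjoint n b c : form (L n b) c = form b (L (- n) c).
Proof.
case: hV => _ _ _ [theta [[th1 [tinv ti1 ti2] th3 th4] thn inv]].
have := inv 2 1%N nu weight_conformal virL1_conformal (n + 1) (tinv b) c.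
rewrite th4 thn ti2 /virL => ->.
rewrite big_ord1 /= fact0 invr1 mul1r subr0 -exprnP sqrrN expr1n mul1r.
by congr (form _ (vop _ _ _ _)); ring.
Qed.

Lemma weight_orthogonal d e u v : weight_vector X d u -> weight_vector X e v ->
  d != e -> form u v = 0.
Proof.
move=> wu wv de; have := virL_adjoint 0 u v; rewrite oppr0 wu wv.
rewrite (spZl hq) (spZr hq) => /eqP; rewrite -subr_eq0 -mulrBl mulf_eq0 => /orP[|/eqP //].
have -> : (d%:~R^*)%C = d%:~R :> R[i].
  by rewrite rmorph_int.
by rewrite -intrB intr_eq0 subr_eq0 (negPf de).
Qed.

Lemma sqform_translation d a : weight_vector X d a -> L 1 a = 0 ->
  form (T a) (T a) = (2 * d%:~R) * form a a.
Proof.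
move=> wa qa; rewrite virL_adjoint opprK virasoro1 qa (linear_0 (virL_lin hva _)) add0r.
by rewrite wa scalerA (spZr hq).
Qed.

(** Induction on the distance to the lower bound [D] of the weights. A vector of negative weight [d]
    killed by [L 1] has [|T a|^2 = 2 d |a|^2] with sides of opposite signs, so it is zero. *)
Lemma weight_ge0 d a : weight_vector X d a -> a != 0 -> 0 <= d.
Proof.
case: hvoa => _ [_ [_ [_ [D hD]]]].
move=> wa a0; rewrite leNgt; apply/negP => d0; move/negP: a0; apply.
have H : forall (k : nat) d a, d < D + k%:Z -> d < 0 -> weight_vector X d a -> a == 0.
  elim=> [|k IH] {wa}d0' {}a dD dn wa; first by apply/eqP; apply: hD wa; lia.
  have qa : L 1 a = 0.
    by apply/eqP; apply: (IH (d0' - 1)); [lia | lia | exact: weight_virL].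
  have := sqform_translation wa qa.
  have h1 := sp_ge0 hq (T a); have h2 := sp_ge0 hq a => e.
  apply/eqP/(sp_eq0 hq)/eqP; rewrite eq_le h2 andbT.
  have dneg : (2 * d0'%:~R : R[i]) < 0 by rewrite pmulr_rlt0 // ltrz0.
  by rewrite -(nmulr_rge0 _ dneg) -e.
apply: (H (absz (d - D)).+1 d a) => //; lia.
Qed.

(** [mode] selects an arbitrary decomposition of [a] into weight vectors. Vectors of distinct
    weights are orthogonal, so in every decomposition the components of weight other than [d] are
    zero. *)
Lemma mode_homogeneous d a n b : weight_vector X d a ->
  mode X a n b = vop X a (n + d - 1) b.
Proof.
move=> wa; rewrite /mode; set S := [set c | _].
have Sin : S (vop X a (n + d - 1) b).
  exists [:: d], (fun e => if e == d then a else 0); split=> //.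
  - by move=> e; case: eqP => [->|_] //; exact: weight0.
  - by rewrite big_seq1 eqxx.
  - by rewrite big_seq1 eqxx.
have [s [w [us ww es ->]]] := xgetPex 0 (ex_intro _ _ Sin).
have vz k : vop X 0 k b = 0 by exact: (linear_0 (vop_linl hva _ _)).
have wz e : e \in s -> e != d -> w e = 0.
  move=> es' ed; apply: (sp_eq0 hq).
  have : form (w e) a = 0 by exact: weight_orthogonal (ww e) wa ed.
  rewrite es (sp_sumr hq) (bigD1_seq e) //= big1 ?addr0 // => i ie.
  by apply: weight_orthogonal (ww e) (ww i) _; rewrite eq_sym.
have [ds|ds] := boolP (d \in s).
  have -> : a = w d.
    rewrite es (bigD1_seq d) //= big1_seq ?addr0 // => i /andP[id is'].
    exact: wz.
  rewrite (bigD1_seq d) //= big1_seq ?addr0 // => i /andP[id is'].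
  by rewrite wz // vz.
have -> : a = 0.
  rewrite es big1_seq // => i /andP[_ is']; apply: wz => //.
  by apply: contraNneq ds => <-.
rewrite vz big1_seq // => i /andP[_ is']; rewrite wz ?vz //.
by apply: contraNneq ds => <-.
Qed.

Lemma mode_adjoint d a : weight_vector X d a -> L 1 a = 0 ->
  exists a', [/\ weight_vector X d a', L 1 a' = 0
    & forall n b c, form (mode X a' n b) c = (-1) ^ d * form b (mode X a (- n) c)].
Proof.
move=> wa qa; have [a' [wa' qa' h]] := adjoint_vector wa qa.
exists a'; split=> // n b c; rewrite (mode_homogeneous _ _ wa') (mode_homogeneous _ _ wa) h.
by congr (_ * form _ (vop _ _ _ _)); ring.
Qed.

Lemma weight_span d : exists (k : nat) (e : nat -> V), forall v, weight_vector X d v ->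
  exists c : nat -> R[i], v = \sum_(i < k) c i *: e i.
Proof.
case: hvoa => _ [_ [_ [h _]]]; have [k [e he]] := h d.
case: k e he => [|k] e he.
  by exists 0%N, (fun=> 0) => v /he [c ->]; exists (fun=> 0); rewrite !big_ord0.
exists k.+1, (fun i => e (inord i)) => v /he [c ->].
exists (fun i => c (inord i)); apply: eq_bigr => i _; by rewrite inord_val.
Qed.

Lemma decomposition v : exists (s : seq int) (w : int -> V),
  (forall d, weight_vector X d (w d)) /\ v = \sum_(d <- s) w d.
Proof. by case: hvoa => _ [_ [h _]]. Qed.

(* V_n = L_{-1} V_{n-1} + ker L_1: the orthogonal complement of L_{-1} V_{n-1}
   in V_n is the kernel of the adjoint L_1. *)
Lemma descendants_span (P : V -> Prop) : P 0 ->
  (forall (k : R[i]) u v, P u -> P v -> P (k *: u + v)) ->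
  (forall k d a, weight_vector X d a -> L 1 a = 0 -> P (iter k T a)) ->
  forall v, P v.
Proof.
move=> P0 Plin PT v.
have PD u w : P u -> P w -> P (u + w).
  by move=> pu pw; rewrite -(scale1r u); exact: Plin.
(* All iterates are treated at once: from [v = T u + r] with [r] quasi-primary, the iterate [k] of
   [v] needs the iterate [k.+1] of [u]. *)
have H : forall (n : nat) v, weight_vector X n%:Z v -> forall k, P (iter k T v).
  elim=> [|n IH] {}v wv k.
    apply: (PT k 0) => //; apply/eqP/negPn/negP => z.
    by have := weight_ge0 (weight_virL 1 wv) z; lia.
  pose W := [set T u | u in [set u | weight_vector X n%:Z u]].
  have lW : linear_set W.
    split; first by exists 0; [exact: weight0 | exact: (linear_0 (virL_lin hva _))].
    move=> c _ _ [x wx <-] [y wy <-]; exists (c *: x + y); first exact: weight_lin.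
    by rewrite (virL_lin hva).
  have [p [e he]] := weight_span n%:Z.
  have [|w [u wu <-] ow] := @finite_projection _ _ _ hq (fun i => T (e i)) p W lW _ v.
    move=> _ [u /he [c ->] <-]; exists c.
    rewrite (linear_S (virL_lin hva _)); apply: eq_bigr => i _.
    by rewrite (linear_Z (virL_lin hva _)).
  have wTu : weight_vector X (n.+1)%:Z (T u).
    have -> : (n.+1)%:Z = n%:Z - (-1) by rewrite intS; ring.
    exact: weight_virL.
  have wr := weight_B wv wTu.
  have -> : v = 1 *: T u + (v - T u) by rewrite scale1r addrC subrK.
  have it (k' : nat) x y : iter k' T (1 *: x + y) = 1 *: iter k' T x + iter k' T y.
    by elim: k' => // k' ih; rewrite !iterS ih (virL_lin hva).
  rewrite it; apply: Plin; first by rewrite -iterSr; exact: IH.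
  (* [L 1] kills the remainder [v - T u]: the squared norm of its image is the product of the
     remainder with [T (L 1 (v - T u))], an element of [W]. *)
  apply: (PT k (n.+1)%:Z) => //; apply: (sp_eq0 hq).
  rewrite virL_adjoint (spC hq) ow ?rmorph0 //.
  exists (L 1 (v - T u)) => //=.
  have -> : n%:Z = (n.+1)%:Z - 1 by rewrite intS; ring.
  exact: weight_virL.
have [s [w [ww ->]]] := decomposition v.
elim: s => [|d s IH]; first by rewrite big_nil.
rewrite big_cons; apply: PD => //.
have [->//|w0] := eqVneq (w d) 0.
have d0 := weight_ge0 (ww d) w0.
case: d d0 {w0} => // n _; exact: (H n (w n%:Z) (ww _) 0%N).
Qed.

Lemma quasi_primary_weight a : quasi_primary X a ->
  exists2 d : nat, weight_vector X d%:Z a & L 1 a = 0.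
Proof.
move=> [d wd qa]; have [->|a0] := eqVneq a 0.
  by exists 0%N; [exact: weight0 | exact: (linear_0 (virL_lin hva _))].
by have := weight_ge0 wd a0; case: d wd => // d wd _; exists d.
Qed.

Lemma mode_vacuum (d : nat) a n : weight_vector X d%:Z a ->
  mode X a n om = if n + d%:Z <= 0 then
     (absz (n + d%:Z))`!%:R^-1 *: iter (absz (n + d%:Z)) T a else 0.
Proof.
move=> wa; rewrite (mode_homogeneous _ _ wa); case: ifP => h.
  rewrite -vop_translation_vacuum //; congr (vop _ _ _ _); lia.
by rewrite vop_annihilation //; lia.
Qed.

Lemma translation_weight0 v : weight_vector X 0 v -> T v = 0.
Proof.
move=> wv; have qv : L 1 v = 0.
  apply/eqP/negPn/negP => z; have := weight_ge0 (weight_virL 1 wv) z; lia.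
by apply: (sp_eq0 hq); rewrite (sqform_translation wv qv) mulr0 mul0r.
Qed.

End UnitaryVOA.

(** * Flows generating the Moebius group *)

Section ComplexDerivatives.
Variable R : realType.
Implicit Types (g k : R -> R[i]) (t s : R) (a b : R[i]).

(** Componentwise form of [has_derivative] for scalar functions, so that product and quotient rules
    reduce to the real ones. *)
Definition cder g t a :=
  is_derive t 1 (fun s => complex.Re (g s)) (complex.Re a) /\
  is_derive t 1 (fun s => complex.Im (g s)) (complex.Im a).

Lemma has_derivative_cder g t a : @has_derivative R R[i]^o g t a -> cder g t a.
Proof.
move=> /cvg_rnormP h.
have E (x : R) : (x^-1)%:C *: (g (t + x) - g t : R[i]^o) - a =
    (x^-1 * (complex.Re (g (t + x)) - complex.Re (g t)) - complex.Re a) +i*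
    (x^-1 * (complex.Im (g (t + x)) - complex.Im (g t)) - complex.Im a).
  rewrite -[_ *: _]/(_ * _).
  by case: (g (t + x)) => ? ?; case: (g t) => ? ?; case: a {h} => ? ?; simpc.
split; apply/der_limP/cvgrPdist_lt => e e0; move: (h e e0); apply: filterS => x.
- rewrite E rnorm_le_norm => /(le_lt_trans _); apply; rewrite distrC.
  by rewrite -lecR [X in _ <= X]RRe_real ?normr_real //; exact: (normc_ge_Re (_ +i* _)).
- rewrite E rnorm_le_norm => /(le_lt_trans _); apply; rewrite distrC.
  rewrite normc_def /= -sqrtr_sqr ler_wsqrtr // lerDr sqr_ge0 //.
Qed.

Lemma cder_has_derivative g t a : cder g t a -> @has_derivative R R[i]^o g t a.
Proof.
have E (x : R) : (x^-1)%:C *: (g (t + x) - g t : R[i]^o) - a =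
    (x^-1 * (complex.Re (g (t + x)) - complex.Re (g t)) - complex.Re a)%:C +
    'i%C * (x^-1 * (complex.Im (g (t + x)) - complex.Im (g t)) - complex.Im a)%:C.
  rewrite -[_ *: _]/(_ * _).
  by case: (g (t + x)) => ? ?; case: (g t) => ? ?; case: a => ? ?; simpc.
move=> [/der_limP/cvgrPdist_lt h1 /der_limP/cvgrPdist_lt h2]; apply/cvg_rnormP => e e0.
have e2 : 0 < e / 2 by rewrite divr_gt0.
have k1 := h1 _ e2; have k2 := h2 _ e2; near=> x.
have l1 : `|complex.Re a - x^-1 * (complex.Re (g (t + x)) - complex.Re (g t))| < e / 2.
  by near: x.
have l2 : `|complex.Im a - x^-1 * (complex.Im (g (t + x)) - complex.Im (g t))| < e / 2.
  by near: x.
rewrite E.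
apply: (le_lt_trans (@rnormD R R[i]^o _ _)); rewrite !rnorm_le_norm Re_normM.
have -> : complex.Re `|'i%C : R[i]| = 1.
  by rewrite normc_def /= expr0n expr1n add0r sqrtr1.
have nr (r : R) : complex.Re `|r%:C| = `|r|.
  by rewrite normc_def /= expr0n addr0 sqrtr_sqr.
rewrite mul1r !nr; rewrite distrC in l1; rewrite distrC in l2; lra.
Unshelve. all: by end_near. Qed.

Lemma cder_val g t a b : cder g t a -> a = b -> cder g t b.
Proof. by move=> h <-. Qed.

Lemma cder_cst t a : cder (fun=> a) t 0.
Proof. by split; exact: der_cst. Qed.

Lemma cderD g k t a b : cder g t a -> cder k t b -> cder (fun s => g s + k s) t (a + b).
Proof.
move=> [g1 g2] [k1 k2]; split.
  apply: der_val (der_ext (derD g1 k1) _) _; last by rewrite raddfD.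
  by move=> s; rewrite raddfD.
apply: der_val (der_ext (derD g2 k2) _) _; last by rewrite raddfD.
by move=> s; rewrite raddfD.
Qed.

Lemma cderM g k t a b : cder g t a -> cder k t b ->
  cder (fun s => g s * k s) t (a * k t + g t * b).
Proof.
move=> [g1 g2] [k1 k2]; split.
  apply: der_val (der_ext (derB (derM g1 k1) (derM g2 k2)) _) _.
    by move=> s; case: (g s) => ? ?; case: (k s).
  by case: (g t) => ? ?; case: (k t) => ? ?; case: a {g1 g2} => ? ?; case: b {k1 k2} => ? ? /=; ring.
apply: der_val (der_ext (derD (derM g1 k2) (derM g2 k1)) _) _.
  by move=> s; case: (g s) => ? ?; case: (k s) => ? ? /=; rewrite [X in _ + X]mulrC.
by case: (g t) => ? ?; case: (k t) => ? ?; case: a {g1 g2} => ? ?; case: b {k1 k2} => ? ? /=; ring.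
Qed.

Lemma cderZ g t a b : cder g t a -> cder (fun s => b * g s) t (b * a).
Proof. by move=> h; apply: cder_val (cderM (cder_cst t b) h) _; rewrite mul0r add0r. Qed.

Lemma cderB g k t a b : cder g t a -> cder k t b -> cder (fun s => g s - k s) t (a - b).
Proof.
move=> hg hk; have := cderD hg (cderZ (-1) hk); rewrite mulN1r.
by congr cder; apply/funext => s; rewrite mulN1r.
Qed.

Lemma cderV g t a : (forall s, g s != 0) -> cder g t a ->
  cder (fun s => (g s)^-1) t (- a / g t ^+ 2).
Proof.
move=> g0 [g1 g2].
pose n s := complex.Re (g s) ^+ 2 + complex.Im (g s) ^+ 2.
have n0 s : n s != 0.
  have := g0 s; rewrite /n; case: (g s) => x y; rewrite eq_complex /=.
  apply: contraNN; rewrite paddr_eq0 ?sqr_ge0 // !expf_eq0 /=.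
  by move=> /andP[-> ->].
have dn : is_derive t 1 n (complex.Re (g t) * complex.Re a + complex.Re (g t) * complex.Re a +
    (complex.Im (g t) * complex.Im a + complex.Im (g t) * complex.Im a)).
  by apply: der_ext (derD (derM g1 g1) (derM g2 g2)) _ => s; rewrite /n !expr2.
have dnV := is_deriveV (n0 t) dn.
split.
  apply: der_val (der_ext (derM g1 dnV) _) _.
    by move=> s; rewrite /n; case: (g s).
  move: (n0 t); rewrite /n; case: (g t) => x y /=; case: a {g1 g2 dn dnV} => p q /= nz.
  have e : (x * x - y * y) ^+ 2 + (x * y + y * x) ^+ 2 = (x ^+ 2 + y ^+ 2) ^+ 2 by ring.
  by rewrite -[_ *: _]/(_ * _) e; field.
apply: der_val (der_ext (derN (derM g2 dnV)) _) _.
  by move=> s; rewrite /n; case: (g s).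
move: (n0 t); rewrite /n; case: (g t) => x y /=; case: a {g1 g2 dn dnV} => p q /= nz.
have e : (x * x - y * y) ^+ 2 + (x * y + y * x) ^+ 2 = (x ^+ 2 + y ^+ 2) ^+ 2 by ring.
by rewrite -[_ *: _]/(_ * _) e; field.
Qed.

Lemma cder_real (u : R -> R) t (r : R) : is_derive t 1 u r -> cder (fun s => (u s)%:C) t r%:C.
Proof. by move=> h; split => //=; exact: der_cst. Qed.

(** To the right of 0 the product of [u] with [expR (- K * t)] is nonincreasing, and to the left the
    product with [expR (K * t)] is nondecreasing; both vanish at 0. *)
Lemma gronwall (u : R -> R) (du : R -> R) (K : R) : (forall t, 0 <= u t) ->
  (forall t, is_derive t 1 u (du t)) -> (forall t, `|du t| <= K * u t) -> u 0 = 0 ->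
  forall t, u t = 0.
Proof.
move=> u0 hu hd uz t.
have dexp (c : R) s : is_derive s 1 (fun x : R => expR (c * x)) (expR (c * s) * c).
  apply: (der_comp (f := expR) (g := fun x => c * x)).
  by apply: der_val (derZ c (der_id s)) _; rewrite mulr1.
apply/eqP; rewrite eq_le u0 andbT.
case: (leP 0 t) => t0.
  have := @der_nonincreasing R (fun s => u s * expR (- K * s))
    (fun s => u s * (expR (- K * s) * - K) + expR (- K * s) * du s) 0 t t0.
  rewrite uz mul0r pmulr_lle0 ?expR_gt0 //; apply.
    by move=> s _; exact: derM.
  move=> s _; have := hd s; have := ler_norm (du s); have := expR_gt0 (- K * s).
  set E := expR _ => E0 h1 h2.
  have -> : u s * (E * - K) + E * du s = E * (du s - K * u s) by ring.
  by rewrite pmulr_rle0 // subr_le0 (le_trans h1).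
have := @der_nonincreasing R (fun s => - (u s * expR (K * s)))
    (fun s => - (u s * (expR (K * s) * K) + expR (K * s) * du s)) t 0 (ltW t0).
rewrite uz mul0r oppr0 oppr_ge0 pmulr_lle0 ?expR_gt0 //; apply.
  by move=> s _; apply: derN; exact: derM.
move=> s _; have := hd s; have := ler_norm (- du s); have := expR_gt0 (K * s).
rewrite normrN; set E := expR _ => E0 h1 h2.
have -> : - (u s * (E * K) + E * du s) = E * (- du s - K * u s) by ring.
by rewrite pmulr_rle0 // subr_le0 (le_trans h1).
Qed.

(** Gronwall for the squared modulus of [g]. It serves to identify an arbitrary flow with an
    explicit one, since [is_flow] does not name a particular solution. *)
Lemma linear_ode_zero g (k : R -> R[i]) (K : R) : (forall t, cder g t (k t * g t)) ->
  (forall t, complex.Re `|k t| <= K) -> g 0 = 0 -> forall t, g t = 0.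
Proof.
move=> hg hk gz.
pose u t := complex.Re (g t) ^+ 2 + complex.Im (g t) ^+ 2.
pose du t := 2 * complex.Re (k t) * u t.
have : forall t, u t = 0.
  apply: (@gronwall u du (2 * K)).
  - by move=> t; rewrite addr_ge0 ?sqr_ge0.
  - move=> t; have [h1 h2] := hg t.
    apply: der_val (der_ext (derD (derM h1 h1) (derM h2 h2)) _) _.
      by move=> s; rewrite /u !expr2.
    by rewrite /du /u; case: (g t) => x y; case: (k t) => p q /=; ring.
  - move=> t; rewrite /du normrM [`|u t|]ger0_norm ?addr_ge0 ?sqr_ge0 //.
    rewrite ler_wpM2r ?addr_ge0 ?sqr_ge0 // normrM ger0_norm // ler_pM2l //.
    apply: le_trans (hk t); rewrite -lecR [X in _ <= X]RRe_real ?normr_real //.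
    exact: normc_ge_Re.
  - by rewrite /u gz /= expr0n addr0.
move=> h t; have := h t; rewrite /u; case: (g t) => x y /eqP /=.
by rewrite paddr_eq0 ?sqr_ge0 // !expf_eq0 /= => /andP[/eqP -> /eqP ->].
Qed.

End ComplexDerivatives.

Section Flows.
Variable R : realType.
Local Notation S1 := (@unit_circle R).
Implicit Types (z : S1) (t s : R).

Definition circle_of (w : R[i]) (hw : `|w| = 1) : S1 := SigSub (mem_set (hw : unit_circle w)).

Lemma circle_ofE (w : R[i]) (hw : `|w| = 1) : circle_val (circle_of hw) = w.
Proof. by []. Qed.

Lemma conjE (w : R[i]) : (w^*)%R = (w^*)%C. Proof. by []. Qed.

Lemma norm1_conj (w : R[i]) : `|w| = 1 -> w * (w^*)%C = 1.
Proof. by move=> h; rewrite -sqr_normc h expr1n. Qed.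

Lemma norm_eq1 (w : R[i]) : w * (w^*)%C = 1 -> `|w| = 1.
Proof.
rewrite -sqr_normc => h; apply/eqP; rewrite -(@eqrXn2 _ 2) ?normr_ge0 ?expr1n //.
by rewrite h.
Qed.

Lemma cder_cis t : cder (@cis R) t ((0 +i* 1) * cis t).
Proof.
by split; [apply: der_val (der_cos t) _ | apply: der_val (der_sin t) _]; rewrite /= !(mul0r, mul1r, sub0r, add0r).
Qed.

Lemma rotation_flow : exists phi, is_flow (@one_field R) phi.
Proof.
have h t z : `|cis t * circle_val z| = 1 by rewrite normrM norm_cis circle_norm mulr1.
exists (fun t z => circle_of (h t z)); split.
  by move=> z; apply: circle_val_inj; rewrite circle_ofE cis0 mul1r.
move=> t z; apply: cder_has_derivative.
have := cderM (cder_cis t) (cder_cst t (circle_val z)).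
by move=> hh; apply: cder_val hh _; rewrite mulr0 addr0 /one_field mulr1 mulrA.
Qed.

Lemma rotation_flow_mobius phi : is_flow (@one_field R) phi -> forall t, mobius (phi t).
Proof.
move=> [p0 dp] t.
have pt s z : circle_val (phi s z) = cis s * circle_val z.
  apply/eqP; rewrite -subr_eq0; apply/eqP.
  apply: (@linear_ode_zero R (fun s => circle_val (phi s z) - cis s * circle_val z) (fun=> 0 +i* 1) 1).
  - move=> r; have h1 := has_derivative_cder (dp r z).
    have h2 := cderM (cder_cis r) (cder_cst r (circle_val z)).
    by apply: cder_val (cderB h1 h2) _; rewrite /one_field; ring.
  - by move=> r; rewrite normc_def /= expr0n expr1n add0r sqrtr1.
  - by rewrite p0 cis0 mul1r subrr.
(* The angle is halved because a diagonal element of SU(1,1) acts by the quotient of its entries,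
   the square of the first. *)
exists (cis (t / 2)), 0; split; first by rewrite norm_cis normr0 expr1n expr0n subr0.
move=> z; rewrite pt !conjE rmorph0 mul0r add0r addr0 -cisN_conj cisN invrK.
by rewrite mulrAC -cisD -splitr.
Qed.

Section Boost.
Variables (kappa : R[i]) (f : S1 -> R[i]) (ch sh : R -> R).
Hypothesis k1 : `|kappa| = 1.
Hypothesis hf : forall z, (0 +i* 1) * f z * circle_val z =
  (kappa - (kappa^*)%C * circle_val z ^+ 2) / 2.
Hypothesis chsh : forall t, ch t ^+ 2 - sh t ^+ 2 = 1.
Hypothesis der_ch : forall t, is_derive t 1 ch (sh t / 2).
Hypothesis der_sh : forall t, is_derive t 1 sh (ch t / 2).
Hypotheses (ch0 : ch 0 = 1) (sh0 : sh 0 = 0).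

(** The flow will be [num z t / den z t], the Moebius map with first row [ch t], [kappa * sh t]. The
    cos field is the case [kappa = i], the sin field the case [kappa = -1], and [ch], [sh] become
    hyperbolic functions of [t / 2]. *)
Let num z t : R[i] := (ch t)%:C * circle_val z + kappa * (sh t)%:C.
Let den z t : R[i] := (kappa^*)%C * (sh t)%:C * circle_val z + (ch t)%:C.

Let kk : kappa * (kappa^*)%C = 1. Proof. exact: norm1_conj. Qed.

Let cder_num z t : cder (num z) t (kappa / 2 * den z t).
Proof.
have h1 := cderM (cder_real (der_ch t)) (cder_cst t (circle_val z)).
have h2 := cderZ kappa (cder_real (der_sh t)).
apply: cder_val (cderD h1 h2) _; rewrite /den !rmorphM !fmorphV !rmorph_nat /=.
have -> : kappa / 2 * ((kappa^*)%C * (sh t)%:C * circle_val z + (ch t)%:C) =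
  (kappa * (kappa^*)%C) * (sh t)%:C / 2 * circle_val z + kappa * ((ch t)%:C / 2) by ring.
by rewrite kk mul1r mulr0 addr0.
Qed.

Let cder_den z t : cder (den z) t ((kappa^*)%C / 2 * num z t).
Proof.
have h1 := cderM (cderZ (kappa^*)%C (cder_real (der_sh t))) (cder_cst t (circle_val z)).
apply: cder_val (cderD h1 (cder_real (der_ch t))) _.
rewrite /num !rmorphM !fmorphV !rmorph_nat /=.
have -> : (kappa^*)%C / 2 * ((ch t)%:C * circle_val z + kappa * (sh t)%:C) =
  (kappa^*)%C * ((ch t)%:C / 2) * circle_val z + (kappa * (kappa^*)%C) * (sh t)%:C / 2 by ring.
by rewrite kk mul1r mulr0 addr0.
Qed.

Let num_conj z t : (num z t)^*%C = den z t * (circle_val z)^*%C.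
Proof.
have -> : (num z t)^*%C = (ch t)%:C * (circle_val z)^*%C + (kappa^*)%C * (sh t)%:C.
  by rewrite /num rmorphD !rmorphM; congr (_ * _ + _ * _); exact: conjc_real.
rewrite /den.
have := norm1_conj (circle_norm z) => e.
rewrite [RHS]mulrDl -[X in _ = X + _]mulrA e mulr1; exact: addrC.
Qed.

Let den_neq0 z t : den z t != 0.
Proof.
apply/eqP => d0.
have n0 : num z t = 0.
  by apply/eqP; rewrite -conjc_eq0 num_conj d0 mul0r.
have : (ch t)%:C * (num z t) - kappa * (sh t)%:C * den z t = circle_val z.
  rewrite /num /den.
  have -> : (ch t)%:C * ((ch t)%:C * circle_val z + kappa * (sh t)%:C) -
    kappa * (sh t)%:C * ((kappa^*)%C * (sh t)%:C * circle_val z + (ch t)%:C) =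
    ((ch t)%:C ^+ 2 - (kappa * (kappa^*)%C) * (sh t)%:C ^+ 2) * circle_val z by ring.
  by rewrite kk mul1r -!rmorphXn -rmorphB /= chsh mul1r.
rewrite n0 d0 !mulr0 subrr => e.
by have := circle_norm z; rewrite -e normr0 => /esym/eqP; rewrite oner_eq0.
Qed.

Let ratio_norm z t : `|num z t / den z t| = 1.
Proof.
apply: norm_eq1; rewrite rmorphM fmorphV /= num_conj.
have dc : (den z t)^*%C = num z t * (circle_val z)^*%C.
  have := congr1 (fun w => (w^*)%C) (num_conj z t); rewrite /= conjcK rmorphM /= conjcK => ->.
  by rewrite -mulrA norm1_conj ?mulr1 // circle_norm.
have n0 : num z t != 0.
  apply: contra_neq (den_neq0 z t) => n0; apply/eqP; rewrite -conjc_eq0 dc n0 mul0r //.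
have z0 : (circle_val z)^*%C != 0.
  by rewrite conjc_eq0 -normr_eq0 circle_norm oner_eq0.
by rewrite dc; field; rewrite n0 z0 den_neq0.
Qed.

Lemma boost_flow : exists phi, is_flow f phi.
Proof.
exists (fun t z => circle_of (ratio_norm z t)); split.
  move=> z; apply: circle_val_inj; rewrite circle_ofE /num /den.
  by rewrite ch0 sh0 !mulr0 mul0r add0r addr0 mul1r divr1.
move=> t z; apply: cder_has_derivative.
have h := cderM (cder_num z t) (cderV (den_neq0 z) (cder_den z t)).
apply: cder_val h _; rewrite hf circle_ofE.
by field; rewrite den_neq0.
Qed.

Lemma boost_flow_mobius phi : is_flow f phi -> forall t, mobius (phi t).
Proof.
move=> [p0 dp] t.
(* The flow equation is of Riccati type; the difference from the explicit solution, multiplied by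
   [den], satisfies a homogeneous linear equation instead. *)
have pt s z : circle_val (phi s z) * den z s - num z s = 0.
  apply: (@linear_ode_zero R (fun s => circle_val (phi s z) * den z s - num z s)
    (fun s => - ((kappa^*)%C * circle_val (phi s z) / 2)) 1).
  - move=> r; have h1 := has_derivative_cder (dp r z); rewrite hf in h1.
    apply: cder_val (cderB (cderM h1 (cder_den z r)) (cder_num z r)) _.
    by field.
  - move=> r; rewrite normrN !Re_normM.
    have e1 : complex.Re `|(kappa^*)%C| = 1 by rewrite normcJ k1.
    have e2 : complex.Re `|2^-1 : R[i]| = 2^-1.
      by rewrite normfV normr_nat -[2%:R](rmorph_nat (real_complex R)) -fmorphV.
    by rewrite e1 e2 circle_norm /=; lra.
  - by rewrite p0 /num /den ch0 sh0 !mulr0 mul0r add0r addr0 mul1r mulr1 subrr.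
exists (ch t)%:C, (kappa * (sh t)%:C); split.
  rewrite normrM k1 mul1r !sqr_normc !conjc_real -!rmorphM -rmorphB /= -!expr2.
  by rewrite chsh.
have e : ((kappa * (sh t)%:C)^*)%C = (kappa^*)%C * (sh t)%:C.
  by rewrite rmorphM; congr (_ * _); exact: conjc_real.
move=> z; rewrite !conjE e conjc_real -/(den z t) -/(num z t).
apply: (mulIf (den_neq0 z t)); rewrite divfK ?den_neq0 //.
by apply/eqP; rewrite -subr_eq0 pt.
Qed.

End Boost.

Definition cosh_half t : R := (expR (2^-1 * t) + expR (- 2^-1 * t)) / 2.
Definition sinh_half t : R := (expR (2^-1 * t) - expR (- 2^-1 * t)) / 2.

Lemma cosh_sinh_half t : cosh_half t ^+ 2 - sinh_half t ^+ 2 = 1.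
Proof.
have e : expR (2^-1 * t) * expR (- 2^-1 * t) = 1 by rewrite -expRD mulNr subrr expR0.
rewrite /cosh_half /sinh_half; move: e; move: (expR (2^-1 * t)) (expR _) => x y e.
by rewrite -[RHS]e; field.
Qed.

Lemma der_expR_scale (c : R) t :
  is_derive t 1 (fun x : R => expR (c * x)) (c * expR (c * t)).
Proof.
rewrite mulrC; apply: (der_comp (f := expR) (g := fun x => c * x)).
by apply: der_val (derZ c (der_id t)) _; rewrite mulr1.
Qed.

Lemma der_cosh_half t : is_derive t 1 cosh_half (sinh_half t / 2).
Proof.
have := derZ 2^-1 (derD (der_expR_scale 2^-1 t) (der_expR_scale (- 2^-1) t)) => h.
apply: der_val (der_ext h _) _; first by move=> s; rewrite mulrC.
by rewrite /sinh_half; ring.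
Qed.

Lemma der_sinh_half t : is_derive t 1 sinh_half (cosh_half t / 2).
Proof.
have := derZ 2^-1 (derB (der_expR_scale 2^-1 t) (der_expR_scale (- 2^-1) t)) => h.
apply: der_val (der_ext h _) _; first by move=> s; rewrite mulrC.
by rewrite /cosh_half; ring.
Qed.

Lemma cosh_half0 : cosh_half 0 = 1.
Proof. by rewrite /cosh_half !mulr0 expR0 -mulr2n -[1 *+ 2]mulr_natl mulr1 divff. Qed.

Lemma sinh_half0 : sinh_half 0 = 0.
Proof. by rewrite /sinh_half !mulr0 expR0 subrr mul0r. Qed.

Lemma boost_flows (kappa : R[i]) (f : S1 -> R[i]) : `|kappa| = 1 ->
  (forall z, (0 +i* 1) * f z * circle_val z =
     (kappa - (kappa^*)%C * circle_val z ^+ 2) / 2) ->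
  (exists phi, is_flow f phi) /\ (forall phi, is_flow f phi -> forall t, mobius (phi t)).
Proof.
move=> k1 hf; split.
  exact: (boost_flow k1 hf cosh_sinh_half der_cosh_half der_sinh_half cosh_half0 sinh_half0).
move=> phi hphi t.
exact: (boost_flow_mobius k1 hf cosh_sinh_half der_cosh_half der_sinh_half cosh_half0 sinh_half0 hphi).
Qed.

Lemma circle_val_conj z : circle_val z * (circle_val z)^*%C = 1.
Proof. exact/norm1_conj/circle_norm. Qed.

Lemma cos_flows : (exists phi, is_flow (@cos_field R) phi) /\
  (forall phi, is_flow (@cos_field R) phi -> forall t, mobius (phi t)).
Proof.
apply: (@boost_flows (0 +i* 1)); first by rewrite normc_def /= expr0n expr1n add0r sqrtr1.
move=> z; have := circle_val_conj z; rewrite /cos_field; case: (circle_val z) => x y.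
move=> [e1 e2]; apply: (mulIf (_ : (2 : R[i]) != 0)); first by rewrite pnatr_eq0.
rewrite divfK ?pnatr_eq0 //= mulr_natr mulr2n expr2; simpc.
by congr (_ +i* _); [ring | rewrite -e1; ring].
Qed.

Lemma sin_flows : (exists phi, is_flow (@sin_field R) phi) /\
  (forall phi, is_flow (@sin_field R) phi -> forall t, mobius (phi t)).
Proof.
apply: (@boost_flows (- 1)); first by rewrite normrN1.
move=> z; have := circle_val_conj z; rewrite /sin_field; case: (circle_val z) => x y.
move=> [e1 e2]; apply: (mulIf (_ : (2 : R[i]) != 0)); first by rewrite pnatr_eq0.
rewrite divfK ?pnatr_eq0 // [conjc _](_ : _ = -1); last first.
  by apply/eqP; rewrite eq_complex /= !oppr0 !eqxx.
rewrite /= mulN1r opprK mulr_natr mulr2n expr2.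
have -> : - 1 = - (x * x - y * - y) +i* 0 :> R[i].
  by rewrite e1; apply/eqP; rewrite eq_complex /= oppr0 !eqxx.
by simpc; congr (_ +i* _); ring.
Qed.

End Flows.

(** * Smeared vertex operators *)

Section BilateralSums.
Variables (R : realType) (H : completeNormedModType R[i]).
Implicit Types (u v : int -> H) (x y z : H).

Lemma bilateral_lin u v (c : R[i]) x y : bilateral_sum u x -> bilateral_sum v y ->
  bilateral_sum (fun n => c *: u n + v n) (c *: x + y).
Proof.
move=> [xp [xn [h1 h2 ->]]] [yp [yn [h3 h4 ->]]].
exists (c *: xp + yp), (c *: xn + yn).
have E (w w' : nat -> H) : series (fun k => c *: w k + w' k) =
    (fun n => c *: series w n + series w' n).
  by apply/funext => n; rewrite !seriesEnat /= big_split /= scaler_sumr.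
split; last by rewrite scalerDr addrACA.
  by rewrite E; apply: cvgD => //; exact: cvgZr.
by rewrite E; apply: cvgD => //; exact: cvgZr.
Qed.

Lemma bilateral_uniq u x y : bilateral_sum u x -> bilateral_sum u y -> x = y.
Proof.
move=> [xp [xn [h1 h2 ->]]] [yp [yn [h3 h4 ->]]].
by rewrite (cvg_rnorm_uniq h1 h3) (cvg_rnorm_uniq h2 h4).
Qed.

Lemma eq_bilateral u v x : u =1 v -> bilateral_sum u x -> bilateral_sum v x.
Proof. by move=> /funext ->. Qed.

Lemma bilateral_abs u (A : R) : (forall n, rnorm (u n) <= A * (absz n).+1%:R ^- 2) ->
  exists2 x, bilateral_sum u x & rnorm x <= 4 * A.
Proof.
move=> hu.
have A0 : 0 <= A.
  have := hu 0; rewrite expr1n invr1 mulr1; apply: le_trans; exact: rnorm_ge0.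
have bnd N : series (fun n : nat => A * n.+1%:R ^- 2) N <= A * 2.
  rewrite seriesEnat /= -mulr_sumr ler_wpM2l //.
  by have := series_inv_sq R N; rewrite seriesEnat.
have [|xp hp np] := @series_rnorm_cvg R H (fun k => u (Posz k)) _ _ _ bnd.
  by move=> n; exact: hu.
have [|xn hn nn] := @series_rnorm_cvg R H (fun k => u (Negz k)) _ _ _ bnd.
  move=> n; apply: le_trans (hu _) _; rewrite ler_wpM2l //.
  rewrite lef_pV2 ?posrE ?exprn_gt0 ?ltr0n // lerXn2r ?nnegrE //.
  by rewrite ler_nat; lia.
exists (xp + xn); first by exists xp, xn.
by apply: le_trans (rnormD _ _) _; lra.
Qed.

(** [q] stands for the moduli of the Fourier coefficients and [s] for the exponent of the energy
    bounds; two more orders of decay make the sum absolutely convergent. *)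
Lemma bilateral_weighted (q : int -> R) u (D r : R) (s : nat) :
  0 <= r -> (forall n, 0 <= q n) -> (forall n, q n * (absz n).+1%:R ^+ (s + 2) <= D) ->
  (forall n, rnorm (u n) <= q n * ((absz n).+1%:R ^+ s * r)) ->
  exists2 x, bilateral_sum u x & rnorm x <= 4 * (D * r).
Proof.
move=> r0 q0 hD hu; apply: bilateral_abs => n.
have n0 : (0 : R) < (absz n).+1%:R by rewrite ltr0n.
rewrite ler_pdivlMr ?exprn_gt0 //.
apply: le_trans (_ : q n * ((absz n).+1%:R ^+ s * r) * (absz n).+1%:R ^+ 2 <= _).
  by rewrite ler_wpM2r ?exprn_ge0.
have -> : q n * ((absz n).+1%:R ^+ s * r) * (absz n).+1%:R ^+ 2 =
  q n * (absz n).+1%:R ^+ (s + 2) * r by rewrite exprD; ring.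
exact: ler_wpM2r.
Qed.

Lemma bilateral_finite (s : seq int) u : uniq s -> (forall n, n \notin s -> u n = 0) ->
  bilateral_sum u (\sum_(n <- s) u n).
Proof.
elim: s u => [|m s IH] u us hu.
  have u0 n : u n = 0 by apply: hu.
  exists 0, 0; split; last by rewrite big_nil addr0.
    have -> : series (fun k => u (Posz k)) = (fun=> 0).
      by apply/funext => n; rewrite seriesEnat /= big1 // => i _; exact: u0.
    exact: cvg_cst.
  have -> : series (fun k => u (Negz k)) = (fun=> 0).
    by apply/funext => n; rewrite seriesEnat /= big1 // => i _; exact: u0.
  exact: cvg_cst.
move: us => /= /andP[ms us].
pose v n := if n == m then 0 else u n.
have hv : bilateral_sum v (\sum_(n <- s) v n).
  apply: IH => // n ns; rewrite /v; case: eqP => // /eqP nm.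
  by apply: hu; rewrite inE negb_or nm.
have dl : bilateral_sum (fun n => if n == m then u m else 0) (u m).
  have one (w : nat -> H) k : (forall i, i != k -> w i = 0) -> series w @ \oo --> w k.
    move=> hw; apply/cvgn_rnormP => e e0; exists k.+1 => n kn.
    rewrite seriesEnat /= (bigD1_seq k) ?iota_uniq //=; last by rewrite mem_index_iota.
    by rewrite big1 ?addr0 ?subrr ?rnorm0 // => i ik; exact: hw.
  have z0 (w : nat -> H) : (forall i, w i = 0) -> series w @ \oo --> (0 : H).
    move=> hw; have -> : series w = (fun=> 0).
      by apply/funext => n; rewrite seriesEnat /= big1.
    exact: cvg_cst.
  case: m {ms v hv hu} => k.
    exists (u (Posz k)), 0; split; last by rewrite addr0.
      have := @one (fun i => if Posz i == Posz k then u (Posz k) else 0) k.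
      rewrite /= eqxx; apply => i ik; by rewrite eqz_nat (negPf ik).
    by apply: z0 => i.
  exists 0, (u (Negz k)); split; last by rewrite add0r.
    by apply: z0 => i.
  have := @one (fun i => if Negz i == Negz k then u (Negz k) else 0) k.
  rewrite /= eqxx; apply => i ik.
  by case: eqP => // -[e]; rewrite e eqxx in ik.
rewrite big_cons; have := bilateral_lin 1 dl hv; rewrite scale1r.
have -> : \sum_(n <- s) v n = \sum_(n <- s) u n.
  apply: eq_big_seq => n ns; rewrite /v; case: eqP => // e.
  by rewrite -e ns in ms.
apply: eq_bilateral => n; rewrite scale1r /v; case: eqP => [->|_].
  by rewrite addr0.
by rewrite add0r.
Qed.

(** No positive index contributes, so the sum runs over the terms [u (- k%:Z)], of which the first
    [d] vanish; what remains is indexed as in the definition of the Fredenhagen-Joerss vector. *)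
Lemma bilateral_onesided (d : nat) u y : (forall n, 0 < n + d%:Z -> u n = 0) ->
  bilateral_sum u y -> series (fun k => u (- (k + d)%N%:Z)) @ \oo --> y.
Proof.
move=> hu [xp [xn [h1 h2 ->]]].
pose v k := u (- k%:Z).
have uz (n : nat) : (0 < n)%N -> u n%:Z = 0 by move=> n0; apply: hu; lia.
have e1 : xp = u 0.
  apply: (cvg_rnorm_uniq h1); apply/cvgn_rnormP => e e0; exists 1%N => -[//|n] _.
  rewrite seriesEnat /= big_nat_recl // big1 ?addr0 ?subrr ?rnorm0 // => i _.
  exact: uz.
have hv N : series v N.+1 = u 0 + series (fun k => u (Negz k)) N.
  rewrite !seriesEnat /= big_nat_recl // {1}/v oppr0; congr (_ + _).
have shift N : series (fun k => u (- (k + d)%N%:Z)) N = series v (N + d)%N.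
  rewrite !seriesEnat /= [RHS](big_cat_nat (n := d)) ?leq_addl //=.
  rewrite [X in _ = X + _]big_nat [X in _ = X + _]big1 ?add0r; last first.
    by move=> i /andP[_ id]; apply: hu; rewrite addrC subr_gt0 ltz_nat.
  by rewrite -{2}[d]add0n big_addn addnK.
apply/cvgn_rnormP => e e0; have [N hN] := (cvgn_rnormP _ _).1 h2 _ e0.
exists N.+1 => n Nn; rewrite shift.
have -> : (n + d)%N = (n + d).-1.+1 by rewrite prednK // addn_gt0; case: n Nn.
rewrite hv e1 opprD addrACA subrr add0r; apply: hN; lia.
Qed.

End BilateralSums.

Section BilateralForm.
Variables (R : realType) (H : completeNormedModType R[i]) (ip : H -> H -> R[i]).
Hypothesis hH : hilbert ip.
Implicit Types (u v : int -> H) (x y z : H).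

Lemma bilateral_ip u v x y z w : bilateral_sum u x -> bilateral_sum v y ->
  (forall n, ip z (u n) = ip (v n) w) -> ip z x = ip y w.
Proof.
have sp := hH.1.
move=> [xp [xn [h1 h2 ->]]] [yp [yn [h3 h4 ->]]] e.
have key (p q : nat -> H) (a b : H) : series p @ \oo --> a -> series q @ \oo --> b ->
    (forall n, ip z (p n) = ip (q n) w) -> ip z a = ip b w.
  move=> ha hb hpq.
  have l1 : (fun n => ip z (series p n) : R[i]^o) @ \oo --> (ip z a : R[i]^o) by apply: (ip_cvg hH).
  have l2 : (fun n => ip w (series q n) : R[i]^o) @ \oo --> (ip w b : R[i]^o) by apply: (ip_cvg hH).
  apply: (@rnorm_small_eq R R[i]^o) => r r0.
  have r2 : 0 < r / 2 by rewrite divr_gt0.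
  have [N1 k1] := (cvgn_rnormP _ _).1 l1 _ r2.
  have [N2 k2] := (cvgn_rnormP _ _).1 l2 _ r2.
  pose n := maxn N1 N2.
  have {k1} := k1 n (leq_maxl _ _); have {k2} := k2 n (leq_maxr _ _).
  have -> : ip z (series p n) = ((ip w (series q n))^*)%C.
    rewrite -(spC sp) !seriesEnat /= (sp_sumr sp) (spC sp w) (sp_sumr sp) rmorph_sum.
    by apply: eq_bigr => i _ /=; rewrite hpq (spC sp w).
  rewrite (spC sp w b).
  set t := ip w _; move=> q1 q2.
  have q1' : rnorm ((t^*)%C - ((ip w b)^*)%C : R[i]^o) < r / 2.
    have -> : (t^*)%C - ((ip w b)^*)%C = ((t - ip w b)^*)%C :> R[i] by rewrite [RHS]rmorphB.
    by rewrite rnorm_le_norm normcJ -rnorm_le_norm.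
  have := @rnorm_triangle R R[i]^o (t^*)%C (ip z a) (ip w b)^*%C.
  rewrite rnormB in q2; move=> q3; apply: (le_lt_trans q3); lra.
rewrite (spDr sp) (spDl sp); congr (_ + _).
  exact: key h1 h3 (fun n => e n).
exact: key h2 h4 (fun n => e (Negz n)).
Qed.

End BilateralForm.

Section PolynomialGrowth.
Variable R : realType.

(** The growth that the rapid decay of the Fourier coefficients of a smooth function absorbs. *)
Definition poly_bounded (E : normedModType R[i]) (w : nat -> E) : Prop :=
  exists (K : R) (p : nat), forall k, rnorm (w k) <= K * k.+1%:R ^+ p.

Lemma poly_boundedD (E : normedModType R[i]) (v w : nat -> E) (c d : R[i]) :
  poly_bounded v -> poly_bounded w -> poly_bounded (fun k => c *: v k + d *: w k).
Proof.
move=> [K1 [p1 h1]] [K2 [p2 h2]].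
exists (complex.Re `|c| * `|K1| + complex.Re `|d| * `|K2|), (p1 + p2)%N => k.
have pw : (1 : R) <= k.+1%:R by rewrite ler1n.
have g (K : R) (p q : nat) (r : R) : r <= K * k.+1%:R ^+ p -> (p <= q)%N ->
    r <= `|K| * k.+1%:R ^+ q.
  move=> hr pq; apply: (le_trans hr); apply: le_trans (_ : `|K| * k.+1%:R ^+ p <= _).
    by rewrite ler_wpM2r ?exprn_ge0 // ler_norm.
  by rewrite ler_wpM2l // ler_weXn2l.
apply: (le_trans (rnormD _ _)); rewrite !rnormZ mulrDl -!mulrA.
apply: lerD; apply: ler_wpM2l; rewrite ?Re_norm_ge0 //.
  exact: (g _ p1 _ _ (h1 k) (leq_addr _ _)).
exact: (g _ p2 _ _ (h2 k) (leq_addl _ _)).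
Qed.

Lemma poly_bounded_ip (H : completeNormedModType R[i]) (ip : H -> H -> R[i])
  (w : nat -> H) z : hilbert ip ->
  poly_bounded w -> poly_bounded (fun k => ip z (w k) : R[i]^o).
Proof.
move=> hH [K [p h]]; exists (rnorm z * K), p => k.
by apply: (le_trans (ip_bound hH _ _)); rewrite -mulrA ler_wpM2l ?rnorm_ge0.
Qed.

End PolynomialGrowth.

(** * Smeared vertex operators as closed operators *)

Section Smeared.
Variables (R : realType) (H : completeNormedModType R[i]) (ip : H -> H -> R[i]).
Variables (V : lmodType R[i]) (X : voa_data V) (form : V -> V -> R[i]) (iota : V -> H).
Hypotheses (hV : unitary_voa X form) (hC : hilbert_completion ip iota form).
Hypothesis heb : energy_bounded X form.
Local Notation S1 := (@unit_circle R).
Local Notation om := (vacuum X).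
Local Notation T := (virL X (-1)).
Implicit Types (a b c v : V) (n : int) (f g : S1 -> R[i]).

Let hH : hilbert ip. Proof. by case: hC. Qed.
Let sp : scalar_product ip := hH.1.
Let li : linear iota. Proof. by case: hC. Qed.
Let ipi u v : ip (iota u) (iota v) = form u v. Proof. by case: hC. Qed.
Let hq : scalar_product form. Proof. by case: hV. Qed.
Let hva : vertex_algebra X. Proof. by case: hV => -[]. Qed.

Lemma dense_sep x y : (forall c, ip (iota c) x = ip (iota c) y) -> x = y.
Proof.
move=> h; apply/eqP; rewrite -subr_eq0; apply/eqP/(sp_eq0 sp).
have e0 c : ip (x - y) (iota c) = 0.
  by rewrite (spC sp (iota c)) (spBr sp) h subrr rmorph0.
apply: (@rnorm_small_eq R R[i]^o) => e e0'; rewrite subr0 rnorm_le_norm.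
have cl : closure (range iota) (x - y).
  move=> B Bx; case: hC => _ _ _ /(_ (B°)).
  case; [by exists (x - y) | exact: open_interior |].
  by move=> z [/interior_subset zB rz]; exists z.
have K0 : 0 < rnorm (x - y) + 1 by rewrite ltr_wpDl ?rnorm_ge0.
have eK : 0 < e / (rnorm (x - y) + 1) by rewrite divr_gt0.
have [_ [c _ <-] hc] := (closure_rnormP _ _).1 cl _ eK.
have -> : ip (x - y) (x - y) = ip (x - y) ((x - y) - iota c) by rewrite (spBr sp _ (x - y)) e0 subr0.
apply: le_lt_trans (ip_bound hH _ _) _; rewrite [rnorm (x - y - iota c)]rnormB.
apply: le_lt_trans (_ : (rnorm (x - y) + 1) * rnorm (iota c - (x - y)) < _).
  by rewrite ler_wpM2r ?rnorm_ge0 // lerDl.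
by rewrite mulrC -ltr_pdivlMr.
Qed.

Lemma iota_inj : injective iota.
Proof.
move=> u v e; apply/eqP; rewrite -subr_eq0; apply/eqP/(sp_eq0 hq).
by rewrite -ipi (linear_B li) e subrr (sp0r sp).
Qed.

Definition energy (v : V) : V := virL X 0 v + v.

Lemma sqrt_form v : sqrtC (form v v) = (rnorm (iota v))%:C.
Proof. by rewrite -ipi hH.2 sqrCK ?normr_ge0 // rnormE. Qed.

Lemma mode_bound a : exists (s k : nat) (M : R), 0 <= M /\
  forall n b, rnorm (iota (mode X a n b)) <=
    M * (absz n).+1%:R ^+ s * rnorm (iota (iter k energy b)).
Proof.
have [s [k [M [_ _ M0 h]]]] := heb a; exists s, k, M; split; first exact: ltW.
move=> n b; rewrite -lecR; have := h n b; rewrite !sqrt_form.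
by rewrite !rmorphM rmorphXn /= rmorph_nat.
Qed.

Definition smear_term a f b n : H := fourier f n *: iota (mode X a n b).

Lemma smear_sum a f : smooth_on_circle f -> exists (k : nat) (C : R), 0 <= C /\
  forall b, exists2 y, bilateral_sum (smear_term a f b) y &
    rnorm y <= C * rnorm (iota (iter k energy b)).
Proof.
move=> sf; have [s [k [M [M0 hM]]]] := mode_bound a.
have [D D0 hD] := fourier_decay (s + 2) sf.
exists k, (4 * (D * M)); split; first by rewrite !mulr_ge0.
move=> b; set r := rnorm (iota (iter k energy b)).
have r0 : 0 <= r by exact: rnorm_ge0.
have [|||y hy ny] := @bilateral_weighted R H (fun n => complex.Re `|fourier f n|)
    (smear_term a f b) D (M * r) s _ _ hD.
- by rewrite mulr_ge0.
- by move=> n; exact: Re_norm_ge0.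
- move=> n; rewrite /smear_term rnormZ ler_wpM2l ?Re_norm_ge0 //.
  by apply: (le_trans (hM n b)); rewrite mulrCA mulrA.
by exists y => //; move: ny; rewrite !mulrA.
Qed.

(** For smooth [f] the sum exists and is unique, so the default 0 can intervene only for other
    [f]. *)
Definition smear a f b : H := xget 0 [set y | bilateral_sum (smear_term a f b) y].

Lemma smearP a f b : smooth_on_circle f -> bilateral_sum (smear_term a f b) (smear a f b).
Proof.
move=> sf; have [k [C [_ h]]] := smear_sum a sf; have [y hy _] := h b.
by apply: (xgetPex 0 (P := [set y | bilateral_sum (smear_term a f b) y])); exists y.
Qed.

Lemma smear_uniq a f b y : smooth_on_circle f -> bilateral_sum (smear_term a f b) y ->
  smear a f b = y.
Proof. by move=> sf; apply: bilateral_uniq; exact: smearP. Qed.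

Lemma smear_bound a f : smooth_on_circle f -> exists (k : nat) (C : R), 0 <= C /\
  forall b, rnorm (smear a f b) <= C * rnorm (iota (iter k energy b)).
Proof.
move=> sf; have [k [C [C0 h]]] := smear_sum a sf; exists k, C; split=> // b.
by have [y hy ny] := h b; rewrite (smear_uniq sf hy).
Qed.

Lemma smear_lin d a f : weight_vector X d a -> smooth_on_circle f -> linear (smear a f).
Proof.
move=> wa sf c u v; apply: smear_uniq => //.
apply: eq_bilateral (bilateral_lin c (smearP a u sf) (smearP a v sf)) => n.
rewrite /smear_term !(mode_homogeneous hV _ _ wa) (vop_lin hva) li scalerDr !scalerA.
by rewrite [c * _]mulrC.
Qed.

Definition smear_graph a f : set (H * H) := [set p | exists b, p = (iota b, smear a f b)].

Lemma smeared_graph a f : smooth_on_circle f ->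
  smeared X iota a f = closure (smear_graph a f).
Proof.
move=> sf; rewrite /smeared; congr closure; apply/seteqP; split => -[x y] /=.
  by move=> [b -> h]; exists b; rewrite (smear_uniq sf h).
by move=> [b [-> ->]]; exists b => //; exact: smearP.
Qed.

Lemma smear_graph_linear d a f : weight_vector X d a -> smooth_on_circle f ->
  linear_set (smear_graph a f).
Proof.
move=> wa sf; have l := smear_lin wa sf; split.
  by exists 0; rewrite (linear_0 li) (linear_0 l).
by move=> c _ _ [u ->] [v ->]; exists (c *: u + v); rewrite li l.
Qed.

Lemma smeared_linear d a f : weight_vector X d a -> smooth_on_circle f ->
  linear_set (smeared X iota a f).
Proof.
by move=> wa sf; rewrite smeared_graph //; apply: closure_linear_set; exact: smear_graph_linear wa sf.
Qed.

Lemma smeared_closed a f : closed (smeared X iota a f).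
Proof. exact: closed_closure. Qed.

Lemma smear_in a f b : smooth_on_circle f -> smeared X iota a f (iota b, smear a f b).
Proof. by move=> sf; rewrite smeared_graph //; apply: subset_closure; exists b. Qed.

(* Y(a,f) has the densely defined adjoint (-1)^d Y(theta a, conj f). *)
Lemma smeared_adjoint a f c : quasi_primary X a -> smooth_on_circle f ->
  exists z, forall x y, smeared X iota a f (x, y) -> ip (iota c) y = ip z x.
Proof.
move=> qa sf; have [d wa q1] := quasi_primary_weight hV qa.
have [a' [wa' qa' ha]] := mode_adjoint hV wa q1.
pose v n : H := ((-1) ^ d%:Z * ((fourier f n)^*)%C) *: iota (mode X a' (- n) c).
have [s [k [M [M0 hM]]]] := mode_bound a'.
have [D D0 hD] := fourier_decay (s + 2) sf.
pose r := rnorm (iota (iter k energy c)).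
have [|||z hz _] := @bilateral_weighted R H (fun n => complex.Re `|fourier f n|)
    v D (M * r) s _ _ hD.
- by rewrite mulr_ge0 // rnorm_ge0.
- by move=> n; exact: Re_norm_ge0.
- move=> n; rewrite /v rnormZ Re_normM normcJ.
  have -> : complex.Re `|(-1) ^ d%:Z : R[i]| = 1.
    by rewrite -exprnP normrX normrN1 expr1n.
  rewrite mul1r ler_wpM2l ?Re_norm_ge0 //.
  by have := hM (- n) c; rewrite abszN -/r [M * _]mulrC -mulrA.
exists z => x y; rewrite smeared_graph // => cl.
have gr b : ip (iota c) (smear a f b) = ip z (iota b).
  apply: (bilateral_ip hH (smearP a b sf) hz) => n.
  rewrite /smear_term /v (spZr sp) (spZl sp) !ipi ha opprK; set F := fourier f n.
  have -> : ((-1) ^ d%:Z * (F^*)%C)^*%C = ((-1) ^ d%:Z)^*%C * F by rewrite rmorphM; congr (_ * _); exact: conjcK.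
  have sg : ((-1 : R[i]) ^ d%:Z)^*%C = (-1) ^ d%:Z.
    by rewrite -exprnP rmorphXn rmorphN1.
  have sq : (-1 : R[i]) ^ d%:Z * (-1) ^ d%:Z = 1.
    by rewrite -exprnP -exprMn mulrNN mulr1 expr1n.
  by rewrite sg mulrACA sq mul1r.
apply: (@rnorm_small_eq R R[i]^o) => e e0.
pose K := rnorm (iota c) + rnorm z + 1.
have K0 : 0 < K by rewrite /K; have := rnorm_ge0 (iota c); have := rnorm_ge0 z; lra.
have eK : 0 < e / K by rewrite divr_gt0.
have [_ [b ->]] := (closure_rnormP _ _).1 cl _ eK.
rewrite rnorm_pair_lt /= => /andP[h1 h2].
have -> : ip (iota c) y - ip z x =
    ip z (iota b - x) - ip (iota c) (smear a f b - y).
  by rewrite !(spBr sp) gr; ring.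
apply: (le_lt_trans (@rnormD R R[i]^o _ _)); rewrite rnormN !rnorm_le_norm.
have k1 := ip_bound hH z (iota b - x).
have k2 := ip_bound hH (iota c) (smear a f b - y).
have l1 : rnorm z * rnorm (iota b - x) <= rnorm z * (e / K).
  by rewrite ler_wpM2l ?rnorm_ge0 // ltW.
have l2 : rnorm (iota c) * rnorm (smear a f b - y) <= rnorm (iota c) * (e / K).
  by rewrite ler_wpM2l ?rnorm_ge0 // ltW.
have l3 : K * (e / K) = e by rewrite mulrC divfK // lt0r_neq0.
have l4 : (rnorm (iota c) + rnorm z) * (e / K) = e - e / K.
  by rewrite -[X in X - _]l3 /K; ring.
by rewrite mulrDl in l4; lra.
Qed.

(** Closability: the second entry of a pair in the closed graph is determined by its products with
    the dense space [V], on which the adjoint is defined. *)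
Lemma smeared_single a f x y y' : quasi_primary X a -> smooth_on_circle f ->
  smeared X iota a f (x, y) -> smeared X iota a f (x, y') -> y = y'.
Proof.
move=> qa sf h h'; apply: dense_sep => c.
have [z hz] := smeared_adjoint c qa sf.
by rewrite (hz _ _ h) (hz _ _ h').
Qed.

Definition descendant (k : nat) a : V := (k`!)%:R^-1 *: iter k T a.

Lemma smear_vacuum (d : nat) a f : weight_vector X d%:Z a -> smooth_on_circle f ->
  series (fun k => fourier f (- (k + d)%N%:Z) *: iota (descendant k a)) @ \oo -->
    smear a f om.
Proof.
move=> wa sf; have := @bilateral_onesided R H d _ _ _ (smearP a om sf).
rewrite /smear_term => h.
have E : (fun k => fourier f (- (k + d)%N%:Z) *: iota (descendant k a)) =
   (fun k => fourier f (- (k + d)%N%:Z) *: iota (mode X a (- (k + d)%N%:Z) om)).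
  apply/funext => k; rewrite (mode_vacuum hV _ wa).
  have -> : - (k + d)%N%:Z + d%:Z = - k%:Z by rewrite PoszD; ring.
  by rewrite oppr_le0 /= abszN.
rewrite E; apply: h => n n0.
by rewrite (mode_vacuum hV _ wa) leNgt n0 /= (linear_0 li) scaler0.
Qed.

Lemma rnorm_vacuum : rnorm (iota om) = 1.
Proof.
have : sqform ip (iota om) = 1 by rewrite /sqform ipi (form_vacuum hV).
rewrite (sqform_rnorm hH) => /eqP; rewrite -{1}(expr1n R 2) eqrXn2 ?rnorm_ge0 //.
by move/eqP.
Qed.

Lemma energy_vacuum k : iter k energy om = om.
Proof.
elim: k => // k IH; rewrite iterS IH /energy.
by rewrite (virL_vacuum hV) // add0r.
Qed.

Lemma energy_descendant (d : nat) a k p : weight_vector X d%:Z a ->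
  iter p energy (descendant k a) = ((d + k).+1%:R ^+ p : R[i]) *: descendant k a.
Proof.
move=> wa; have wk : weight_vector X (d + k)%N%:Z (descendant k a).
  have := weight_lin hV (k`!%:R^-1) (weight_iterT hV k wa) (weight0 hV _).
  by rewrite addr0 PoszD.
have E v (c : R[i]) : energy (c *: v) = c *: energy v.
  by rewrite /energy (linear_Z (virL_lin hva _)) scalerDr.
elim: p => [|p IH]; first by rewrite expr0 scale1r.
rewrite iterS IH E /energy wk -{2}[descendant k a]scale1r -scalerDl scalerA.
by rewrite -pmulrn natr1 exprSr.
Qed.

Lemma nat_weight_bound (d k s : nat) : ((d + k).+1%:R : R) ^+ s <= d.+1%:R ^+ s * k.+1%:R ^+ s.
Proof.
rewrite -exprMn lerXn2r ?nnegrE ?mulr_ge0 // -natrM ler_nat; lia.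
Qed.

(** [descendant k a] is the mode [- (k + d)] of [a] on the vacuum, which [energy] fixes; the energy
    bound there is a pure power of the index. *)
Lemma descendant_bounded (d : nat) a : weight_vector X d%:Z a ->
  poly_bounded (fun k => iota (descendant k a)).
Proof.
move=> wa; have [s [k0 [M [M0 hM]]]] := mode_bound a.
exists (M * d.+1%:R ^+ s), s => k.
have := hM (- (k + d)%N%:Z) om; rewrite energy_vacuum rnorm_vacuum mulr1.
rewrite (mode_vacuum hV _ wa).
have -> : - (k + d)%N%:Z + d%:Z = - k%:Z by rewrite PoszD; ring.
rewrite oppr_le0 /= !abszN absz_nat => h; apply: le_trans h _.
by rewrite -mulrA ler_wpM2l // addnC nat_weight_bound.
Qed.

(** Descendants of [b] are eigenvectors of [energy] with eigenvalue [d + k + 1], so the energy norm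
    in [smear_bound] adds only a polynomial factor. *)
Lemma smear_descendant_bounded (d : nat) a f b : smooth_on_circle f ->
  weight_vector X d%:Z b -> poly_bounded (fun k => smear a f (descendant k b)).
Proof.
move=> sf wb; have [p [C [C0 hCb]]] := smear_bound a sf.
have [K [s hK]] := descendant_bounded wb.
exists (C * d.+1%:R ^+ p * K), (p + s)%N => k.
apply: le_trans (hCb _) _; rewrite (energy_descendant _ _ wb) (linear_Z li) rnormZ.
have -> : complex.Re `|(d + k).+1%:R ^+ p : R[i]| = (d + k).+1%:R ^+ p.
  by rewrite normrX normr_nat -[_.+1%:R](rmorph_nat (real_complex R)) -rmorphXn.
rewrite -!mulrA ler_wpM2l //.
apply: le_trans (_ : d.+1%:R ^+ p * k.+1%:R ^+ p * (K * k.+1%:R ^+ s) <= _).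
  by apply: ler_pM; rewrite ?exprn_ge0 ?rnorm_ge0 ?nat_weight_bound.
by rewrite exprD; lra.
Qed.

Lemma fourier_series_cvg f (w : nat -> H) (e : int) : smooth_on_circle f ->
  poly_bounded w -> exists y : H, series (fun k => fourier f (e - k%:Z) *: w k) @ \oo --> y.
Proof.
move=> sf [K [p hw]].
have K0 : 0 <= K by have := hw 0%N; rewrite expr1n mulr1; apply: le_trans; exact: rnorm_ge0.
have [D D0 hD] := fourier_decay (p + 2) sf.
pose L : R := (absz e).+1%:R ^+ (p + 2).
have L0 : 0 <= L by rewrite exprn_ge0.
have [||y hy _] := @series_rnorm_cvg R H (fun k => fourier f (e - k%:Z) *: w k)
  (fun k => (D * L * K) * k.+1%:R ^- 2) ((D * L * K) * 2).
- move=> k; rewrite rnormZ; set x := complex.Re _.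
  have x0 : 0 <= x by exact: Re_norm_ge0.
  have k1 : (0 : R) < k.+1%:R ^+ 2 by rewrite exprn_gt0 // ltr0n.
  rewrite ler_pdivlMr //.
  apply: le_trans (_ : x * (K * k.+1%:R ^+ p) * k.+1%:R ^+ 2 <= _).
    by rewrite ler_wpM2r ?(ltW k1) // ler_wpM2l.
  rewrite -!mulrA -exprD mulrCA [X in _ <= X](_ : _ = K * (D * L)); last by ring.
  rewrite ler_wpM2l //.
  apply: le_trans (_ : x * (L * (absz (e - k%:Z)).+1%:R ^+ (p + 2)) <= _).
    rewrite ler_wpM2l // /L -exprMn lerXn2r ?nnegrE ?mulr_ge0 //.
    by rewrite -natrM ler_nat; lia.
  by rewrite mulrCA mulrC; apply: ler_wpM2r => //; exact: hD.
- move=> n; rewrite seriesEnat /= -mulr_sumr ler_wpM2l ?mulr_ge0 //.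
  by have := series_inv_sq R n; rewrite seriesEnat.
by exists y.
Qed.

(** The vector [smear b g om] need not lie in the range of [iota]. The partial sums of its series
    do, and their images converge by polynomial growth, so the pair of limits lies in the closed
    graph. *)
Lemma smear_smear_vacuum (d d' : nat) a b f g : weight_vector X d%:Z a ->
  weight_vector X d'%:Z b -> smooth_on_circle f -> smooth_on_circle g ->
  exists2 y, smeared X iota a f (smear b g om, y) &
    series (fun k => fourier g (- (k + d')%N%:Z) *: smear a f (descendant k b)) @ \oo --> y.
Proof.
move=> wa wb sf sg.
have [y hy] := fourier_series_cvg (- d'%:Z) sg (smear_descendant_bounded a sf wb).
have E : (fun k : nat => fourier g (- d'%:Z - k%:Z) *: smear a f (descendant k b)) =
    (fun k => fourier g (- (k + d')%N%:Z) *: smear a f (descendant k b)).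
  by apply/funext => k; congr (fourier _ _ *: _); rewrite PoszD; ring.
rewrite E in hy; exists y => //.
have hx := smear_vacuum wb sg.
rewrite smeared_graph //; apply/closure_rnormP => e e0.
have [N1 h1] := (cvgn_rnormP _ _).1 hx _ e0.
have [N2 h2] := (cvgn_rnormP _ _).1 hy _ e0.
pose n := maxn N1 N2.
pose p := \sum_(0 <= k < n) fourier g (- (k + d')%N%:Z) *: descendant k b.
exists (iota p, smear a f p); first by exists p.
have l := smear_lin wa sf.
rewrite rnorm_pair_lt /=; apply/andP; split.
  have -> : iota p = series (fun k => fourier g (- (k + d')%N%:Z) *: iota (descendant k b)) n.
    by rewrite /p (linear_S li) seriesEnat /=; apply: eq_bigr => k _; rewrite (linear_Z li).
  by apply: h1; exact: leq_maxl.
have -> : smear a f p = series (fun k => fourier g (- (k + d')%N%:Z) *: smear a f (descendant k b)) n.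
  by rewrite /p (linear_S l) seriesEnat /=; apply: eq_bigr => k _; rewrite (linear_Z l).
by apply: h2; exact: leq_maxr.
Qed.

End Smeared.

(** * Comparison with the Fredenhagen-Joerss operators *)

Lemma eq_series_cvg (R : realType) (E : normedModType R[i]) (u v : nat -> E) (x : E) :
  u =1 v -> series u @ \oo --> x -> series v @ \oo --> x.
Proof. by move=> /funext ->. Qed.

Lemma closure_sub_closed (T : topologicalType) (A C : set T) :
  closed C -> A `<=` C -> closure A `<=` C.
Proof. by move=> cC sAC x clx; apply: cC; exact: closureS clx. Qed.

Section UnitaryGroups.
Variables (R : realType) (H : completeNormedModType R[i]) (ip : H -> H -> R[i]).
Hypothesis hH : hilbert ip.

Lemma unitary_rnorm (W : H -> H) x : unitary_op ip W -> rnorm (W x) = rnorm x.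
Proof.
move=> [_ h _]; apply/eqP; rewrite -(@eqrXn2 _ 2) ?rnorm_ge0 // -!(sqform_rnorm hH).
by rewrite /sqform h.
Qed.

(** By the group law the derivative of [W s x] vanishes at every [s], hence so does that of each
    matrix element, which is therefore constant. *)
Lemma generator_fixed (W : R -> H -> H) x : unitary_group ip W ->
  generator W (x, 0) -> forall t, W t x = x.
Proof.
move=> [hW W0 WD _] /cvg_rnormP /= gx t.
apply: (ip_sep hH) => z; rewrite (spC hH.1 z) (spC hH.1 z x); congr (_^*)%C.
have cd s : cder (fun s => ip z (W s x)) s 0.
  apply: has_derivative_cder.
  have d : @has_derivative R H (fun s => W s x) s 0.
    apply/cvg_rnormP => e e0; near=> h.
    have lW : linear (W s) by case: (hW s).
    have -> : (h^-1)%:C *: (W (s + h) x - W s x) - 0 =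
        W s ((h^-1)%:C *: (W (0 + h) x - W 0 x) - (0 +i* 1) *: 0).
      by rewrite scaler0 !subr0 (linZ _ _ lW) (linB _ _ lW) add0r W0 WD.
    by rewrite unitary_rnorm //; near: h; exact: gx.
  have l : (fun h => ip z ((h^-1)%:C *: (W (s + h) x - W s x)) : R[i]^o) @ 0^' -->
      (ip z 0 : R[i]^o) by apply: (ip_cvg hH).
  rewrite (sp0r hH.1) in l; rewrite /has_derivative.
  set G := (X in X @ _ --> _); suff -> : G = (fun h => ip z ((h^-1)%:C *: (W (s + h) x - W s x))) by [].
  by apply/funext => h; rewrite /G (spZr hH.1) (spBr hH.1).
rewrite -[in RHS](W0 x); move: (der0_const (fun s => (cd s).1) t 0) (der0_const (fun s => (cd s).2) t 0).
by case: (ip z (W t x)) => a b; case: (ip z (W 0 x)) => a' b' /= -> ->.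
Unshelve. all: by end_near. Qed.

End UnitaryGroups.

Lemma imaginary_half (R : realType) : (0 +i* 1 : R[i]) * ((0 +i* 1) / 2) = - 2^-1.
Proof.
rewrite mulrA -mulN1r; congr (_ * _).
by apply/eqP; rewrite eq_complex /=; apply/andP; split; apply/eqP; ring.
Qed.

(** * The Moebius generators of the net on V, and V = H^fin *)

Section NetOfVoa.
Variables (R : realType) (H : completeNormedModType R[i]) (ip : H -> H -> R[i]).
Variables (V : lmodType R[i]) (X : voa_data V) (form : V -> V -> R[i]) (iota : V -> H).
Variable N : net H.
Hypothesis hS : simple_unitary_strongly_local X ip iota form.
Hypothesis hN : net_of_voa X ip iota N.
Local Notation S1 := (@unit_circle R).
Local Notation om := (vacuum X).
Local Notation nu := (conformal_vector X).
Local Notation L := (virL X).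
Implicit Types (a b c v : V) (n : int) (f g : S1 -> R[i]).

Let hV : unitary_voa X form. Proof. by case: hS. Qed.
Let hC : hilbert_completion ip iota form. Proof. by case: hS. Qed.
Let heb : energy_bounded X form. Proof. by case: hS => _ _ _ []. Qed.
Let hH : hilbert ip. Proof. by case: hC. Qed.
Let sp : scalar_product ip := hH.1.
Let li : linear iota. Proof. by case: hC. Qed.
Let ipi u v : ip (iota u) (iota v) = form u v. Proof. by case: hC. Qed.
Let hq : scalar_product form. Proof. by case: hV. Qed.
Let hva : vertex_algebra X. Proof. by case: hV => -[]. Qed.
Let qnu : quasi_primary X nu. Proof. exact: quasi_primary_conformal hV. Qed.

Lemma mode_conformal n b : mode X nu n b = L n b.
Proof. by rewrite (mode_homogeneous hV _ _ (weight_conformal hV)) /virL; congr vop; ring. Qed.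

Lemma smear_one b : smear X iota nu (@one_field R) b = iota (L 0 b).
Proof.
apply: (smear_uniq hC heb); first exact: smooth_one.
have <- : \sum_(n <- [:: 0]) smear_term X iota nu (@one_field R) b n = iota (L 0 b).
  by rewrite big_seq1 /smear_term fourier_one eqxx scale1r mode_conformal.
apply: bilateral_finite => // n.
by rewrite inE /smear_term fourier_one => /negPf ->; rewrite scale0r.
Qed.

Lemma smear_cos b :
  smear X iota nu (@cos_field R) b = 2^-1 *: (iota (L 1 b) + iota (L (-1) b)).
Proof.
apply: (smear_uniq hC heb); first exact: smooth_cos_field.
have <- : \sum_(n <- [:: 1; -1]) smear_term X iota nu (@cos_field R) b n =
    2^-1 *: (iota (L 1 b) + iota (L (-1) b)).
  by rewrite big_cons big_seq1 /smear_term !fourier_cos /= !mode_conformal scalerDr.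
apply: bilateral_finite => // n.
by rewrite !inE /smear_term fourier_cos => /negPf ->; rewrite scale0r.
Qed.

Lemma smear_sin b : smear X iota nu (@sin_field R) b =
  ((0 +i* 1) / 2) *: (iota (L (-1) b) - iota (L 1 b)).
Proof.
apply: (smear_uniq hC heb); first exact: smooth_sin_field.
have <- : \sum_(n <- [:: -1; 1]) smear_term X iota nu (@sin_field R) b n =
    ((0 +i* 1) / 2) *: (iota (L (-1) b) - iota (L 1 b)).
  by rewrite big_cons big_seq1 /smear_term !fourier_sin !mode_conformal scaleNr scalerBr.
apply: bilateral_finite => // n.
rewrite !inE /smear_term fourier_sin negb_or => /andP[/negPf -> /negPf ->].
by rewrite scale0r.
Qed.

Lemma mobius_generator_smeared f : smooth_on_circle f -> (forall z, f z \is Num.real) ->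
  (exists phi, is_flow f phi) -> (forall phi, is_flow f phi -> forall t, mobius (phi t)) ->
  smear X iota nu f om = 0 ->
  mobius_generator N f = smeared X iota nu f.
Proof.
move=> sf rf [phi0 fl0] fm sv0.
case: hN => -[_ [_ [_ [_ [_ [_ [_ [_ [_ [fix_vac _]]]]]]]]]] _ _ vacE [U [_ [_ [_ [UN _]]]] hU].
have key phi : is_flow f phi -> generator (fun t => mobius_rep N (phi t)) =
    smeared X iota nu f.
  move=> fl; have [W [uW gW hW]] := hU f phi sf rf fl; rewrite -gW.
  have Wom t : W t (iota om) = iota om.
    by apply: (generator_fixed hH uW); rewrite gW -sv0; exact: (smear_in hC heb).
  suff -> : (fun t => mobius_rep N (phi t)) = W by [].
  (* The two unitaries differ by the phase [c] and both fix the vacuum, a vector of norm 1. *)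
  apply/funext => t; apply/funext => x; have [c c1 hc] := hW t.
  rewrite -(UN _ (fm _ fl t)) hc.
  have := hc (iota om); rewrite (UN _ (fm _ fl t)) -vacE fix_vac ?vacE; last exact: fm.
  rewrite Wom => e; suff -> : c = 1 by rewrite scale1r.
  apply/eqP; rewrite -subr_eq0; apply/eqP.
  have : (c - 1) *: iota om = 0 by rewrite scalerBl scale1r -e subrr.
  move/eqP; rewrite scaler_eq0 => /orP[/eqP //|/eqP o0].
  by have := rnorm_vacuum hV hC; rewrite o0 rnorm0 => /eqP; rewrite eq_sym oner_eq0.
apply/seteqP; split => p /=.
  by move=> [phi fl]; rewrite (key _ fl).
by move=> hp; exists phi0 => //; rewrite (key _ fl0).
Qed.

Lemma net_L0_smeared : net_L0 N = smeared X iota nu (@one_field R).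
Proof.
apply: mobius_generator_smeared.
- exact: smooth_one.
- by move=> z; rewrite /one_field real1.
- exact: rotation_flow.
- exact: rotation_flow_mobius.
- by rewrite smear_one (virL_vacuum hV) // (linear_0 li).
Qed.

Lemma real_complex_real (r : R) : (r%:C : R[i]) \is Num.real.
Proof. by rewrite complex_real. Qed.

Lemma cos_generator_smeared : mobius_generator N (@cos_field R) = smeared X iota nu (@cos_field R).
Proof.
apply: mobius_generator_smeared.
- exact: smooth_cos_field.
- by move=> z; rewrite /cos_field real_complex_real.
- exact: (@cos_flows R).1.
- exact: (@cos_flows R).2.
- by rewrite smear_cos !(virL_vacuum hV) // (linear_0 li) addr0 scaler0.
Qed.

Lemma sin_generator_smeared : mobius_generator N (@sin_field R) = smeared X iota nu (@sin_field R).
Proof.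
apply: mobius_generator_smeared.
- exact: smooth_sin_field.
- by move=> z; rewrite /sin_field real_complex_real.
- exact: (@sin_flows R).1.
- exact: (@sin_flows R).2.
- by rewrite smear_sin !(virL_vacuum hV) // (linear_0 li) subr0 scaler0.
Qed.

Lemma smeared_conformal_iota f b y : smooth_on_circle f ->
  smeared X iota nu f (iota b, y) <-> y = smear X iota nu f b.
Proof.
move=> sf; split => [h|->]; last exact: (smear_in hC heb).
exact: (smeared_single hV hC heb qnu sf h (smear_in hC heb sf)).
Qed.

Lemma net_L0_iota b y : net_L0 N (iota b, y) <-> y = iota (L 0 b).
Proof. by rewrite net_L0_smeared smeared_conformal_iota ?smear_one //; exact: smooth_one. Qed.

Lemma iota_Hfin b : Hfin N (iota b).
Proof.
have [s [w [hw ->]]] := decomposition hV b.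
exists (size s), (fun i => absz (nth 0 s i)), (fun i => iota (w (nth 0 s i))); split.
  move=> i; apply/net_L0_iota; set d := nth 0 s i.
  (* A zero component satisfies the eigenvector equation for every natural number; a nonzero one has
     nonnegative weight, which [absz] leaves unchanged. *)
  have [/eqP w0|w0] := boolP (w d == 0).
    by rewrite w0 (linear_0 (virL_lin hva _)) (linear_0 li) scaler0.
  rewrite (hw d) (linear_Z li); congr (_ *: _).
  by have := weight_ge0 hV (hw d) w0; case: (d).
by rewrite (linear_S li) (big_nth 0) big_mkord.
Qed.

(** The vector furnished by [smeared_adjoint] is identified by testing it against the dense space
    [V], where [L 0] is symmetric. *)
Lemma net_L0_symmetric c x y : net_L0 N (x, y) -> ip (iota c) y = ip (iota (L 0 c)) x.
Proof.
rewrite net_L0_smeared => h.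
have [z hz] := smeared_adjoint hV hC heb c qnu (@smooth_one R).
rewrite (hz _ _ h); congr ip; apply: (dense_sep hC) => b.
rewrite (spC sp) -(hz _ _ (smear_in hC heb (smooth_one R))) smear_one ipi.
by rewrite -(spC hq) ipi (virL_adjoint hV) oppr0.
Qed.

(** By symmetry an eigenvector of the closed generator with eigenvalue [m] is orthogonal to all
    weight spaces of other weights. It thus has the same products with [V] as its projection onto
    the finite-dimensional space of weight [m], and density gives equality. *)
Lemma eigenvector_iota (m : nat) x : net_L0 N (x, m%:R *: x) -> range iota x.
Proof.
move=> hx; have [k [e he]] := weight_span hV m%:Z.
pose W : set H := [set iota v | v in [set v | weight_vector X m%:Z v]].
have lW : linear_set W.
  split; first by exists 0; [exact: (weight0 hV) | exact: linear_0 li].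
  move=> c _ _ [u wu <-] [v wv <-]; exists (c *: u + v); last exact: li.
  exact: (weight_lin hV c wu wv).
have sW w : W w -> exists c : nat -> R[i], w = \sum_(i < k) c i *: iota (e i).
  move=> [v wv <-]; have [c ->] := he v wv; exists c.
  by rewrite (linear_S li); apply: eq_bigr => i _; rewrite (linear_Z li).
have [_ [v wv <-] hw] := @finite_projection R H ip sp (fun i => iota (e i)) k W lW sW x.
exists v => //; apply: (dense_sep hC) => c.
have [s [w [ww ->]]] := decomposition hV c.
rewrite !(linear_S li) !(spC sp _ (\sum_(i <- s) _)) !(sp_sumr sp); congr (_^*)%C.
apply: eq_bigr => d _; rewrite (spC sp (iota (w d)) x) (spC sp (iota (w d))); congr (_^*)%C.
have [e1|nd] := eqVneq d m%:Z.
  apply/esym/eqP; rewrite -subr_eq0 -(spBr sp); apply/eqP/hw.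
  by exists (w d) => //; rewrite -e1; exact: ww.
rewrite ipi (weight_orthogonal hV (ww d) wv nd).
have := net_L0_symmetric (w d) hx.
rewrite (ww d) (linear_Z li) (spZr sp) (spZl sp) => /eqP.
have -> : (d%:~R^*)%C = d%:~R :> R[i] by exact: rmorph_int.
rewrite -subr_eq0 -mulrBl mulf_eq0 => /orP[|/eqP //].
rewrite subr_eq0 -[m%:R]/((m%:Z)%:~R) eqr_int => /eqP e1.
by rewrite e1 eqxx in nd.
Qed.

Lemma range_Hfin : range iota = Hfin N.
Proof.
apply/seteqP; split => [_ [b _ <-]|v [k [m [x [hx ->]]]]]; first exact: iota_Hfin.
have hy i : exists b, iota b = x i by have [b _ hb] := eigenvector_iota (hx i); exists b.
have [b hb] := choice hy.
by exists (\sum_i b i) => //; rewrite (linear_S li); apply: eq_bigr.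
Qed.

(** The combination [cos - i sin] is the field [e^(-it)], whose only Fourier coefficient selects
    [L (-1)]. *)
Lemma smear_raising b : smear X iota nu (@cos_field R) b -
  (0 +i* 1) *: smear X iota nu (@sin_field R) b = iota (L (-1) b).
Proof.
rewrite smear_cos smear_sin scalerA imaginary_half scaleNr opprK -scalerDr.
rewrite [_ + (_ - _)]addrC addrA subrK -[X in _ *: (X + _)]scale1r.
by rewrite -[X in _ *: (_ + X)]scale1r -scalerDl scalerA mulVf ?scale1r // pnatr_eq0.
Qed.

Lemma smear_lowering b : smear X iota nu (@cos_field R) b +
  (0 +i* 1) *: smear X iota nu (@sin_field R) b = iota (L 1 b).
Proof.
rewrite smear_cos smear_sin scalerA imaginary_half scaleNr -scalerBr opprB.
rewrite [_ + (_ - _)]addrC [iota (L 1 b) + _]addrC addrA subrK -[X in _ *: (X + _)]scale1r.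
by rewrite -[X in _ *: (_ + X)]scale1r -scalerDl scalerA mulVf ?scale1r // pnatr_eq0.
Qed.

Lemma net_ladder b (u w : H) : (mobius_generator N (@cos_field R) (iota b, u) /\
  mobius_generator N (@sin_field R) (iota b, w)) <->
  u = smear X iota nu (@cos_field R) b /\ w = smear X iota nu (@sin_field R) b.
Proof.
rewrite cos_generator_smeared sin_generator_smeared.
by rewrite !smeared_conformal_iota //; [exact: smooth_sin_field|exact: smooth_cos_field].
Qed.

Lemma net_Lm1_iota b y : net_Lm1 N (iota b, y) <-> y = iota (L (-1) b).
Proof.
split=> [[_ [u [v [hu hv /= ->]]]]|->].
  by have [-> ->] := (net_ladder b u v).1 (conj hu hv); rewrite smear_raising.
split; first exact: iota_Hfin.
exists (smear X iota nu (@cos_field R) b), (smear X iota nu (@sin_field R) b).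
have [h1 h2] := (net_ladder b _ _).2 (conj erefl erefl).
by split; [exact: h1|exact: h2|exact/esym/smear_raising].
Qed.

Lemma net_L1_iota b y : net_L1 N (iota b, y) <-> y = iota (L 1 b).
Proof.
split=> [[_ [u [v [hu hv /= ->]]]]|->].
  by have [-> ->] := (net_ladder b u v).1 (conj hu hv); rewrite smear_lowering.
split; first exact: iota_Hfin.
exists (smear X iota nu (@cos_field R) b), (smear X iota nu (@sin_field R) b).
have [h1 h2] := (net_ladder b _ _).2 (conj erefl erefl).
by split; [exact: h1|exact: h2|exact/esym/smear_lowering].
Qed.

Lemma fj_vector_smear a f x : quasi_primary X a -> smooth_on_circle f ->
  fj_vector N (iota a) f x <-> x = smear X iota a f om.
Proof.
move=> qa sf.
have term (d k : nat) : fourier f (- (k + d)%N%:Z) *: iota (descendant X k a) =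
    (fourier f (- (k + d)%N%:Z) / (k`!)%:R) *: iota (iter k (L (-1)) a).
  by rewrite /descendant (linear_Z li) scalerA.
split=> [[d [w [w0 _ wa wS hx]]]|->].
  have wd : weight_vector X d%:Z a.
    apply: (iota_inj hV hC); move/net_L0_iota: w0 => <-.
    by rewrite (linear_Z li).
  have wE k : w k = iota (iter k (L (-1)) a).
    elim: k => [|k IH] //; have := wS k; rewrite IH => /net_Lm1_iota -> //.
  have := smear_vacuum hV hC heb wd sf; apply: cvg_rnorm_uniq.
  by apply: (eq_series_cvg _ hx) => k; rewrite wE term.
have [d wd a1] := quasi_primary_weight hV qa.
exists d, (fun k => iota (iter k (L (-1)) a)); split => //.
- by apply/net_L0_iota; rewrite wd (linear_Z li).
- by apply/net_L1_iota; rewrite a1 (linear_0 li).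
- by move=> k; apply/net_Lm1_iota.
by apply: (eq_series_cvg _ (smear_vacuum hV hC heb wd sf)) => k; rewrite term.
Qed.

Lemma fj_commutant_graph a f I : quasi_primary X a -> smooth_on_circle f ->
  fj_operator N I (iota a) f =
  commutant_graph (local_algebra N I) (iota om) (smear X iota a f om).
Proof.
move=> qa sf; case: hN => _ _ _ vacE _.
rewrite /fj_operator /commutant_graph; congr closure; apply/seteqP; split => p /=.
  by move=> [A [x [hA /(fj_vector_smear _ qa sf) -> ->]]]; exists A => //; rewrite vacE.
move=> [A hA ->]; exists A, (smear X iota a f om); split => //; last by rewrite vacE.
exact/(fj_vector_smear _ qa sf).
Qed.

(** * The two inclusions between the graphs *)

Section Inclusions.
Variables (a : V) (f : S1 -> R[i]) (I : set S1).
Hypotheses (qa : quasi_primary X a) (cI : circle_interval I) (tf : test_function I f).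

Let sf : smooth_on_circle f := tf.1.
Let wa : exists d : nat, weight_vector X d%:Z a.
Proof. by have [d ? _] := quasi_primary_weight hV qa; exists d. Qed.
Let algE : local_algebra N I = voa_algebra X ip iota I.
Proof. by case: hN => _ _ + _ _; apply. Qed.

Lemma fj_sub_smeared : fj_operator N I (iota a) f `<=` smeared X iota a f.
Proof.
rewrite fj_commutant_graph // /commutant_graph algE.
have [d wd] := wa.
have cl : closed (smeared X iota a f) by exact: smeared_closed.
apply: (closure_sub_closed cl) => _ [A hA ->].
have aff : affiliated (smeared X iota a f) (voa_algebra X ip iota I).
  apply: (affiliated_Wstar hH) => //; first by exists a, f.
  exact: (smeared_linear hV hC heb wd sf).
by apply: aff => //; exact: (smear_in hC heb).
Qed.

Lemma opposite_open : open (opposite I).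
Proof. exact: open_interior. Qed.

Lemma opposite_nonempty : opposite I !=set0.
Proof.
case: cI => _ _ _ nd; apply: contrapT => h0; apply: nd => O [x Ox] oO.
apply: contrapT => h1; apply: h0; exists x.
have sO : O `<=` ~` I by move=> y Oy Iy; apply: h1; exists y.
by apply: filterS sO _; exact: open_nbhs_nbhs.
Qed.

Lemma smeared_sub_fj : smeared X iota a f `<=` fj_operator N I (iota a) f.
Proof.
have [d wd] := wa.
have vN : von_neumann ip (local_algebra N I) by case: hN => -[+ _] _ _ _ _; apply.
have clF : closed (fj_operator N I (iota a) f) by exact: closed_closure.
have lF : linear_set (fj_operator N I (iota a) f).
  rewrite fj_commutant_graph //; apply: closure_linear_set; apply: commutant_linear_set.
  by case: vN.
rewrite (smeared_graph hC heb _ sf); apply: (closure_sub_closed clF) => _ [b ->].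
apply: (orthogonal_mem hH lF clF) => -[xi eta] orth.
have lsm := smear_lin hV hC heb wd sf.
pose ell v := ip xi (iota v) + ip eta (smear X iota a f v).
have ellE (k : R[i]) u v : ell (k *: u + v) = k * ell u + ell v.
  by rewrite /ell li lsm !(spDr sp) !(spZr sp); ring.
have ell0 : ell 0 = 0 by rewrite /ell (linear_0 li) (linear_0 lsm) !(sp0r sp) addr0.
have ellZ k v : ell (k *: v) = k * ell v by rewrite -[_ *: _]addr0 ellE ell0 addr0.
rewrite -/(ell b); apply: (descendants_span hV (P := fun v => ell v = 0)) => //.
  by move=> k u v hu hv; rewrite ellE hu hv mulr0 addr0.
move=> k e b' wb' qb'.
have qb : quasi_primary X b' by exists e.
have {e wb' qb'} [e wb' _] := quasi_primary_weight hV qb.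
(* Divided powers of [L (-1)] are the vectors that occur in [smear_vacuum]; the factorial is
   invertible. *)
suff h j : ell (descendant X j b') = 0.
  have := h k; rewrite /descendant ellZ => /eqP; rewrite mulf_eq0 invr_eq0 pnatr_eq0.
  by rewrite -leqn0 leqNgt fact_gt0 /= => /eqP.
have [K [p hK]] : poly_bounded (fun j => ell (descendant X j b') : R[i]^o).
  have := poly_boundedD 1 1
    (poly_bounded_ip xi hH (descendant_bounded hV hC heb wb'))
    (poly_bounded_ip eta hH (smear_descendant_bounded hV hC heb a sf wb')).
  by congr poly_bounded; apply/funext => i; rewrite !scale1r.
apply: (test_extract (e := - e%:Z) opposite_open opposite_nonempty hK).
move=> g tg; have sg := tg.1.
pose T := smeared X iota b' g.
have lT : linear_set T by exact: (smeared_linear hV hC heb wb' sg).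
have inv B : local_algebra N I B -> diag_invariant T B.
  rewrite algE => hB.
  have hB' : commutant (voa_algebra X ip iota (opposite I)) B.
    by case: hS => _ _ _ [_ /(_ I cI)]; apply.
  have aff : affiliated T (voa_algebra X ip iota (opposite I)).
    apply: (affiliated_Wstar hH) => //; first by exists b', g.
    exact: smeared_closed.
  by move=> x y; exact: aff.
(* [v] and [y] are the two orders of the product, [Y(b',g) Y(a,f) Omega] and [Y(a,f) Y(b',g) Omega].
   Both exist by closedness; that they agree is not assumed but derived. *)
have [v hv _] := smear_smear_vacuum hV hC heb wb' wd sg sf.
have [y hy ly] := smear_smear_vacuum hV hC heb wd wb' sf sg.
have hu : smeared X iota b' g (iota om, smear X iota b' g om) by exact: (smear_in hC heb).
have inF := commutant_graph_invariant hH vN lT inv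
  (fun z y y' => smeared_single hV hC heb qb sg (y':=y')) hu hv.
have vy : v = y.
  apply: (smeared_single hV hC heb qa sf _ hy); apply: fj_sub_smeared.
  by rewrite fj_commutant_graph.
rewrite vy -fj_commutant_graph // in inF.
have lx := smear_vacuum hV hC heb wb' sg.
have z0 : ip xi (smear X iota b' g om) + ip eta y = 0.
  exact: (orth _ inF).
rewrite -z0.
set Fs := series _; have -> : Fs = fun m =>
    ip xi (series (fun i => fourier g (- (i + e)%N%:Z) *: iota (descendant X i b')) m) +
    ip eta (series (fun i => fourier g (- (i + e)%N%:Z) *: smear X iota a f (descendant X i b')) m).
  apply/funext => m; rewrite /Fs.
  rewrite !seriesEnat /= !(sp_sumr sp) -big_split /=; apply: eq_bigr => i _.
  have -> : - e%:Z - i%:Z = - (i + e)%N%:Z by rewrite PoszD; ring.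
  by rewrite !(spZr sp) -mulrDr.
by apply: (@cvgD _ R[i]^o); apply: (ip_cvg hH).
Qed.

Lemma fj_operator_smeared : fj_operator N I (iota a) f = smeared X iota a f.
Proof. by apply/seteqP; split; [exact: fj_sub_smeared | exact: smeared_sub_fj]. Qed.

End Inclusions.

End NetOfVoa.

(** * Reconstruction of the vertex operator algebra *)

Section HalfCircle.
Variable R : realType.
Local Notation S1 := (@unit_circle R).

Lemma Re_norm_real (x : R) : complex.Re `|x%:C| = `|x|.
Proof. by rewrite normc_def /= expr0n addr0 sqrtr_sqr. Qed.

Lemma cis_continuous : continuous (fun t : R => cis t : R[i]^o).
Proof.
move=> t; apply/cvg_rnormP => e e0; have e2 : 0 < e / 2 by rewrite divr_gt0.
near=> s.
have -> : cis s - cis t = (cos s - cos t)%:C + 'i%C * (sin s - sin t)%:C :> R[i].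
  by rewrite /cis; apply/eqP; rewrite eq_complex /=; apply/andP; split; apply/eqP; ring.
apply: (le_lt_trans (@rnormD R R[i]^o _ _)).
rewrite !rnorm_le_norm Re_normM !Re_norm_real.
have -> : complex.Re `|'i%C : R[i]| = 1 by rewrite normc_def /= expr0n expr1n add0r sqrtr1.
rewrite mul1r [e]splitr; apply: ltrD; rewrite distrC; near: s.
  exact: (cvgrPdist_lt _ _).1 (@continuous_cos R t) _ e2.
exact: (cvgrPdist_lt _ _).1 (@continuous_sin R t) _ e2.
Unshelve. all: by end_near. Qed.

Lemma expi_continuous : continuous (@expi R).
Proof. by apply: continuous_comp_initial; exact: cis_continuous. Qed.

Lemma half_circle_open (k : R) : open [set z : S1 | 0 < k * complex.Re (circle_val z)].
Proof.
have -> : [set z : S1 | 0 < k * complex.Re (circle_val z)] =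
   @circle_val R @^-1` [set w : R[i]^o | 0 < k * complex.Re w] by [].
apply: open_comp; first by move=> z _; exact: circle_val_continuous.
rewrite openE => w /= w0; rewrite /interior.
have k0 : 0 < `|k| by rewrite normr_gt0; apply: contraTneq w0 => ->; rewrite mul0r ltxx.
have e0 : 0 < k * complex.Re w / `|k| by rewrite divr_gt0.
near=> z => /=.
have : rnorm (z - w : R[i]^o) < k * complex.Re w / `|k|.
  by near: z; exact: (cvg_rnormP _ _).1 cvg_id _ e0.
rewrite ltr_pdivlMr // => h.
have r : `|complex.Re z - complex.Re w| <= rnorm (z - w : R[i]^o).
  by have := normc_ge_Re (z - w); rewrite raddfB rnorm_le_norm normc_def lecR.
have : `|k * complex.Re z - k * complex.Re w| < k * complex.Re w.
  by rewrite -mulrBr normrM mulrC; apply: le_lt_trans h; rewrite ler_wpM2r.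
by rewrite ltr_distl subrr => /andP[].
Unshelve. all: by end_near. Qed.

(** Reconstruction needs one interval on which the operators of two algebras can be compared. The
    right half-circle serves; it is the image of an open interval of angles, hence connected. *)
Lemma circle_interval_exists : exists I : set S1, circle_interval I.
Proof.
exists [set z : S1 | 0 < 1 * complex.Re (circle_val z)]; split.
- exact: half_circle_open.
- have -> : [set z : S1 | 0 < 1 * complex.Re (circle_val z)] =
      @expi R @` [set` `]-(pi / 2), pi / 2[].
    apply/seteqP; split => z /=; last first.
      move=> [t]; rewrite in_itv /= => ht <-; rewrite circle_valE mul1r.
      exact: cos_gt0_pihalf.
    rewrite mul1r; have := circle_norm z; have := @circle_val_inj R z.
    case: (circle_val z) => x y /= inj nz x0.
    have xy : x ^+ 2 + y ^+ 2 = 1.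
      move: nz; rewrite normc_def /= => -[h].
      by rewrite -[LHS]sqr_sqrtr ?addr_ge0 ?sqr_ge0 // h expr1n.
    have y1 : `|y| < 1.
      rewrite -(ltr_pXn2r (n := 2)) ?nnegrE // real_normK ?num_real // expr1n -xy.
      by rewrite ltrDr exprn_gt0.
    have /andP[yl yr] : -1 < y < 1 by rewrite -ltr_norml.
    have yI : -1 <= y <= 1 by rewrite !ltW.
    exists (asin y).
      by rewrite in_itv /= asin_gtNpi2 ?asin_ltpi2 // ?yl ?(ltW yl) ?(ltW yr).
    apply/esym/inj; rewrite circle_valE /cis cos_asin // asinK ?in_itv //=.
    by rewrite -xy addrK sqrtr_sqr gtr0_norm.
  apply: connected_continuous_connected.
    exact/connected_intervalP/interval_is_interval.
  by apply: continuous_subspaceT; exact: expi_continuous.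
- by exists (expi 0); rewrite /mkset circle_valE /= cos0 mul1r.
- move=> /(_ [set z : S1 | 0 < -1 * complex.Re (circle_val z)]).
  case; [|exact: half_circle_open |].
    by exists (expi pi); rewrite /mkset circle_valE /= cospi mulrNN mulr1.
  by move=> z /= [h1 h2]; lra.
Qed.

End HalfCircle.

(** * Recovering modes from smeared operators *)

Section BilateralExtraction.
Variables (R : realType) (H : completeNormedModType R[i]) (ip : H -> H -> R[i]).
Hypothesis hH : hilbert ip.
Local Notation S1 := (@unit_circle R).
Implicit Types (u : int -> H) (x y z : H).

Lemma series_tail (w : nat -> H) x : series w @ \oo --> x ->
  series (fun k => w k.+1) @ \oo --> x - w 0%N.
Proof.
move=> /cvgn_rnormP h; apply/cvgn_rnormP => e /h [M hM]; exists M => n Mn.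
have := hM n.+1 (leqW Mn); rewrite !seriesEnat /= big_nat_recl //.
by rewrite opprB addrCA addrA.
Qed.

Lemma series_cons (w : nat -> H) x c : series w @ \oo --> x ->
  series (fun k => if k is k'.+1 then w k' else c) @ \oo --> c + x.
Proof.
move=> /cvgn_rnormP h; apply/cvgn_rnormP => e /h [M hM]; exists M.+1 => -[//|n] Mn.
have := hM n Mn; rewrite !seriesEnat /= big_nat_recl //.
by rewrite opprD addrACA subrr add0r.
Qed.

Lemma bilateral_shift u x (K : nat) : bilateral_sum u x ->
  bilateral_sum (fun n => u (n + K%:Z)) x.
Proof.
elim: K u => [|K IH] u; first by apply: eq_bilateral => n; rewrite addr0.
move=> hu; have : bilateral_sum (fun n => u (n + 1)) x.
  move: hu => [xp [xn [h1 h2 ->]]].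
  exists (xp - u 0), (u 0 + xn); split; last by rewrite addrA subrK.
    apply: (eq_series_cvg _ (series_tail h1)) => k.
    by congr u; lia.
  have h3 := series_cons (c := u 0) h2.
  by apply: eq_series_cvg h3 => -[|k]; congr u; lia.
by move=> /IH; apply: eq_bilateral => n; congr u; lia.
Qed.

(** Translating the index by [K] leaves no positive terms, so the sum becomes one-sided; pairing
    with an arbitrary [z] reduces the claim to [test_extract]. *)
Lemma bilateral_extract (J : set S1) u (K : nat) : open J -> J !=set0 ->
  (forall n, K%:Z < n -> u n = 0) ->
  poly_bounded (fun k => u (K%:Z - k%:Z)) ->
  (forall g, test_function J g -> bilateral_sum (fun n => fourier g n *: u n) 0) ->
  forall n, u n = 0.
Proof.
move=> oJ J0 uK pb hu.
have key k : u (K%:Z - k%:Z) = 0.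
  apply: (ip_sep hH) => z; rewrite (spC hH.1 z) (spC hH.1 z 0) (sp0r hH.1); congr (_^*)%C.
  have [K' [p hp]] := poly_bounded_ip z hH pb.
  apply: (@test_extract R J (fun k => ip z (u (K%:Z - k%:Z))) K' p K%:Z) => // g tg.
  have /(@bilateral_onesided R H 0) := bilateral_shift K (hu g tg) => h.
  have {}h : series (fun k => fourier g (K%:Z - k%:Z) *: u (K%:Z - k%:Z)) @ \oo --> (0 : H).
    apply: (eq_series_cvg _ (h _)) => [k'|n n0]; last by rewrite uK ?scaler0 //; lia.
    by congr (fourier _ _ *: u _); rewrite addn0 addrC.
  have -> : series (fun k => fourier g (K%:Z - k%:Z) * ip z (u (K%:Z - k%:Z))) =
      (fun n => ip z (series (fun k => fourier g (K%:Z - k%:Z) *: u (K%:Z - k%:Z)) n)).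
    apply/funext => n; rewrite !seriesEnat /= (sp_sumr hH.1).
    by apply: eq_bigr => i _; rewrite (spZr hH.1).
  by rewrite -(sp0r hH.1 z); apply: (ip_cvg hH).
move=> n; have [nK|nK] := ltP K%:Z n; first exact: uK.
have := key (absz (K%:Z - n)); congr (u _ = 0); lia.
Qed.

End BilateralExtraction.

(** * Comparison of two vertex operator algebras with the same net *)

Section Uniqueness.
Variables (R : realType) (H : completeNormedModType R[i]) (ip : H -> H -> R[i]).
Variable N : net H.
Variables (V1 V2 : lmodType R[i]) (X1 : voa_data V1) (X2 : voa_data V2).
Variables (form1 : V1 -> V1 -> R[i]) (form2 : V2 -> V2 -> R[i]).
Variables (iota1 : V1 -> H) (iota2 : V2 -> H).
Hypotheses (hS1 : simple_unitary_strongly_local X1 ip iota1 form1)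
  (hN1 : net_of_voa X1 ip iota1 N)
  (hS2 : simple_unitary_strongly_local X2 ip iota2 form2)
  (hN2 : net_of_voa X2 ip iota2 N).
Variable phi : V1 -> V2.
Hypothesis phiE : forall a, iota2 (phi a) = iota1 a.
Local Notation S1 := (@unit_circle R).

Let hV1 : unitary_voa X1 form1. Proof. by case: hS1. Qed.
Let hV2 : unitary_voa X2 form2. Proof. by case: hS2. Qed.
Let hC1 : hilbert_completion ip iota1 form1. Proof. by case: hS1. Qed.
Let hC2 : hilbert_completion ip iota2 form2. Proof. by case: hS2. Qed.
Let heb1 : energy_bounded X1 form1. Proof. by case: hS1 => _ _ _ []. Qed.
Let heb2 : energy_bounded X2 form2. Proof. by case: hS2 => _ _ _ []. Qed.
Let hH : hilbert ip. Proof. by case: hC1. Qed.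
Let li1 : linear iota1. Proof. by case: hC1. Qed.
Let li2 : linear iota2. Proof. by case: hC2. Qed.
Let hva1 : vertex_algebra X1. Proof. by case: hV1 => -[]. Qed.
Let hva2 : vertex_algebra X2. Proof. by case: hV2 => -[]. Qed.
Let inj2 : injective iota2 := iota_inj hV2 hC2.

Lemma transfer_linear : linear phi.
Proof. by move=> c u v; apply: inj2; rewrite phiE li1 li2 !phiE. Qed.

(** Both images are [Hfin N], which refers to neither algebra. *)
Lemma transfer_surjective b : exists a, phi a = b.
Proof.
have [a _ ha] : range iota1 (iota2 b).
  by rewrite (range_Hfin hS1 hN1) -(range_Hfin hS2 hN2); exists b.
by exists a; apply: inj2; rewrite phiE.
Qed.

Lemma transfer_injective : injective phi.
Proof.
move=> u v e; apply: (iota_inj hV1 hC1).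
by rewrite -!phiE e.
Qed.

Lemma transfer_vacuum : phi (vacuum X1) = vacuum X2.
Proof.
apply: inj2; rewrite phiE; case: hN1 => _ _ _ <- _; by case: hN2.
Qed.

(** Both operators are restrictions of one generator of the net, which is single-valued on the image
    of [iota2]. *)
Lemma transfer_L0 a : phi (virL X1 0 a) = virL X2 0 (phi a).
Proof.
apply: inj2; apply/(net_L0_iota hS2 hN2); rewrite !phiE.
exact/(net_L0_iota hS1 hN1).
Qed.

Lemma transfer_L1 a : phi (virL X1 1 a) = virL X2 1 (phi a).
Proof.
apply: inj2; apply/(net_L1_iota hS2 hN2); rewrite !phiE.
exact/(net_L1_iota hS1 hN1).
Qed.

Lemma transfer_translation a : phi (virL X1 (-1) a) = virL X2 (-1) (phi a).
Proof.
apply: inj2; apply/(net_Lm1_iota hS2 hN2); rewrite !phiE.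
exact/(net_Lm1_iota hS1 hN1).
Qed.

Lemma transfer_iterT k a : phi (iter k (virL X1 (-1)) a) = iter k (virL X2 (-1)) (phi a).
Proof. by elim: k => // k IH; rewrite !iterS transfer_translation IH. Qed.

Lemma transfer_weight d a : weight_vector X1 d a -> weight_vector X2 d (phi a).
Proof. by rewrite /weight_vector -transfer_L0 => ->; rewrite (linear_Z transfer_linear). Qed.

Lemma transfer_mode d a n b : weight_vector X1 d a -> virL X1 1 a = 0 ->
  phi (vop X1 a n b) = vop X2 (phi a) n (phi b).
Proof.
move=> wa a1; have qa : quasi_primary X1 a by exists d.
have wa2 := transfer_weight wa.
have qa2 : quasi_primary X2 (phi a).
  by exists d => //; rewrite -transfer_L1 a1 (linear_0 transfer_linear).
apply: inj2; rewrite phiE; apply/eqP; rewrite -subr_eq0; apply/eqP.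
pose u m := iota1 (mode X1 a m b) - iota2 (mode X2 (phi a) m (phi b)).
suff u0 m : u m = 0.
  have := u0 (n - d + 1); rewrite /u (mode_homogeneous hV1 _ _ wa) (mode_homogeneous hV2 _ _ wa2).
  by have -> : n - d + 1 + d - 1 = n by ring.
have [I cI] := circle_interval_exists R.
have [M1 v1] := vop_vanish hva1 a b.
have [M2 v2] := vop_vanish hva2 (phi a) (phi b).
case: (cI) => oI _ I0 _.
(* Beyond this index, chosen with room for the weight [d], both modes vanish on the fixed vectors
   [b] and [phi b]. *)
apply: (bilateral_extract hH (J := I) (K := (absz M1 + absz M2 + absz d + 1)%N)) => //.
- move=> {}m hm; rewrite /u (mode_homogeneous hV1 _ _ wa) (mode_homogeneous hV2 _ _ wa2).
  by rewrite v1 ?v2 ?(linear_0 li1) ?(linear_0 li2) ?subrr //; lia.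
- set K := (_ + _)%N.
  have -> : (fun k : nat => u (K%:Z - k%:Z)) = (fun k => 1 *: iota1 (mode X1 a (K%:Z - k%:Z) b) +
      (-1) *: iota2 (mode X2 (phi a) (K%:Z - k%:Z) (phi b))).
    by apply/funext => k; rewrite scale1r scaleN1r.
  have pb (M r : R) (s : nat) (w : int -> H) : 0 <= M -> 0 <= r ->
      (forall n, rnorm (w n) <= M * (absz n).+1%:R ^+ s * r) ->
      poly_bounded (fun k => w (K%:Z - k%:Z)).
    move=> M0 r0 hw; exists (M * K.+1%:R ^+ s * r), s => k; apply: (le_trans (hw _)).
    have -> : M * K.+1%:R ^+ s * r * k.+1%:R ^+ s = M * (K.+1%:R ^+ s * k.+1%:R ^+ s) * r by ring.
    rewrite ler_wpM2r // ler_wpM2l // -exprMn.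
    by rewrite lerXn2r ?nnegrE ?mulr_ge0 // -natrM ler_nat; lia.
  have [s1 [k1 [C1 [C10 h1]]]] := mode_bound hC1 heb1 a.
  have [s2 [k2 [C2 [C20 h2]]]] := mode_bound hC2 heb2 (phi a).
  by apply: poly_boundedD; [apply: pb (fun n => h1 n b) | apply: pb (fun n => h2 n (phi b))];
    rewrite ?rnorm_ge0.
- move=> g tg; have sg := tg.1.
  (* Both vectors are values at [iota1 b] of a single operator, since the Fredenhagen-Joerss
     operator is built from [N], [I], [g] and the vector [iota1 a] alone. *)
  have e : smear X1 iota1 a g b = smear X2 iota2 (phi a) g (phi b).
    apply: (smeared_single hV2 hC2 heb2 qa2 sg (x := iota1 b)).
      rewrite -(fj_operator_smeared hS2 hN2 qa2 cI tg) phiE.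
      rewrite (fj_operator_smeared hS1 hN1 qa cI tg); exact: (smear_in hC1 heb1).
    by rewrite -phiE; exact: (smear_in hC2 heb2).
  have := bilateral_lin (-1) (smearP hC2 heb2 (phi a) (phi b) sg) (smearP hC1 heb1 a b sg).
  rewrite e scaleN1r addNr; apply: eq_bilateral => k.
  by rewrite /u /smear_term scalerBr scaleN1r addrC.
Qed.

Lemma transfer_vop_vacuum a n :
  phi (vop X1 a n (vacuum X1)) = vop X2 (phi a) n (vacuum X2).
Proof.
have [n0|n0] := leP 0 n.
  by rewrite !(vop_annihilation hva1, vop_annihilation hva2) // (linear_0 transfer_linear).
have -> : n = - (absz (n + 1))%:Z - 1 by lia.
by rewrite !(vop_translation_vacuum hva1, vop_translation_vacuum hva2)
  (linear_Z transfer_linear) transfer_iterT.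
Qed.

(** Induction on the second argument along descendants. For quasi-primary [b], [vop_swap] rewrites
    the mode of [a] through modes of [b], covered by [transfer_mode], on vectors covered by
    [transfer_vop_vacuum]; the commutator with [L_(-1)] then passes from each iterate of [b] to the
    next. *)
Lemma transfer_vop a n b : phi (vop X1 a n b) = vop X2 (phi a) n (phi b).
Proof.
have lphi := transfer_linear; elim/(descendants_span hV1): b a n => //.
- move=> a n; rewrite (linear_0 (vop_lin hva1 a n)) (linear_0 lphi).
  by rewrite (linear_0 (vop_lin hva2 _ n)).
- move=> c u v hu hv a n.
  by rewrite (vop_lin hva1) !lphi hu hv (vop_lin hva2).
move=> k d b wb b1; elim: k => [|k IH] a n.
  rewrite /=; have [K1 s1] := vop_swap hva1 a b; have [K2 s2] := vop_swap hva2 (phi a) (phi b).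
  (* A common order of locality gives finite sums of the same shape on both sides. *)
  pose K := maxn K1 K2; have -> : n = (n - K%:Z) + K%:Z by ring.
  rewrite s1 ?leq_maxl // s2 ?leq_maxr // (linear_S lphi).
  apply: eq_bigr => j _; rewrite (linear_Z lphi) (transfer_mode _ _ wb b1).
  by rewrite transfer_vop_vacuum.
set c := iter k (virL X1 (-1)) b in IH *; rewrite iterS -/c.
have t1 : phi (virL X1 (-1) (vop X1 a n c)) = phi (vop X1 a n (virL X1 (-1) c)) +
    (- n)%:~R *: vop X2 (phi a) (n - 1) (phi c).
  by rewrite (translation_vop hva1) (linear_D lphi) (linear_Z lphi) IH.
move: t1; rewrite transfer_translation IH (translation_vop hva2) => /addIr <-.
by rewrite transfer_translation.
Qed.

(* For w = phi nu1 - nu2 the modes w_(0), w_(1), w_(2) vanish, so by weights the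
   terms of nu2_(0) w given by locality vanish too; thus L_{-1} w = 0, whereas
   |L_{-1} w|^2 = 4 |w|^2. *)
Lemma transfer_conformal : phi (conformal_vector X1) = conformal_vector X2.
Proof.
have lphi := transfer_linear.
set nu1 := conformal_vector X1; set nu2 := conformal_vector X2.
pose w := phi nu1 - nu2.
have wE n c : vop X2 w n (phi c) = phi (virL X1 (n - 1) c) - virL X2 (n - 1) (phi c).
  rewrite /w (linear_B (vop_linl hva2 n _)) -transfer_vop /virL.
  by have -> : n - 1 + 1 = n by ring.
have w012 n c : 0 <= n <= 2 -> vop X2 w n c = 0.
  move=> /andP[n0 n2]; have [b <-] := transfer_surjective c; rewrite wE.
  have [->|[->|->]] : n = 0 \/ n = 1 \/ n = 2 by lia.
  - by rewrite sub0r transfer_translation subrr.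
  - by rewrite subrr transfer_L0 subrr.
  - have -> : 2 - 1 = 1 :> int by [].
    by rewrite transfer_L1 subrr.
have ww : weight_vector X2 2 w.
  by apply: (weight_B hV2); [apply: transfer_weight; exact: (weight_conformal hV1)|exact: (weight_conformal hV2)].
have w1 : virL X2 1 w = 0.
  rewrite (linear_B (virL_lin hva2 1)) -transfer_L1 (virL1_conformal hV1).
  by rewrite (virL1_conformal hV2) (linear_0 lphi) subrr.
have wwt n d c : weight_vector X2 d c -> weight_vector X2 (d + 1 - n) (vop X2 w n c).
  have [b <-] := transfer_surjective c => wc.
  have wb : weight_vector X1 d b.
    apply: transfer_injective; rewrite transfer_L0 wc (linear_Z lphi) //.
  rewrite wE; have -> : d + 1 - n = d - (n - 1) by ring.
  by apply: (weight_B hV2); [apply: transfer_weight; exact: (weight_virL hV1)|exact: (weight_virL hV2)].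
have step n c : vop X2 w n (virL X2 (-1) c) =
    virL X2 (-1) (vop X2 w n c) + n%:~R *: vop X2 w (n - 1) c.
  by rewrite (translation_vop hva2) mulrNz scaleNr subrK.
have wT (p : nat) n : 0 <= n <= p%:Z + 2 -> vop X2 w n (iter p (virL X2 (-1)) nu2) = 0.
  elim: p n => [|p IH] n /andP[n0 np]; first by rewrite w012 // n0.
  rewrite iterS step.
  have -> : n%:~R *: vop X2 w (n - 1) (iter p (virL X2 (-1)) nu2) = 0.
    have [->|n1] := eqVneq n 0; first by rewrite scale0r.
    by rewrite IH ?scaler0 //; lia.
  rewrite addr0; have [n2|n2] := leP n (p%:Z + 2).
    by rewrite IH ?n0 // (linear_0 (virL_lin hva2 _)).
  (* The new index [p + 3] is outside the induction hypothesis; there the vector has weight 0, and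
     [L_(-1)] annihilates weight 0. *)
  apply: (translation_weight0 hV2).
  have := wwt n _ _ (weight_iterT hV2 p (weight_conformal hV2)).
  by have -> : 2 + p%:Z + 1 - n = 0 by lia.
have Tw : virL X2 (-1) w = 0.
  have [K hK] := vop_swap hva2 nu2 w.
  (* With [m = - K] the left side is the mode 0 of [nu2] on [w], that is [L_(-1) w]. *)
  have := hK K (leqnn K) (- K%:Z); rewrite addNr => E.
  rewrite /virL -/nu2 addNr E big1 // => -[j /= jK] _.
  have -> : - K%:Z + (K - j)%N%:Z = - j%:Z by lia.
  case: j jK => [|p] jK.
    by rewrite oppr0 (vop_annihilation hva2) // (linear_0 (vop_lin hva2 _ _)) scaler0.
  have -> : - p.+1%:Z = - p%:Z - 1 by lia.
  rewrite (vop_translation_vacuum hva2) (linear_Z (vop_lin hva2 _ _)).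
  have -> : p.+1%:Z - 1 = p by lia.
  by rewrite wT ?scaler0 //; lia.
have hq2 : scalar_product form2 by case: hV2.
apply/eqP; rewrite -subr_eq0 -/w; apply/eqP/(sp_eq0 hq2).
have := sqform_translation hV2 ww w1; rewrite Tw (sp0r hq2) => /esym/eqP.
by rewrite mulf_eq0 -natrM pnatr_eq0 => /eqP.
Qed.

End Uniqueness.

Theorem theorem9p2 (R : realType) (H : completeNormedModType R[i])
    (ip : H -> H -> R[i]) (N : net H) :
  (forall (V : lmodType R[i]) (X : voa_data V) (form : V -> V -> R[i])
      (iota : V -> H),
    simple_unitary_strongly_local X ip iota form -> net_of_voa X ip iota N ->
    range iota = Hfin N /\
    forall a : V, quasi_primary X a ->
    forall (I : set (@unit_circle R)) (f : @unit_circle R -> R[i]),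
      circle_interval I -> test_function I f ->
      fj_operator N I (iota a) f = smeared X iota a f)
  /\
  (forall (V1 V2 : lmodType R[i]) (X1 : voa_data V1) (X2 : voa_data V2)
      (form1 : V1 -> V1 -> R[i]) (form2 : V2 -> V2 -> R[i])
      (iota1 : V1 -> H) (iota2 : V2 -> H),
    simple_unitary_strongly_local X1 ip iota1 form1 ->
    net_of_voa X1 ip iota1 N ->
    simple_unitary_strongly_local X2 ip iota2 form2 ->
    net_of_voa X2 ip iota2 N ->
    exists phi : V1 -> V2,
      [/\ linear phi, bijective phi & forall a, iota2 (phi a) = iota1 a] /\
      [/\ forall a n b, phi (vop X1 a n b) = vop X2 (phi a) n (phi b),
          phi (vacuum X1) = vacuum X2
        & phi (conformal_vector X1) = conformal_vector X2]).
Proof.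
split=> [V X form iota hS hN|V1 V2 X1 X2 form1 form2 iota1 iota2 hS1 hN1 hS2 hN2].
  split; first exact: range_Hfin hS hN.
  by move=> a qa I f cI tf; exact: (fj_operator_smeared hS hN qa cI tf).
have ex a : exists b, iota2 b = iota1 a.
  have [b _ hb] : range iota2 (iota1 a).
    by rewrite (range_Hfin hS2 hN2) -(range_Hfin hS1 hN1); exists a.
  by exists b.
have [phi phiE] := choice ex.
have [psi psiK] := choice (transfer_surjective hS1 hN1 hS2 hN2 phiE).
exists phi; split; split.
- exact: (transfer_linear hS1 hS2 phiE).
- exists psi => // a; apply: (transfer_injective hS1 phiE); exact: psiK.
- exact: phiE.
- exact: (transfer_vop hS1 hN1 hS2 hN2 phiE).
- exact: (transfer_vacuum hN1 hS2 hN2 phiE).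
- exact: (transfer_conformal hS1 hN1 hS2 hN2 phiE).
Qed.
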